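(* Let $f$ be a transcendental entire function with a multiply connected wandering domain $U$, and for $n\in\mathbb{N}$ let $U_n=f^n(U)$. For each $z_0 \in U$ and each open set $D \subset U$ containing $z_0$, there exists $\alpha > 0$ such that, for all sufficiently large $n \in \mathbb{N}$, $$U_n \supset f^n(D) \supset A\left(|f^n(z_0)|^{1-\alpha}, |f^n(z_0)|^{1+\alpha}\right).$$
   Context: $A(r,R)=\{z\in\mathbb{C}:r<|z|<R\}$ for $0<r<R$. A transcendental entire function is an entire function $f:\mathbb{C}\to\mathbb{C}$ that is not a polynomial; $f^n$ denotes its $n$-th iterate, and $\mathbb{N}=\{1,2,\dots\}$. The Fatou set $F(f)$ is the set of points of $\mathbb{C}$ having a neighbourhood on which the iterates $f^n$ form a normal family (locally uniform convergence to $\infty$ being allowed). A Fatou component is a connected component of $F(f)$. For a Fatou component $U$, $U_n$ denotes the Fatou component containing $f^n(U)$, with $U_0=U$; $U$ is a wandering domain if the sequence $(U_n)$ is not eventually periodic. A domain is multiply connected if it is not simply connected. By results of Baker, if $U$ is a multiply connected wandering domain then each $U_n$ is bounded and multiply connected, $U_n=f^n(U)$, for all large $n$ both $U_n$ and $0$ lie in a bounded complementary component of $U_{n+1}$, and $\mathrm{dist}(U_n,0)\to\infty$ as $n\to\infty$. *)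

(* Defs.v *)
From HB Require Import structures.
From mathcomp Require Import all_boot all_order all_algebra.
From mathcomp Require Import all_classical all_reals all_analysis.
From mathcomp Require Import complex.
Set Implicit Arguments.
Unset Strict Implicit.
Unset Printing Implicit Defensive.
Import Order.TTheory GRing.Theory Num.Theory.
Import numFieldNormedType.Exports.
Local Open Scope classical_set_scope.
Local Open Scope ring_scope.

(* The topology and the norm of the complex numbers come from their structure
   of regular module over themselves, hence the [^o]; in particular
   [derivable f z 1] is complex differentiability of [f] at [z]. *)
Notation Cplx R := (R[i]^o).

Definition cmod (R : realType) (z : Cplx R) : R := ComplexField.Normc.normc z.

Lemma cmodE (R : realType) (z : Cplx R) : `|z| = (cmod z)%:C%C.
Proof. by []. Qed.

Definition annulus (R : realType) (r s : R) : set (Cplx R) :=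
  [set z | r < cmod z < s].

Definition entire (R : realType) (f : Cplx R -> Cplx R) : Prop :=
  forall z, derivable f z 1.

Definition transcendental_entire (R : realType) (f : Cplx R -> Cplx R) : Prop :=
  entire f /\ ~ exists p : {poly R[i]}, forall z, f z = p.[z].

Definition locally_uniform_cvg (R : realType) (G : set (Cplx R))
    (g : nat -> Cplx R -> Cplx R) (h : Cplx R -> Cplx R) : Prop :=
  forall z, G z -> exists2 V, nbhs z V & {uniform V `&` G, g @ \oo --> h}.

Definition locally_uniform_cvg_infty (R : realType) (G : set (Cplx R))
    (g : nat -> Cplx R -> Cplx R) : Prop :=
  forall z, G z -> exists2 V, nbhs z V &
    forall M : R, \forall k \near \oo, forall w, V w -> G w -> M < cmod (g k w).

(* Locally uniform limits of holomorphic functions are holomorphic, so no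
   regularity is asked of the limit; [F] is the set of functions of the family
   and the sequence [g] may repeat members of [F]. *)
Definition normal_family (R : realType) (G : set (Cplx R))
    (F : set (Cplx R -> Cplx R)) : Prop :=
  forall g : nat -> Cplx R -> Cplx R, (forall k, F (g k)) ->
  exists phi : nat -> nat, {homo phi : m n / (m < n)%N} /\
    ((exists h, locally_uniform_cvg G (g \o phi) h) \/
     locally_uniform_cvg_infty G (g \o phi)).

Definition Fatou_set (R : realType) (f : Cplx R -> Cplx R) : set (Cplx R) :=
  [set z | exists2 G : set (Cplx R), open_nbhs z G &
     normal_family G [set iter n f | n in [set n | (0 < n)%N]]].

Definition Fatou_component (R : realType) (f : Cplx R -> Cplx R) :
    set (set (Cplx R)) :=
  connected_component (Fatou_set f) @` Fatou_set f.

(* The component containing [f^n(U)] is unique when [U] is nonempty, so that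
   [get] returns it. *)
Definition component_orbit (R : realType) (f : Cplx R -> Cplx R)
    (U : set (Cplx R)) (n : nat) : set (Cplx R) :=
  get [set V | Fatou_component f V /\ iter n f @` U `<=` V].

Definition eventually_periodic (T : Type) (u : nat -> T) : Prop :=
  exists N p : nat, (0 < p)%N /\ forall n, (N <= n)%N -> u (n + p)%N = u n.

Definition wandering_domain (R : realType) (f : Cplx R -> Cplx R)
    (U : set (Cplx R)) : Prop :=
  Fatou_component f U /\ ~ eventually_periodic (component_orbit f U).

Definition domain (R : realType) (U : set (Cplx R)) : Prop :=
  [/\ U !=set0, open U & connected U].

Definition loop_in (R : realType) (U : set (Cplx R)) (c : R -> Cplx R) : Prop :=
  [/\ {within `[0, 1], continuous c}, c @` `[0, 1] `<=` U & c 0 = c 1].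

(* Homotopy relative to the base point [c 0]. *)
Definition null_homotopic_in (R : realType) (U : set (Cplx R))
    (c : R -> Cplx R) : Prop :=
  exists H : R * R -> Cplx R,
  [/\ {within `[0, 1] `*` `[0, 1], continuous H},
      H @` (`[0, 1] `*` `[0, 1]) `<=` U,
      forall t, 0 <= t <= 1 -> H (0, t) = c t,
      forall t, 0 <= t <= 1 -> H (1, t) = c 0 &
      forall s, 0 <= s <= 1 -> H (s, 0) = c 0 /\ H (s, 1) = c 0].

Definition simply_connected (R : realType) (U : set (Cplx R)) : Prop :=
  domain U /\ forall c, loop_in U c -> null_homotopic_in U c.

Definition multiply_connected (R : realType) (U : set (Cplx R)) : Prop :=
  domain U /\ ~ simply_connected U.

(* Main.v *)
Require Import Defs.
From HB Require Import structures.
From mathcomp Require Import all_boot all_order all_algebra.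
From mathcomp Require Import all_classical all_reals all_analysis.
From mathcomp Require Import complex ring lra zify.
Set Implicit Arguments.
Unset Strict Implicit.
Unset Printing Implicit Defensive.
Import Order.TTheory GRing.Theory Num.Theory.
Import numFieldNormedType.Exports.
Local Open Scope classical_set_scope.
Local Open Scope ring_scope.

(* A loop of [U] that is not null-homotopic, once pushed to a fine lattice, winds around a point
   outside [U]; hence there is a bounded domain [W] with frontier in [U] that contains a point of
   the Julia set.  Normality on the frontier and the maximum principle then force some iterates to
   be large on the frontier while their images of [W] contain large discs.  As the images of the
   wandering domain [U] are pairwise disjoint, [f^n] tends to infinity uniformly on [U].

   Let [l_n = ln|f^n| / ln|f^n(z0)|].  If [l_n] tended to 1 near [z0] along some subsequence,
   Harnack's inequality and the three circles theorem would propagate this to all of [U], in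
   particular to the frontier of [W].  But the growth of the iterates of a transcendental function,
   [M(r^8, f^n) >= M(r, f^n)^4], yields a disc in [W] where [l_n <= 1/2], and the three circles
   theorem propagates a bound [l_n <= c < 1] from it through [W] up to the frontier, a
   contradiction.  So [|l_n - 1|] is bounded below somewhere near [z0] for all large [n].  The
   holomorphic functions [G_n = (log f^n - log f^n(z0)) / ln|f^n(z0)|] are therefore bounded by 2
   and not uniformly small near [z0]; if [G_n] omitted a small value [w], Harnack's inequality for
   [- ln|G_n - w|] would make it small.  Thus [G_n] covers a fixed disc about 0, and exponentiating
   gives the annulus. *)

(** * Holomorphic functions *)

(** The functions [f^n] have no finite limit on [U] to pass to, so every estimate bears on ratios of
    logarithms, with constants independent of [n]. For the same reason the growth inequality must
    hold for all iterates with the same numbers 8 and 4. If [l_n] tends to 1 on the frontier of [W],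
    then [f^n] is at most [expR (2 * L)] there, with [L = ln|f^n(z0)|]; the power 4 turns this
    exponent 2 into 1/2 on the disc of slow growth. Multiple connectivity enters through a single
    closed bounded set [S], not contained in [U], all of whose points outside [U] are interior to
    it. The annulus closes up because an angle of at most [pi] becomes at most [pi / L] in the scale
    of [G_n]: once [L] is large, a fixed disc about 0 in this scale contains a full turn. The
    function theory rests on rectangles: circles are vertical segments seen through the exponential,
    and derivatives are shown to be differentiable by the maximum principle applied to difference
    quotients, in the role usually played by Cauchy's formula. *)

Section ComplexPlane.
Variable R : realType.
Local Notation C := (R[i]).
Implicit Types (z w c : C) (r s e : R).

Lemma cmod_ge0 z : 0 <= cmod z.
Proof. by case: z => a b; rewrite /cmod /= sqrtr_ge0. Qed.

Lemma cmod0 : cmod (0 : C) = 0.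
Proof. exact: ComplexField.Normc.normc0. Qed.

Lemma cmod1 : cmod (1 : C) = 1.
Proof. exact: ComplexField.Normc.normc1. Qed.

Lemma cmodM z w : cmod (z * w) = cmod z * cmod w.
Proof. exact: ComplexField.Normc.normcM. Qed.

Lemma cmodV z : cmod (z^-1) = (cmod z)^-1.
Proof. exact: ComplexField.Normc.normcV. Qed.

Lemma cmodX z n : cmod (z ^+ n) = cmod z ^+ n.
Proof. by elim: n => [|n IH]; rewrite ?expr0 ?cmod1 // !exprS cmodM IH. Qed.

Lemma cmodD z w : cmod (z + w) <= cmod z + cmod w.
Proof. exact: le_normcD. Qed.

Lemma cmodN z : cmod (- z) = cmod z.
Proof. exact: normcN. Qed.

Lemma cmodB z w : cmod (z - w) = cmod (w - z).
Proof. by rewrite -cmodN opprB. Qed.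

Lemma cmod_tri z w c : cmod (z - w) <= cmod (z - c) + cmod (c - w).
Proof.
by apply: le_trans (cmodD _ _); rewrite (_ : z - c + (c - w) = z - w) //; ring.
Qed.

Lemma cmod_subl z w : cmod z - cmod w <= cmod (z - w).
Proof. by rewrite lerBlDr; apply: le_trans (cmodD _ _); rewrite subrK. Qed.

Lemma cmod_eq0 z : (cmod z == 0) = (z == 0).
Proof.
apply/eqP/eqP => [|->]; last exact: cmod0.
exact: ComplexField.Normc.eq0_normc.
Qed.

Lemma cmod_gt0 z : (0 < cmod z) = (z != 0).
Proof. by rewrite lt_def cmod_ge0 andbT cmod_eq0. Qed.

Lemma cmod_re z : `|complex.Re z| <= cmod z.
Proof. by rewrite -(lecR (`|_|)); exact: normc_ge_Re. Qed.

Lemma cmod_im z : `|complex.Im z| <= cmod z.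
Proof.
have := cmod_re (z * 'i%C); rewrite cmodM ReiNIm normrN.
by rewrite /cmod /= expr0n /= add0r expr1n sqrtr1 mulr1.
Qed.

Lemma cmod_real r : cmod (r%:C%C) = `|r|.
Proof. by rewrite /cmod /= expr0n /= addr0 sqrtr_sqr. Qed.

Lemma cmod_i : cmod ('i%C : C) = 1.
Proof. by rewrite /cmod /= expr0n /= add0r expr1n sqrtr1. Qed.

Lemma complexEi z : z = (complex.Re z)%:C%C + 'i%C * (complex.Im z)%:C%C.
Proof. exact: complexE. Qed.

Lemma cmod_le z : cmod z <= `|complex.Re z| + `|complex.Im z|.
Proof.
rewrite {1}(complexEi z); apply: le_trans (cmodD _ _) _.
by rewrite cmodM cmod_i mul1r !cmod_real.
Qed.

Lemma cmod_sqr z : cmod z ^+ 2 = complex.Re z ^+ 2 + complex.Im z ^+ 2.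
Proof. by case: z => a b; rewrite /cmod /= sqr_sqrtr // addr_ge0 // sqr_ge0. Qed.

Lemma cReB z w : complex.Re (z - w) = complex.Re z - complex.Re w.
Proof. by case: z w => a b [c d]. Qed.

Lemma cReD z w : complex.Re (z + w) = complex.Re z + complex.Re w.
Proof. by case: z w => a b [c d]. Qed.

Lemma cImB z w : complex.Im (z - w) = complex.Im z - complex.Im w.
Proof. by case: z w => a b [c d]. Qed.

Lemma cImD z w : complex.Im (z + w) = complex.Im z + complex.Im w.
Proof. by case: z w => a b [c d]. Qed.

Lemma cReM z w : complex.Re (z * w) =
  complex.Re z * complex.Re w - complex.Im z * complex.Im w.
Proof. by case: z w => a b [c d]. Qed.

Lemma cImM z w : complex.Im (z * w) =
  complex.Re z * complex.Im w + complex.Im z * complex.Re w.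
Proof. by case: z w => a b [c d]. Qed.

Lemma complex_ext z w : complex.Re z = complex.Re w ->
  complex.Im z = complex.Im w -> z = w.
Proof. by case: z w => a b [c d] /= -> ->. Qed.

Lemma nbhsC (z : Cplx R) (A : set (Cplx R)) :
  nbhs z A <-> exists2 e, 0 < e & forall w, cmod (w - z) < e -> A w.
Proof.
split=> [/nbhs_ballP[e e0 H]|[e e0 H]].
- move: e0 H; rewrite /= ltcE /= => /andP[/eqP e2 e1] H.
  exists (complex.Re e) => // w hw; apply: H.
  rewrite -ball_normE /= cmodE cmodB.
  by rewrite ltcE /= e2 eqxx.
- apply/nbhs_ballP; exists (e%:C%C); first by rewrite /= ltcR.
  move=> w; rewrite -ball_normE /= cmodE ltcR => hw.
  by apply: H; rewrite cmodB.
Qed.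

Lemma openC (A : set (Cplx R)) : open A <->
  forall z, A z -> exists2 e, 0 < e & forall w, cmod (w - z) < e -> A w.
Proof.
by rewrite openE; split=> H z /H; rewrite /interior => /nbhsC.
Qed.

Lemma closureC (A : set (Cplx R)) z : closure A z <->
  forall e, 0 < e -> exists2 w, A w & cmod (w - z) < e.
Proof.
split=> [H e e0|H B /nbhsC [e e0 he]].
  have [|w [Aw wB]] := H [set w | cmod (w - z) < e].
    by apply/nbhsC; exists e.
  by exists w.
by have [w Aw hw] := H e e0; exists w; split => //; apply: he.
Qed.

Lemma closedC (A : set (Cplx R)) : closed A <->
  forall z, (forall e, 0 < e -> exists2 w, A w & cmod (w - z) < e) -> A z.
Proof.
by split=> [H z /closureC /H //|H z /closureC]; apply: H.
Qed.

(** Connectedness is used in this form throughout the dynamics: boundedness of orbits, inclusion of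
    images and both ratio estimates spread from one point to the whole domain by showing that they
    are relatively open and closed. *)
Lemma connected_ind (U A : set (Cplx R)) : connected U ->
  (exists2 z, U z & A z) ->
  (forall z, U z -> A z -> exists2 e, 0 < e &
     forall w, cmod (w - z) < e -> U w -> A w) ->
  (forall z, U z -> (forall e, 0 < e -> exists2 w, cmod (w - z) < e & U w /\ A w)
     -> A z) ->
  U `<=` A.
Proof.
move=> Uc [z0 Uz0 Az0] Aop Acl.
suff <- : U `&` A = U by apply: subIsetr.
apply: Uc; first by exists z0.
- exists [set z | exists2 e, 0 < e & forall w, cmod (w - z) < e -> U w -> A w].
    apply/openC => z [e e0 he]; exists (e / 2); first by rewrite divr_gt0.
    move=> w hw; exists (e / 2); first by rewrite divr_gt0.
    move=> v hv; apply: he; apply: le_lt_trans (cmod_tri v z w) _.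
    by rewrite (splitr e) ltrD.
  apply/seteqP; split=> z [Uz Az]; split => //; first exact: Aop.
  by move: Az => [e e0 he]; apply: he => //; rewrite subrr cmod0.
- exists (closure (U `&` A)); first exact: closed_closure.
  apply/seteqP; split=> z [Uz Az]; split => //.
    exact: subset_closure.
  apply: Acl => // e e0; have [w [Uw Aw] hw] := (closureC _ _).1 Az e e0.
  by exists w.
Qed.

Definition ccont (f : C -> C) z := forall e, 0 < e -> exists2 d, 0 < d &
  forall w, cmod (w - z) < d -> cmod (f w - f z) < e.

Lemma ccontP (f : Cplx R -> Cplx R) z : ccont f z <-> {for z, continuous f}.
Proof.
split=> [H A /nbhsC [e e0 he]|H e e0].
  have [d d0 hd] := H e e0.
  by apply/nbhsC; exists d => // w /hd; apply: he.
have /nbhsC [d d0 hd] : nbhs (z : Cplx R) [set w : Cplx R | cmod (f w - f z) < e].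
  apply: (H [set w : Cplx R | cmod (w - f z) < e]).
  by apply/nbhsC; exists e.
by exists d.
Qed.

(** A bound on the remainder instead of a limit of quotients, so that [h = 0] is not a special
    case. *)
Definition cder (f : C -> C) z l := forall e, 0 < e -> exists2 d, 0 < d &
  forall h, cmod h < d -> cmod (f (z + h) - f z - l * h) <= e * cmod h.

Lemma cder_derivable (f : Cplx R -> Cplx R) z : derivable f z 1 ->
  exists l, cder f z l.
Proof.
move=> /cvg_ex [l Hl]; exists l => e e0.
have := Hl [set w | cmod (w - l) < e].
have hn : nbhs l [set w : Cplx R | cmod (w - l) < e] by apply/nbhsC; exists e.
move=> /(_ hn); rewrite /= => /nbhsC [d d0 hd].
exists d => // h hh.
have [->|h0] := eqVneq h 0.
  by rewrite addr0 subrr mulr0 subrr cmod0 mulr0.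
have := hd h; rewrite subr0 => /(_ hh h0) /=.
rewrite /GRing.scale /= mulr1 => hlt.
have -> : f (z + h) - f z - l * h = (h^-1 * (f (h + z) - f z) - l) * h.
  by rewrite (addrC z) mulrBl mulrAC mulVf // mul1r.
by rewrite cmodM ler_wpM2r ?cmod_ge0 // ltW.
Qed.

Lemma cder_cont f z l : cder f z l -> ccont f z.
Proof.
move=> H e e0; have [d d0 hd] := H 1 ltr01.
have c0 : 0 < 1 + cmod l by rewrite ltr_pwDl // cmod_ge0.
exists (Num.min d (e / (1 + cmod l))); first by rewrite lt_min d0 divr_gt0.
move=> w; rewrite lt_min => /andP[h1 h2].
have := hd _ h1; rewrite (addrC z) subrK mul1r => h3.
have : cmod (f w - f z) <= (1 + cmod l) * cmod (w - z).
  have -> : f w - f z = (f w - f z - l * (w - z)) + l * (w - z) by ring.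
  apply: le_trans (cmodD _ _) _; rewrite mulrDl mul1r cmodM.
  by rewrite lerD2r.
move=> /le_lt_trans; apply; rewrite mulrC -ltr_pdivlMr //.
Qed.

Lemma cder_unique f z l l' : cder f z l -> cder f z l' -> l = l'.
Proof.
move=> H H'; apply/eqP; rewrite -subr_eq0 -cmod_eq0; apply/eqP.
apply/le_anti; rewrite cmod_ge0 andbT; apply/ler_addgt0Pr => e e0; rewrite add0r.
have e2 : 0 < e / 2 by rewrite divr_gt0.
have [d d0 hd] := H _ e2; have [d' d'0 hd'] := H' _ e2.
pose m := Num.min d d' / 2.
have m0 : 0 < m by rewrite divr_gt0 // lt_min d0.
have cm : cmod (m%:C%C) = m by rewrite cmod_real gtr0_norm.
have mm : m < Num.min d d' by rewrite /m ltr_pdivrMr // mulr2n mulrDr mulr1 ltrDl lt_min d0.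
move: mm; rewrite lt_min => /andP[md md'].
have := hd m%:C%C; rewrite cm => /(_ md) h1.
have := hd' m%:C%C; rewrite cm => /(_ md') h2.
have : cmod ((l - l') * m%:C%C) <= e * m.
  have -> : (l - l') * m%:C%C = (f (z + m%:C%C) - f z - l' * m%:C%C) -
       (f (z + m%:C%C) - f z - l * m%:C%C) by ring.
  apply: le_trans (cmodD _ _) _; rewrite cmodN (splitr e) mulrDl.
  exact: lerD.
by rewrite cmodM cm ler_pM2r.
Qed.

Lemma cder_ext f g z l : (exists2 d, 0 < d & forall w, cmod (w - z) < d -> f w = g w) ->
  cder f z l -> cder g z l.
Proof.
move=> [d d0 hd] H e e0; have [d' d'0 hd'] := H e e0.
exists (Num.min d d'); first by rewrite lt_min d0.
move=> h; rewrite lt_min => /andP[h1 h2].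
have -> : g (z + h) = f (z + h) by rewrite hd // (addrC z) addrK.
have -> : g z = f z by rewrite hd // subrr cmod0.
exact: hd'.
Qed.

Lemma ccont_ext f g z : (exists2 d, 0 < d & forall w, cmod (w - z) < d -> f w = g w) ->
  ccont f z -> ccont g z.
Proof.
move=> [d d0 hd] H e e0; have [d' d'0 hd'] := H e e0.
exists (Num.min d d'); first by rewrite lt_min d0.
move=> h; rewrite lt_min => /andP[h1 h2].
by rewrite -!hd ?subrr ?cmod0 //; exact: hd'.
Qed.

Lemma cder_cst c z : cder (fun=> c) z 0.
Proof.
move=> e e0; exists 1 => // h _; rewrite subrr mul0r subr0 cmod0.
by rewrite mulr_ge0 ?cmod_ge0 // ltW.
Qed.

Lemma cder_id z : cder id z 1.
Proof.
move=> e e0; exists 1 => // h _; rewrite mul1r (addrC z) addrK subrr cmod0.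
by rewrite mulr_ge0 ?cmod_ge0 // ltW.
Qed.

Lemma cderD f g z l m : cder f z l -> cder g z m ->
  cder (fun w => f w + g w) z (l + m).
Proof.
move=> F G e e0; have e2 : 0 < e / 2 by rewrite divr_gt0.
have [d d0 hd] := F _ e2; have [d' d'0 hd'] := G _ e2.
exists (Num.min d d'); first by rewrite lt_min d0.
move=> h; rewrite lt_min => /andP[h1 h2].
have -> : f (z + h) + g (z + h) - (f z + g z) - (l + m) * h =
  (f (z + h) - f z - l * h) + (g (z + h) - g z - m * h) by ring.
apply: le_trans (cmodD _ _) _; rewrite (splitr e) mulrDl.
by apply: lerD; [exact: hd | exact: hd'].
Qed.

Lemma ccontM f g z : ccont f z -> ccont g z -> ccont (fun w => f w * g w) z.
Proof.
move=> F G e e0.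
pose M := 1 + cmod (f z) + cmod (g z).
have M0 : 0 < M.
  by rewrite /M; have := cmod_ge0 (f z); have := cmod_ge0 (g z); lra.
pose e1 := Num.min 1 (e / (2 * M)).
have e10 : 0 < e1 by rewrite lt_min ltr01 divr_gt0 // mulr_gt0.
have [d d0 hd] := F _ e10; have [d' d'0 hd'] := G _ e10.
exists (Num.min d d'); first by rewrite lt_min d0.
move=> w; rewrite lt_min => /andP[/hd h1 /hd' h2].
have -> : f w * g w - f z * g z = (f w - f z) * (g w - g z) + f z * (g w - g z)
  + (f w - f z) * g z by ring.
apply: le_lt_trans (cmodD _ _) _.
apply: (@le_lt_trans _ _ (e1 * M)); last first.
  have : e1 <= e / (2 * M) by rewrite ge_min lexx orbT.
  rewrite ler_pdivlMr ?mulr_gt0 // => h.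
  have : e1 * M * 2 <= e by rewrite -mulrA (mulrC M).
  have : 0 < e1 * M by rewrite mulr_gt0.
  by lra.
apply: le_trans (lerD (cmodD _ _) (lexx _)) _; rewrite !cmodM /M !mulrDr mulr1.
have e1l : e1 <= 1 by rewrite ge_min lexx.
apply: lerD; last by rewrite ler_wpM2r ?cmod_ge0 // ltW.
apply: lerD; last by rewrite mulrC ler_wpM2r ?cmod_ge0 // ltW.
rewrite -(mulr1 e1) ler_pM ?cmod_ge0 ?ltW //.
exact: lt_le_trans h2 _.
Qed.

Lemma ccontD f g z : ccont f z -> ccont g z -> ccont (fun w => f w + g w) z.
Proof.
move=> F G e e0; have e2 : 0 < e / 2 by rewrite divr_gt0.
have [d d0 hd] := F _ e2; have [d' d'0 hd'] := G _ e2.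
exists (Num.min d d'); first by rewrite lt_min d0.
move=> h; rewrite lt_min => /andP[h1 h2].
have -> : f h + g h - (f z + g z) = (f h - f z) + (g h - g z) by ring.
apply: le_lt_trans (cmodD _ _) _; rewrite (splitr e).
by apply: ltrD; [exact: hd | exact: hd'].
Qed.

Lemma ccont_cst c z : ccont (fun=> c) z.
Proof. exact: cder_cont (cder_cst c z). Qed.

Lemma ccont_id z : ccont id z.
Proof. exact: cder_cont (cder_id z). Qed.

Lemma ccontN f z : ccont f z -> ccont (fun w => - f w) z.
Proof.
move=> H e e0; have [d d0 hd] := H e e0; exists d => // w /hd.
by rewrite -opprD cmodN.
Qed.

Lemma ccontB f g z : ccont f z -> ccont g z -> ccont (fun w => f w - g w) z.
Proof. by move=> F G; apply: ccontD => //; exact: ccontN. Qed.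

(** Caratheodory's criterion. The slope [g] is a function continuous at [z], so the product, chain
    and inverse rules reduce to algebra with slopes. *)
Lemma cderP f z l : cder f z l <-> exists2 g, ccont g z &
  g z = l /\ forall w, f w - f z = g w * (w - z).
Proof.
split=> [H|[g gc [gl hg]] e e0].
  exists (fun w => if w == z then l else (f w - f z) / (w - z)); last first.
    rewrite eqxx; split => // w; case: eqVneq => [->|wz]; first by rewrite !subrr mulr0.
    by rewrite divfK // subr_eq0.
  move=> e e0; have e2 : 0 < e / 2 by rewrite divr_gt0.
  have [d d0 hd] := H _ e2; exists d => // w hw.
  rewrite /= eqxx; case: (eqVneq w z) => [_|wz]; first by rewrite subrr cmod0.
  have wz0 : w - z != 0 by rewrite subr_eq0.
  have -> : (f w - f z) / (w - z) - l = (f (z + (w - z)) - f z - l * (w - z)) / (w - z).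
    by rewrite (addrC z) subrK; field.
  rewrite cmodM cmodV ltr_pdivrMr ?cmod_gt0 //.
  apply: le_lt_trans (hd _ hw) _.
  by rewrite ltr_pM2r ?cmod_gt0 // ltr_pdivrMr // ltr_pMr // ltr1n.
have [d d0 hd] := gc e e0; exists d => // h hh.
have -> : f (z + h) - f z - l * h = (g (z + h) - g z) * h.
  by rewrite hg gl (addrC z) addrK mulrBl.
rewrite cmodM ler_wpM2r ?cmod_ge0 //; apply/ltW/hd.
by rewrite (addrC z) addrK.
Qed.

Lemma cderM f g z l m : cder f z l -> cder g z m ->
  cder (fun w => f w * g w) z (l * g z + f z * m).
Proof.
move=> F G; have gc := cder_cont G.
move: F G => /cderP [p pc [pl hp]] /cderP [q qc [ql hq]]; apply/cderP.
exists (fun w => p w * g w + f z * q w).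
  by apply: ccontD; apply: ccontM => //; exact: ccont_cst.
rewrite pl ql; split=> // w.
have -> : f w * g w - f z * g z = (f w - f z) * g w + f z * (g w - g z) by ring.
by rewrite hp hq; ring.
Qed.

Lemma ccont_comp f g z : ccont g z -> ccont f (g z) -> ccont (fun w => f (g w)) z.
Proof.
move=> G F e e0; have [d d0 hd] := F e e0; have [d' d'0 hd'] := G _ d0.
by exists d' => // w /hd' /hd.
Qed.

Lemma cder_comp f g z l m : cder g z m -> cder f (g z) l ->
  cder (fun w => f (g w)) z (l * m).
Proof.
move=> G F; have gc := cder_cont G.
move: F G => /cderP [p pc [pl hp]] /cderP [q qc [ql hq]]; apply/cderP.
exists (fun w => p (g w) * q w).
  by apply: ccontM => //; exact: ccont_comp.
by rewrite pl ql; split => // w; rewrite hp hq mulrA.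
Qed.

Lemma ccontV f z : f z != 0 -> ccont f z -> ccont (fun w => (f w)^-1) z.
Proof.
move=> fz F e e0; have fz0 : 0 < cmod (f z) by rewrite cmod_gt0.
pose m := Num.min (cmod (f z) / 2) (e * cmod (f z) ^+ 2 / 2).
have m0 : 0 < m by rewrite lt_min !divr_gt0 // mulr_gt0 // exprn_gt0.
have [d d0 hd] := F _ m0; exists d => // w /hd; rewrite lt_min => /andP[h1 h2].
have fw : cmod (f z) / 2 < cmod (f w).
  by have := cmod_subl (f z) (f w); rewrite cmodB; lra.
have fw0 : f w != 0 by rewrite -cmod_gt0; apply: le_lt_trans fw; lra.
have -> : (f w)^-1 - (f z)^-1 = (f z - f w) / (f w * f z) by field; apply/andP.
rewrite cmodM cmodV cmodM cmodB ltr_pdivrMr ?mulr_gt0 ?cmod_gt0 //.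
apply: lt_trans h2 _.
rewrite -mulrA ltr_pM2l // expr2 -mulrA mulrC -subr_gt0 -mulrBl mulr_gt0 //; lra.
Qed.

Lemma cderV f z l : f z != 0 -> cder f z l ->
  cder (fun w => (f w)^-1) z (- l / f z ^+ 2).
Proof.
move=> fz F; have fc := cder_cont F.
move: F => /cderP [p pc [pl hp]]; apply/cderP.
(* The slope identity must hold for every [w], including zeros of [f], where the inverse is 0 by
   convention; by continuity this branch is not met near [z]. *)
exists (fun w => if f w == 0 then ((f w)^-1 - (f z)^-1) / (w - z) else - p w / (f w * f z)).
  have : ccont (fun w => - p w / (f w * f z)) z.
    apply: ccontM; first exact: ccontN.
    apply: ccontV; first by rewrite mulf_neq0.
    by apply: ccontM => //; exact: ccont_cst.
  apply: ccont_ext; have [d' d'0 hd'] := fc (cmod (f z)) ltac:(by rewrite cmod_gt0).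
  exists d' => // w /hd' h; case: eqP => // fw0; move: h.
  by rewrite fw0 sub0r cmodN ltxx.
rewrite (negPf fz) pl expr2; split=> // w.
have [fw0|fw0] := eqVneq (f w) 0.
  have [->|wz] := eqVneq w z; first by rewrite !subrr mulr0.
  by rewrite divfK // subr_eq0.
have -> : (f w)^-1 - (f z)^-1 = - (f w - f z) / (f w * f z) by field; apply/andP.
by rewrite hp; field; apply/andP.
Qed.

Lemma cderZ k f z l : cder f z l -> cder (fun w => k * f w) z (k * l).
Proof. by move=> F; have := cderM (cder_cst k z) F; rewrite mul0r add0r. Qed.

Lemma cderN f z l : cder f z l -> cder (fun w => - f w) z (- l).
Proof.
move=> /(cderZ (-1)); rewrite mulN1r; apply: cder_ext; exists 1 => // w _.
by rewrite mulN1r.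
Qed.

Lemma cderB f g z l m : cder f z l -> cder g z m ->
  cder (fun w => f w - g w) z (l - m).
Proof. by move=> F G; apply: cderD => //; exact: cderN. Qed.

Definition cdiff (f : C -> C) z := exists l, cder f z l.

Lemma cdiff_cont f z : cdiff f z -> ccont f z.
Proof. by move=> [l]; exact: cder_cont. Qed.

Lemma cdiff_ext f g z : (exists2 d, 0 < d & forall w, cmod (w - z) < d -> f w = g w) ->
  cdiff f z -> cdiff g z.
Proof. by move=> H [l F]; exists l; exact: cder_ext F. Qed.

Lemma cdiff_cst c z : cdiff (fun=> c) z.
Proof. by exists 0; exact: cder_cst. Qed.

Lemma cdiff_id z : cdiff id z.
Proof. by exists 1; exact: cder_id. Qed.

Lemma cdiffD f g z : cdiff f z -> cdiff g z -> cdiff (fun w => f w + g w) z.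
Proof. by move=> [l F] [m G]; exists (l + m); apply: cderD. Qed.

Lemma cdiffN f z : cdiff f z -> cdiff (fun w => - f w) z.
Proof. by move=> [l F]; exists (- l); exact: cderN. Qed.

Lemma cdiffB f g z : cdiff f z -> cdiff g z -> cdiff (fun w => f w - g w) z.
Proof. by move=> F G; apply: cdiffD => //; exact: cdiffN. Qed.

Lemma cdiffM f g z : cdiff f z -> cdiff g z -> cdiff (fun w => f w * g w) z.
Proof. by move=> [l F] [m G]; exists (l * g z + f z * m); apply: cderM. Qed.

Lemma cdiffV f z : f z != 0 -> cdiff f z -> cdiff (fun w => (f w)^-1) z.
Proof. by move=> fz [l F]; exists (- l / f z ^+ 2); apply: cderV. Qed.

Lemma cdiff_div f g z : g z != 0 -> cdiff f z -> cdiff g z ->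
  cdiff (fun w => f w / g w) z.
Proof. by move=> gz F G; apply: cdiffM => //; exact: cdiffV. Qed.

Lemma cdiffX f n z : cdiff f z -> cdiff (fun w => f w ^+ n) z.
Proof.
move=> F; elim: n => [|n IH]; first exact: cdiff_cst.
have [l L] := cdiffM F IH; exists l; apply: cder_ext L; exists 1 => // w _.
by rewrite exprS.
Qed.

Lemma cdiff_comp f g z : cdiff g z -> cdiff f (g z) -> cdiff (fun w => f (g w)) z.
Proof. by move=> [m G] [l F]; exists (l * m); apply: (cder_comp G F). Qed.

Lemma cdiff_subz c z : cdiff (fun w => w - c) z.
Proof. by apply: cdiffB; [exact: cdiff_id | exact: cdiff_cst]. Qed.

Lemma cmod_cont f z : ccont f z -> forall e, 0 < e -> exists2 d, 0 < d &
  forall w, cmod (w - z) < d -> `|cmod (f w) - cmod (f z)| < e.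
Proof.
move=> F e e0; have [d d0 hd] := F e e0; exists d => // w /hd.
apply: le_lt_trans; rewrite ler_norml cmod_subl andbT lerNl opprB cmodB.
exact: cmod_subl.
Qed.

End ComplexPlane.

(** * Compactness on the line and in the plane *)

Section Compactness.
Variable R : realType.
Local Notation C := (R[i]).
Implicit Types (z w c : C) (r s e : R).

Definition bounded_by (A : set C) r := forall z, A z -> cmod z <= r.

Lemma compactC (A : set (Cplx R)) r : closed A -> bounded_by A r -> compact A.
Proof.
move=> cA bA.
pose g (p : R * R) : Cplx R := Complex p.1 p.2.
apply: (@subclosed_compact _ _ (g @` (`[-r, r] `*` `[-r, r]))) => //.
  apply: continuous_compact; last by apply: compact_setX; exact: segment_compact.
  apply: continuous_subspaceT => p A' /nbhsC [e e0 he].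
  have e2 : 0 < e / 2 by rewrite divr_gt0.
  apply/nbhs_ballP; exists (e / 2) => //= q [/= h1 h2]; apply: he.
  apply: le_lt_trans (cmod_le _) _; rewrite /= (splitr e).
  by apply: ltrD; rewrite distrC; [exact: h1|exact: h2].
move=> z Az; exists (complex.Re z, complex.Im z); last by case: {Az} z.
have := bA _ Az; have := cmod_re z; have := cmod_im z.
rewrite /= !in_itv /= -!ler_norml => h1 h2 h3; split; exact: le_trans h3.
Qed.

Lemma compact_max (A : set (Cplx R)) r (u : C -> R) : closed A -> bounded_by A r ->
  A !=set0 ->
  (forall z, A z -> forall e, 0 < e -> exists2 d, 0 < d &
     forall w, A w -> cmod (w - z) < d -> `|u w - u z| < e) ->
  exists2 z, A z & forall w, A w -> u w <= u z.
Proof.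
move=> cA bA A0 uc.
have [||c /set_mem Ac hc] := @compact_EVT_max (Cplx R) R u A A0.
- exact: compactC bA.
- apply/subspace_continuousP => z Az; apply/cvgrPdist_lt => e e0.
  have [d d0 hd] := uc z Az e e0; apply/nbhsC; exists d => // w hw Aw.
  by rewrite distrC; apply: hd.
- by exists c => // w Aw; apply: hc; rewrite inE.
Qed.

Lemma bw_real (u : nat -> R) M : (forall n, `|u n| <= M) ->
  exists2 f : nat -> nat, {homo f : m n / (m < n)%N} & exists l : R,
   forall e, 0 < e -> exists N, forall n, (N <= n)%N -> `|u (f n) - l| < e.
Proof.
move=> hu; have [|f fi fc] := @bolzano_weierstrass R u.
  exists M; split; first exact: num_real.
  by move=> x Mx n _ /=; apply: le_trans (hu n) (ltW Mx).
exists f.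
  by move=> m n mn; rewrite ltnNge -leEnat fi -ltnNge.
exists (limn (u \o f)) => e e0.
have := fc => /cvgrPdist_lt /(_ _ e0) [N _ hN].
by exists N => n Nn; rewrite distrC; apply: hN.
Qed.

Lemma bwC (u : nat -> C) M : (forall n, cmod (u n) <= M) ->
  exists2 f : nat -> nat, {homo f : m n / (m < n)%N} & exists l : C,
   forall e, 0 < e -> exists N, forall n, (N <= n)%N -> cmod (u (f n) - l) < e.
Proof.
move=> hu.
have [f fi [l hl]] := @bw_real (fun n => complex.Re (u n)) M
   (fun n => le_trans (cmod_re _) (hu n)).
have [g gi [m hm]] := @bw_real (fun n => complex.Im (u (f n))) M
   (fun n => le_trans (cmod_im _) (hu (f n))).
have gn n : (n <= g n)%N.
  by elim: n => // n IH; apply: leq_ltn_trans IH _; exact: gi.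
exists (f \o g); first by move=> i j ij; apply/fi/gi.
exists (Complex l m) => e e0.
have e2 : 0 < e / 2 by rewrite divr_gt0.
have [N1 h1] := hl _ e2; have [N2 h2] := hm _ e2.
exists (maxn N1 N2) => n; rewrite geq_max => /andP[n1 n2].
apply: le_lt_trans (cmod_le _) _; rewrite cReB cImB (splitr e) /=.
apply: ltrD; last exact: h2.
by apply: h1; apply: leq_trans n1 (gn n).
Qed.

End Compactness.

(** * Real primitives and integrals with bounds in any order *)

Section Antiderivative.
Variable R : realType.
Implicit Types (f g P : R -> R) (a b x y : R).

Lemma deriv0_cst P a b : a <= b -> (forall x, a <= x <= b -> is_derive x 1 P 0) ->
  P a = P b.
Proof.
move=> ab H.
have [||c _] := @MVT_segment R P (fun=> 0) a b ab.
- by move=> x; rewrite in_itv /= => /andP[h1 h2]; apply: H; rewrite !ltW.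
- apply: derivable_within_continuous => x; rewrite in_itv /= => hx.
  by have [] := H x hx.
by rewrite mul0r => /eqP; rewrite subr_eq0 => /eqP.
Qed.

Lemma antider_right f a : continuous f ->
  exists P, forall x, a < x -> is_derive x 1 P (f x).
Proof.
move=> fc; exists (fun x => (\int[lebesgue_measure]_(t in [set` Interval (BLeft a) (BRight x)]) f t)%R).
move=> x ax; have xx : x < x + 1 by rewrite ltrDl.
have [|||dF dE] := @continuous_FTC1 R f (BLeft a) x (x + 1) xx.
- apply: continuous_compact_integrable; first exact: segment_compact.
  exact: continuous_subspaceT.
- by rewrite lte_fin.
- exact: fc.
by apply: DeriveDef => //; rewrite -derive1E.
Qed.

(** Integration from a base point gives a primitive to the right of it only. The primitives based at
    [- n.+1] are normalised at 0 and glued: two of them differ by a constant on their common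
    domain. *)
Lemma antider_ex f : continuous f -> exists P, forall x, is_derive x 1 P (f x).
Proof.
move=> fc.
have /choice [P hP] : forall n : nat, exists P, forall x, - n.+1%:R < x -> is_derive x 1 P (f x).
  by move=> n; exact: antider_right.
pose N (x : R) := Num.truncn `|x|.
have NE x n : (N x <= n)%N = (`|x| < n.+1%:R) by rewrite /N truncn_le_nat.
have NP x n : (N x <= n)%N -> - n.+1%:R < x.
  by rewrite NE ltr_norml => /andP[].
have glue x m n : (N x <= m)%N -> (N x <= n)%N -> P m x - P m 0 = P n x - P n 0.
  move=> hm hn.
  have hN0 k : - k.+1%:R < (0 : R) by rewrite oppr_lt0 ltr0n.
  suff H a b : a <= b -> - m.+1%:R < a -> - n.+1%:R < a -> P m a - P n a = P m b - P n b.
    have [x0|x0] := leP x 0.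
      by have := H x 0 x0 (NP _ _ hm) (NP _ _ hn); lra.
    by have := H 0 x (ltW x0) (hN0 _) (hN0 _); lra.
  move=> ab am an; apply: (@deriv0_cst (fun t => P m t - P n t)) => // t /andP[ta tb].
  rewrite -(subrr (f t)).
  by apply: is_deriveB; apply: hP; [exact: lt_le_trans am ta|exact: lt_le_trans an ta].
exists (fun x => P (N x) x - P (N x) 0) => x.
pose n := (N x).+1.
have D := hP n x (NP x n (leqW (leqnn _))).
have D' : is_derive x 1 (fun t => P n t - P n 0) (f x).
  by rewrite -(subr0 (f x)); apply: is_deriveB.
apply: near_eq_is_derive D'.
apply/nbhs_ballP; exists 1 => //= t xt; apply: glue => //; rewrite NE.
have h1 : `|x| < (N x).+1%:R by rewrite -NE.
have h2 : `|t - x| < 1 by rewrite distrC.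
rewrite /n -natr1; have := ler_normD (t - x) x; rewrite subrK; lra.
Qed.

Definition antider f : R -> R := xget (fun=> 0) [set P | forall x, is_derive x 1 P (f x)].

Lemma antiderP f : continuous f -> forall x, is_derive x 1 (antider f) (f x).
Proof.
move=> /antider_ex [P hP].
exact: (@xgetI _ (fun=> 0) [set P | forall x, is_derive x 1 P (f x)] P hP).
Qed.

(** As a difference of values of one global primitive, the integral is additive and antisymmetric in
    its bounds whatever their order. *)
Definition Int f a b := antider f b - antider f a.

Lemma IntP f P a b : continuous f -> a <= b ->
  (forall x, a <= x <= b -> is_derive x 1 P (f x)) -> Int f a b = P b - P a.
Proof.
move=> fc ab H; rewrite /Int.
suff : antider f a - P a = antider f b - P b by lra.
apply: (@deriv0_cst (fun x => antider f x - P x)) => // x /H D.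
by rewrite -(subrr (f x)); apply: is_deriveB; exact: antiderP.
Qed.

Lemma Int_mvt f a b : continuous f -> a <= b ->
  exists2 c, a <= c <= b & Int f a b = f c * (b - a).
Proof.
move=> fc ab; have [||c] := @MVT_segment R (antider f) f a b ab.
- by move=> x _; exact: antiderP.
- apply: derivable_within_continuous => x _.
  by have [] := antiderP fc x.
by rewrite in_itv /= => h1 h2; exists c.
Qed.

Lemma Int_cat f a b c : Int f a b + Int f b c = Int f a c.
Proof. by rewrite /Int; ring. Qed.

Lemma Int_swap f a b : Int f a b = - Int f b a.
Proof. by rewrite /Int opprB. Qed.

Lemma IntD f g a b : continuous f -> continuous g -> a <= b ->
  Int (fun x => f x + g x) a b = Int f a b + Int g a b.
Proof.
move=> fc gc ab.
transitivity ((antider f b + antider g b) - (antider f a + antider g a)); last by rewrite /Int; ring.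
apply: (@IntP _ (fun x => antider f x + antider g x)) => //.
- by move=> x; apply: cvgD; [exact: fc|exact: gc].
- by move=> x _; apply: is_deriveD; exact: antiderP.
Qed.

Lemma Int_affine p q a b : a <= b ->
  Int (fun x => p + q * x) a b = p * (b - a) + q * (b ^+ 2 - a ^+ 2) / 2.
Proof.
move=> ab.
transitivity ((p * b + q / 2 * (b * b)) - (p * a + q / 2 * (a * a))); last by field.
apply: (@IntP _ (fun x => p * x + q / 2 * (x * x))) => //.
- move=> x; apply: cvgD; first exact: cvg_cst.
  apply: cvgM; first exact: cvg_cst. exact: cvg_id.
- move=> x _; apply: is_derive_eq.
  by rewrite /GRing.scale /= !mulr1; field.
Qed.

Lemma Int_ge0 f a b : continuous f -> a <= b -> (forall x, a <= x <= b -> 0 <= f x) ->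
  0 <= Int f a b.
Proof.
move=> fc ab H; have [c /H h ->] := Int_mvt fc ab.
by rewrite mulr_ge0 // subr_ge0.
Qed.

Lemma Int_abs_le f a b M : continuous f -> a <= b ->
  (forall x, a <= x <= b -> `|f x| <= M) -> `|Int f a b| <= M * (b - a).
Proof.
move=> fc ab H; have [c /H h ->] := Int_mvt fc ab.
have b0 : 0 <= b - a by rewrite subr_ge0.
by rewrite normrM (ger0_norm b0) ler_wpM2r.
Qed.

Lemma Int_eq0 f a b x : continuous f -> (forall x, a <= x <= b -> 0 <= f x) ->
  Int f a b = 0 -> a < x < b -> f x = 0.
Proof.
move=> fc H I0 /andP[ax xb]; apply/le_anti/andP; split; last by apply: H; rewrite !ltW.
rewrite leNgt; apply/negP => fx0; have f2 : 0 < f x / 2 by rewrite divr_gt0.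
have := fc x => /cvgrPdist_lt /(_ _ f2) /nbhs_ballP [e /= e0 he].
pose d := Num.min e (Num.min (x - a) (b - x)) / 2.
have m0 : 0 < Num.min e (Num.min (x - a) (b - x)) by rewrite !lt_min e0 !subr_gt0 ax.
have d0 : 0 < d by rewrite divr_gt0.
have : d < Num.min e (Num.min (x - a) (b - x)) by rewrite /d ltr_pdivrMr // ltr_pMr // ltr1n.
rewrite !lt_min => /and3P[de dxa dbx].
have dd : x - d <= x + d by lra.
have [c /andP[c1 c2] Ic] := Int_mvt fc dd.
have : ball x e c.
  by rewrite -ball_normE /=; apply: le_lt_trans de; rewrite ler_norml; apply/andP; split; lra.
move=> /he; rewrite ltr_norml => /andP[h1 h2].
have I1 : 0 <= Int f a (x - d).
  by apply: Int_ge0 => //; [lra|move=> y /andP[y1 y2]; apply: H; apply/andP; split; lra].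
have I2 : 0 <= Int f (x + d) b.
  by apply: Int_ge0 => //; [lra|move=> y /andP[y1 y2]; apply: H; apply/andP; split; lra].
have I3 : 0 < Int f (x - d) (x + d).
  by rewrite Ic; apply: mulr_gt0; lra.
have := Int_cat f a (x - d) (x + d); have := Int_cat f a (x + d) b; lra.
Qed.

End Antiderivative.

(** * The complex exponential and polar coordinates *)

Section ComplexExponential.
Variable R : realType.
Local Notation C := (R[i]).
Implicit Types (z w c : C) (r s e : R).

Definition cexp z : C := (expR (complex.Re z))%:C%C * Complex (cos (complex.Im z)) (sin (complex.Im z)).

Lemma cexpE a b : cexp (Complex a b) = Complex (expR a * cos b) (expR a * sin b).
Proof. by rewrite /cexp; apply: complex_ext; rewrite /= !mul0r ?subr0 ?addr0. Qed.

Lemma cexp0 : cexp 0 = 1.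
Proof. by rewrite /cexp /= expR0 cos0 sin0 mul1r. Qed.

Lemma cexpD z w : cexp (z + w) = cexp z * cexp w.
Proof.
case: z w => a b [c d]; rewrite -[Complex a b + _]/(Complex (a + c) (b + d)).
rewrite !cexpE expRD cosD sinD.
by apply: complex_ext => /=; ring.
Qed.

Lemma cmod_cexp z : cmod (cexp z) = expR (complex.Re z).
Proof.
rewrite cmodM cmod_real ger0_norm ?expR_ge0 //.
by rewrite /cmod /= cos2Dsin2 sqrtr1 mulr1.
Qed.

Lemma cexp_neq0 z : cexp z != 0.
Proof. by rewrite -cmod_gt0 cmod_cexp expR_gt0. Qed.

Lemma cexpN z : cexp (- z) = (cexp z)^-1.
Proof.
by apply: (mulIf (cexp_neq0 z)); rewrite -cexpD addNr cexp0 mulVf // cexp_neq0.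
Qed.

Lemma cexp_2pi z : cexp (z + Complex 0 (pi *+ 2)) = cexp z.
Proof. by rewrite cexpD cexpE expR0 cos2pi sin2pi !mul1r mulr1. Qed.

Lemma is_derive_le (f : R -> R) (x l : R) e : is_derive x 1 f l -> 0 < e ->
  exists2 d, 0 < d & forall k, `|k| < d -> `|f (x + k) - f x - l * k| <= e * `|k|.
Proof.
move=> D e0.
have [/cvg_ex [l' Hl] dl] := D.
have ll : l' = l by rewrite -dl; apply/esym/cvg_lim.
subst l'.
have := Hl => /cvgrPdist_lt /(_ _ e0) /nbhs_ballP [d /= d0 hd].
exists d => // k hk; have [->|k0] := eqVneq k 0.
  by rewrite addr0 mulr0 subrr subr0 normr0 mulr0.
have := hd k; rewrite -ball_normE /= sub0r normrN => /(_ hk k0).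
rewrite /GRing.scale /= mulr1 distrC (addrC k) => hlt.
have -> : f (x + k) - f x - l * k = (k^-1 * (f (x + k) - f x) - l) * k.
  by rewrite mulrBl mulrAC mulVf // mul1r.
by rewrite normrM ler_wpM2r // ltW.
Qed.

Lemma cder_cexp0 : cder cexp 0 1.
Proof.
move=> e e0.
(* The errors of the real and imaginary parts come to [e1 * m * 4] and [e1 * m * 5], so 16 leaves
   room. *)
pose e1 := Num.min (e / 16) 1.
have e10 : 0 < e1 by rewrite lt_min divr_gt0 //=.
have e11 : e1 <= 1 by rewrite ge_min lexx orbT.
have e116 : e1 <= e / 16 by rewrite ge_min lexx.
clearbody e1.
have [d1 d10 h1] := is_derive_le (is_derive_expR (0 : R)) e10.
have [d2 d20 h2] := is_derive_le (is_derive_sin (0 : R)) e10.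
have [d3 d30 h3] := is_derive_le (is_derive_cos (0 : R)) e10.
exists (Num.min (Num.min d1 e1) (Num.min d2 d3)); first by rewrite !lt_min d10 e10 d20.
move=> [x y] hxy; rewrite add0r cexp0 mul1r cexpE.
have hx := cmod_re (Complex x y); have hy := cmod_im (Complex x y).
set m := cmod (Complex x y) in hxy hx hy *; rewrite /= in hx hy.
move: hxy; rewrite !lt_min => /andP[/andP[m1 me] /andP[m2 m3]].
have := h1 x (le_lt_trans hx m1); have := h2 y (le_lt_trans hy m2).
have := h3 y (le_lt_trans hy m3).
rewrite !add0r expR0 sin0 cos0 oppr0 mul0r !mul1r !subr0 addr0 => H3 H2 H1.
have m0 : 0 <= m := cmod_ge0 _.
have emx : e1 * `|x| <= e1 * m by rewrite ler_wpM2l // ltW.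
have emy : e1 * `|y| <= e1 * m by rewrite ler_wpM2l // ltW.
have H1' := le_trans H1 emx; have H2' := le_trans H2 emy; have H3' := le_trans H3 emy.
have em1 : e1 * m <= m by rewrite -[leRHS]mul1r ler_wpM2r.
have E2 : expR x <= 2 + m.
  by move: H1'; rewrite ler_norml => /andP[_]; move: hx; rewrite ler_norml => /andP[_]; lra.
have me1 : m <= 1 by apply: le_trans (ltW me) e11.
have E3 : expR x <= 3 by lra.
have E0 : 0 <= expR x := expR_ge0 _.
have Ex : `|expR x - 1| <= 2 * m.
  have -> : expR x - 1 = (expR x - 1 - x) + x by ring.
  by apply: le_trans (ler_normD _ _) _; lra.
apply: le_trans (cmod_le _) _ => /=.
have e8m : e1 * m * 16 <= e * m.
  by rewrite mulrAC ler_wpM2r // -ler_pdivlMr.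
have A1 : `|expR x * cos y - 1 - x| <= e1 * m * 4.
  have -> : expR x * cos y - 1 - x = (expR x - 1 - x) + expR x * (cos y - 1) by ring.
  apply: le_trans (ler_normD _ _) _; rewrite normrM (ger0_norm E0).
  have : expR x * `|cos y - 1| <= 3 * (e1 * m) by apply: ler_pM.
  lra.
have A2 : `|expR x * sin y - 0 - y| <= e1 * m * 5.
  have -> : expR x * sin y - 0 - y = expR x * (sin y - y) + (expR x - 1) * y by ring.
  apply: le_trans (ler_normD _ _) _; rewrite !normrM (ger0_norm E0).
  have b1 : expR x * `|sin y - y| <= 3 * (e1 * m) by apply: ler_pM.
  have b2 : `|expR x - 1| * `|y| <= (2 * m) * m by apply: ler_pM; rewrite ?normr_ge0.
  have b3 : m * m <= e1 * m by rewrite ler_wpM2r // ltW.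
  lra.
have : 0 <= e1 * m by rewrite mulr_ge0 // ltW.
lra.
Qed.

Lemma cder_cexp z : cder cexp z (cexp z).
Proof.
have D : cder (fun w => w - z) z 1 by rewrite -(subr0 1); exact: cderB (cder_id z) (cder_cst z z).
have := cder_cexp0; rewrite -(subrr z) => D0.
have := cderZ (cexp z) (cder_comp D D0); rewrite !mulr1; apply: cder_ext.
by exists 1 => // w _; rewrite -cexpD addrC subrK.
Qed.

Lemma cdiff_cexp z : cdiff cexp z.
Proof. by exists (cexp z); exact: cder_cexp. Qed.

Lemma polar (x y : R) : x ^+ 2 + y ^+ 2 = 1 ->
  exists2 t, - pi <= t <= pi & cos t = x /\ sin t = y.
Proof.
move=> xy; have x2 : x ^+ 2 <= 1 by rewrite -xy lerDl sqr_ge0.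
have x1 : -1 <= x <= 1 by rewrite -ler_norml -sqrtr_sqr -sqrtr1 ler_wsqrtr.
have sE : sin (acos x) = `|y|.
  by rewrite sin_acos // -sqrtr_sqr; congr Num.sqrt; lra.
have [a0 api] : 0 <= acos x /\ acos x <= pi by rewrite acos_ge0 // acos_lepi.
have [y0|y0] := leP 0 y.
  exists (acos x); first by apply/andP; split => //; lra.
  by rewrite acosK ?sE ?ger0_norm // in_itv.
exists (- acos x); first by apply/andP; split => //; lra.
by rewrite cosN sinN acosK ?sE ?ltr0_norm ?opprK // in_itv.
Qed.

Lemma cexp_surj z : z != 0 -> exists2 t, - pi <= t <= pi &
  cexp (Complex (ln (cmod z)) t) = z.
Proof.
move=> z0; have c0 : 0 < cmod z by rewrite cmod_gt0.
have cn : cmod z != 0 by rewrite gt_eqF.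
have [t ht [hc hs]] := @polar (complex.Re z / cmod z) (complex.Im z / cmod z)
  ltac:(rewrite !expr_div_n -mulrDl -cmod_sqr mulfV // expf_neq0 //).
exists t => //; rewrite cexpE hc hs lnK ?posrE //.
by apply: complex_ext => /=; rewrite mulrC divfK.
Qed.

End ComplexExponential.

(** * Goursat's theorem for rectangles *)

Section Goursat.
Variable R : realType.
Local Notation C := (R[i]).
Implicit Types (z w p : C) (a b c d r s e x y : R).

Definition rcont (h : R -> C) :=
  continuous (fun t => complex.Re (h t)) /\ continuous (fun t => complex.Im (h t)).

Definition cInt (h : R -> C) a b : C :=
  Complex (Int (fun t => complex.Re (h t)) a b) (Int (fun t => complex.Im (h t)) a b).

Lemma rcont_of (h : R -> C) : (forall x e, 0 < e -> exists2 d, 0 < d &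
  forall y, `|y - x| < d -> cmod (h y - h x) < e) -> rcont h.
Proof.
move=> H; split=> x; apply/cvgrPdist_lt => e e0; have [d d0 hd] := H x e e0;
  apply/nbhs_ballP; exists d => //= y hy;
  have {}hy : `|y - x| < d by [rewrite distrC].
- by rewrite -cReB; apply: le_lt_trans (cmod_re _) _; rewrite cmodB hd.
- by rewrite -cImB; apply: le_lt_trans (cmod_im _) _; rewrite cmodB hd.
Qed.

Lemma rcont_hor (h : C -> C) y : (forall z, ccont h z) -> rcont (fun t => h (Complex t y)).
Proof.
move=> hc; apply: rcont_of => x e e0; have [d d0 hd] := hc (Complex x y) e e0.
exists d => // t ht; apply: hd; apply: le_lt_trans (cmod_le _) _.
by rewrite /= subrr normr0 addr0.
Qed.

Lemma rcont_ver (h : C -> C) x : (forall z, ccont h z) -> rcont (fun t => h (Complex x t)).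
Proof.
move=> hc; apply: rcont_of => y e e0; have [d d0 hd] := hc (Complex x y) e e0.
exists d => // t ht; apply: hd; apply: le_lt_trans (cmod_le _) _.
by rewrite /= subrr normr0 add0r.
Qed.

Lemma cInt_cat h a b c : cInt h a b + cInt h b c = cInt h a c.
Proof. by apply: complex_ext; rewrite /= Int_cat. Qed.

Lemma cIntD h k a b : rcont h -> rcont k -> a <= b ->
  cInt (fun t => h t + k t) a b = cInt h a b + cInt k a b.
Proof.
move=> [h1 h2] [k1 k2] ab; apply: complex_ext => /=; rewrite -IntD //;
  by congr (Int _ a b); apply/funext => t; rewrite ?cReD ?cImD.
Qed.

Lemma cInt_le h a b M : rcont h -> a <= b -> (forall t, a <= t <= b -> cmod (h t) <= M) ->
  cmod (cInt h a b) <= 2 * M * (b - a).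
Proof.
move=> [h1 h2] ab H; apply: le_trans (cmod_le _) _ => /=.
rewrite -mulrA mulr_natl mulr2n; apply: lerD; apply: Int_abs_le => // x hx.
- exact: le_trans (cmod_re _) (H x hx).
- exact: le_trans (cmod_im _) (H x hx).
Qed.

(** The counterclockwise contour integral: the factors ['i] come from [dz] on the vertical sides. *)
Definition rectInt (h : C -> C) a b c d : C :=
  cInt (fun t => h (Complex t c)) a b + 'i%C * cInt (fun t => h (Complex b t)) c d
  - cInt (fun t => h (Complex t d)) a b - 'i%C * cInt (fun t => h (Complex a t)) c d.

Lemma rectInt_splitx h a m b c d :
  rectInt h a b c d = rectInt h a m c d + rectInt h m b c d.
Proof.
by rewrite /rectInt -!(cInt_cat _ a m b); ring.
Qed.

Lemma rectInt_splity h a b c m d :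
  rectInt h a b c d = rectInt h a b c m + rectInt h a b m d.
Proof.
by rewrite /rectInt -!(cInt_cat _ c m d); ring.
Qed.

Lemma rectIntD h k a b c d : (forall z, ccont h z) -> (forall z, ccont k z) ->
  a <= b -> c <= d ->
  rectInt (fun z => h z + k z) a b c d = rectInt h a b c d + rectInt k a b c d.
Proof.
move=> hc kc ab cd; rewrite /rectInt.
have H y := cIntD (rcont_hor y hc) (rcont_hor y kc) ab.
have V x := cIntD (rcont_ver x hc) (rcont_ver x kc) cd.
by rewrite !H !V; ring.
Qed.

Lemma rectInt_affine p q a b c d : a <= b -> c <= d ->
  rectInt (fun z => p + q * z) a b c d = 0.
Proof.
move=> ab cd; case: p q => p1 p2 [q1 q2].
have H y : cInt (fun t => Complex p1 p2 + Complex q1 q2 * Complex t y) a b =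
  Complex ((p1 - q2 * y) * (b - a) + q1 * (b ^+ 2 - a ^+ 2) / 2)
          ((p2 + q1 * y) * (b - a) + q2 * (b ^+ 2 - a ^+ 2) / 2).
  by rewrite -!Int_affine //; apply: complex_ext => /=; congr (Int _ a b);
    apply/funext => t /=; ring.
have V x : cInt (fun t => Complex p1 p2 + Complex q1 q2 * Complex x t) c d =
  Complex ((p1 + q1 * x) * (d - c) + (- q2) * (d ^+ 2 - c ^+ 2) / 2)
          ((p2 + q2 * x) * (d - c) + q1 * (d ^+ 2 - c ^+ 2) / 2).
  by rewrite -!Int_affine //; apply: complex_ext => /=; congr (Int _ c d);
    apply/funext => t /=; ring.
by rewrite /rectInt !H !V; apply: complex_ext => /=; field.
Qed.

Lemma rectInt_le h a b c d M : (forall z, ccont h z) -> a <= b -> c <= d ->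
  (forall x y, a <= x <= b -> c <= y <= d -> cmod (h (Complex x y)) <= M) ->
  cmod (rectInt h a b c d) <= 4 * M * ((b - a) + (d - c)).
Proof.
move=> hc ab cd H.
have Hh y : c <= y <= d -> cmod (cInt (fun t => h (Complex t y)) a b) <= 2 * M * (b - a).
  by move=> hy; apply: cInt_le => //; [exact: rcont_hor|move=> t ht; exact: H].
have Hv x : a <= x <= b -> cmod (cInt (fun t => h (Complex x t)) c d) <= 2 * M * (d - c).
  by move=> hx; apply: cInt_le => //; [exact: rcont_ver|move=> t ht; exact: H].
rewrite /rectInt; apply: le_trans (cmodD _ _) _; rewrite cmodN cmodM cmod_i mul1r.
apply: le_trans (lerD (cmodD _ _) (lexx _)) _; rewrite cmodN.
apply: le_trans (lerD (lerD (cmodD _ _) (lexx _)) (lexx _)) _; rewrite cmodM cmod_i mul1r.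
have := Hh c ltac:(by rewrite lexx); have := Hh d ltac:(by rewrite lexx andbT).
have := Hv a ltac:(by rewrite lexx); have := Hv b ltac:(by rewrite lexx andbT).
lra.
Qed.

Lemma rectInt_quarter h a b c d : a <= b -> c <= d ->
  exists r : (R * R) * (R * R), [/\ [&& a <= r.1.1, r.1.1 <= r.1.2 & r.1.2 <= b], [&& c <= r.2.1, r.2.1 <= r.2.2 & r.2.2 <= d],
    r.1.2 - r.1.1 = (b - a) / 2, r.2.2 - r.2.1 = (d - c) / 2 &
    cmod (rectInt h a b c d) <= 4 * cmod (rectInt h r.1.1 r.1.2 r.2.1 r.2.2)].
Proof.
move=> ab cd; pose m := (a + b) / 2; pose n := (c + d) / 2.
have E : rectInt h a b c d = (rectInt h a m c n + rectInt h a m n d) +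
   (rectInt h m b c n + rectInt h m b n d).
  by rewrite -!rectInt_splity -rectInt_splitx.
set J := cmod _.
have [am mb] : a <= m /\ m <= b by rewrite /m; split; lra.
have [cn nd] : c <= n /\ n <= d by rewrite /n; split; lra.
have ma : m - a = (b - a) / 2 by rewrite /m; lra.
have bm : b - m = (b - a) / 2 by rewrite /m; lra.
have nc : n - c = (d - c) / 2 by rewrite /n; lra.
have dn : d - n = (d - c) / 2 by rewrite /n; lra.
clearbody m n.
have [h1|h1] := leP J (4 * cmod (rectInt h a m c n)).
  by exists ((a, m), (c, n)); rewrite /= lexx am mb cn nd lexx.
have [h2|h2] := leP J (4 * cmod (rectInt h a m n d)).
  by exists ((a, m), (n, d)); rewrite /= lexx am mb cn nd lexx.
have [h3|h3] := leP J (4 * cmod (rectInt h m b c n)).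
  by exists ((m, b), (c, n)); rewrite /= lexx am mb cn nd lexx.
have [h4|h4] := leP J (4 * cmod (rectInt h m b n d)).
  by exists ((m, b), (n, d)); rewrite /= lexx am mb cn nd lexx.
have : J <= cmod (rectInt h a m c n) + cmod (rectInt h a m n d) +
            (cmod (rectInt h m b c n) + cmod (rectInt h m b n d)).
  rewrite /J E; apply: le_trans (cmodD _ _) _; apply: lerD; exact: cmodD.
lra.
Qed.

(** Some quarter always carries at least a fourth of the integral. In the limit point [h] is affine
    up to a small multiple of the diameter, and affine functions have integral zero. Continuity is
    asked on the whole plane because [Int] is controlled only for integrands continuous on the whole
    line. *)
Lemma goursat h a b c d : a <= b -> c <= d -> (forall z, ccont h z) ->
  (forall x y, a <= x <= b -> c <= y <= d -> cdiff h (Complex x y)) ->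
  rectInt h a b c d = 0.
Proof.
move=> ab cd hc hd.
pose valid (r : (R * R) * (R * R)) := r.1.1 <= r.1.2 /\ r.2.1 <= r.2.2.
(* Quartering is made total, returning [r] itself when its bounds are not ordered, so that a choice
   function can be iterated. *)
have step (r : (R * R) * (R * R)) : exists r' : (R * R) * (R * R), valid r -> [/\ [&& r.1.1 <= r'.1.1, r'.1.1 <= r'.1.2 & r'.1.2 <= r.1.2],
    [&& r.2.1 <= r'.2.1, r'.2.1 <= r'.2.2 & r'.2.2 <= r.2.2],
    r'.1.2 - r'.1.1 = (r.1.2 - r.1.1) / 2, r'.2.2 - r'.2.1 = (r.2.2 - r.2.1) / 2 &
    cmod (rectInt h r.1.1 r.1.2 r.2.1 r.2.2) <= 4 * cmod (rectInt h r'.1.1 r'.1.2 r'.2.1 r'.2.2)].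
  have [v|] := pselect (valid r); last by exists r.
  by have [r' H] := rectInt_quarter h v.1 v.2; exists r'.
have {step} /choice [F hF] := step.
pose u n := iter n F ((a, b), (c, d)).
have uS n : u n.+1 = F (u n) by [].
have uv n : valid (u n).
  elim: n => [|n IH] //; rewrite uS.
  by have [/and3P[_ h1 _] /and3P[_ h2 _] _ _ _] := hF _ IH.
have uF n := hF _ (uv n).
have mono m n : (m <= n)%N -> (u m).1.1 <= (u n).1.1 /\ (u n).1.2 <= (u m).1.2 /\
    (u m).2.1 <= (u n).2.1 /\ (u n).2.2 <= (u m).2.2.
  elim: n => [|n IH]; first by rewrite leqn0 => /eqP ->.
  rewrite leq_eqVlt => /orP[/eqP -> //|]; rewrite ltnS => /IH [i1 [i2 [i3 i4]]].
  have [/and3P[h1 _ h2] /and3P[h3 _ h4] _ _ _] := uF n; rewrite uS.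
  by split; [|split; [|split]]; [exact: le_trans h1|exact: le_trans i2|exact: le_trans h3|exact: le_trans i4].
have cross m n : (u m).1.1 <= (u n).1.2 /\ (u m).2.1 <= (u n).2.2.
  have [m1 [_ [m3 _]]] := mono m _ (leq_maxl m n).
  have [_ [m2 [_ m4]]] := mono n _ (leq_maxr m n).
  have [v1 v2] := uv (maxn m n).
  by split; [exact: le_trans m1 (le_trans v1 m2)|exact: le_trans m3 (le_trans v2 m4)].
have limit (v w : nat -> R) : (forall m n, v m <= w n) -> exists x, forall n, v n <= x <= w n.
  move=> vw; exists (sup (range v)) => n; apply/andP; split.
    apply: ub_le_sup; last by exists n.
    by exists (w 0%N) => _ [m _ <-].
  by apply: ge_sup; [exists (v 0%N), 0%N|move=> _ [m _ <-]].
have [x hx] := limit (fun n => (u n).1.1) (fun n => (u n).1.2) (fun m n => (cross m n).1).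
have [y hy] := limit (fun n => (u n).2.1) (fun n => (u n).2.2) (fun m n => (cross m n).2).
have {}hd := hd x y (hx 0%N) (hy 0%N).
pose L := (b - a) + (d - c).
have L0 : 0 <= L by rewrite /L; lra.
have Ln n : (u n).1.2 - (u n).1.1 + ((u n).2.2 - (u n).2.1) = L / 2 ^+ n.
  elim: n => [|n IH]; first by rewrite /= expr0 divr1.
  have [_ _ e1 e2 _] := uF n; rewrite uS e1 e2 -mulrDl IH exprS invfM mulrAC mulrA.
  by rewrite mulrC mulrA.
have Jn n : cmod (rectInt h a b c d) <= 4 ^+ n * cmod (rectInt h (u n).1.1 (u n).1.2 (u n).2.1 (u n).2.2).
  elim: n => [|n IH]; first by rewrite expr0 mul1r.
  have [_ _ _ _ e1] := uF n; apply: le_trans IH _; rewrite uS exprSr -mulrA.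
  by rewrite ler_wpM2l // exprn_ge0.
have [l hl] := hd.
apply/eqP; rewrite -cmod_eq0; apply/eqP/le_anti; rewrite cmod_ge0 andbT.
apply/ler_addgt0Pr => e e0; rewrite add0r.
(* The estimate ends at [e1 * (4 * L ^+ 2)]; the added 1 covers a rectangle reduced to a point. *)
pose e1 := e / (4 * L ^+ 2 + 1).
have D0 : 0 < 4 * L ^+ 2 + 1 by rewrite ltr_wpDl // mulr_ge0 // sqr_ge0.
have e10 : 0 < e1 by rewrite divr_gt0.
have [dl dl0 hdl] := hl _ e10.
have [n Hn] : exists n, L / 2 ^+ n < dl.
  exists (Num.truncn (L / dl)).+1.
  rewrite ltr_pdivrMr ?exprn_gt0 // mulrC -ltr_pdivrMr //.
  apply: lt_trans (truncnS_gt _) _.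
  by rewrite -natrX ltr_nat ltn_expl.
have [v1 v2] := uv n.
pose E z := h z - ((h (Complex x y) - l * Complex x y) + l * z).
have Ec z : ccont E z.
  apply: ccontB => //; apply: ccontD; first exact: ccont_cst.
  by apply: ccontM; [exact: ccont_cst|exact: ccont_id].
have Ac z : ccont (fun z => (h (Complex x y) - l * Complex x y) + l * z) z.
  apply: ccontD; first exact: ccont_cst.
  by apply: ccontM; [exact: ccont_cst|exact: ccont_id].
have hE : rectInt h (u n).1.1 (u n).1.2 (u n).2.1 (u n).2.2 =
   rectInt E (u n).1.1 (u n).1.2 (u n).2.1 (u n).2.2.
  rewrite -[RHS]addr0 -(rectInt_affine (h (Complex x y) - l * Complex x y) l v1 v2) -rectIntD //.
  by congr (rectInt _ _ _ _ _); apply/funext => z; rewrite /E subrK.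
apply: le_trans (Jn n) _; rewrite hE.
set a' := (u n).1.1 in v1 *; set b' := (u n).1.2 in v1 *.
set c' := (u n).2.1 in v2 *; set d' := (u n).2.2 in v2 *.
have Ln' : b' - a' + (d' - c') = L / 2 ^+ n := Ln n.
have EM x' y' : a' <= x' <= b' -> c' <= y' <= d' -> cmod (E (Complex x' y')) <= e1 * (L / 2 ^+ n).
  move=> hx' hy'; have := hdl (Complex (x' - x) (y' - y)).
  have -> : Complex x y + Complex (x' - x) (y' - y) = Complex x' y'.
    by apply: complex_ext => /=; ring.
  have -> : h (Complex x' y') - h (Complex x y) - l * Complex (x' - x) (y' - y) = E (Complex x' y').
    rewrite /E (_ : Complex (x' - x) (y' - y) = Complex x' y' - Complex x y) //; ring.
  have hle : cmod (Complex (x' - x) (y' - y)) <= L / 2 ^+ n.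
    apply: le_trans (cmod_le _) _; rewrite -Ln' /=.
    have := hx n; have := hy n; rewrite -/a' -/b' -/c' -/d'.
    move=> /andP[q1 q2] /andP[q3 q4]; move: hx' hy' => /andP[q5 q6] /andP[q7 q8].
    by apply: lerD; rewrite ler_norml; apply/andP; split; lra.
  move=> /(_ (le_lt_trans hle Hn)) h1; apply: le_trans h1 _.
  by rewrite ler_wpM2l // ltW.
have := rectInt_le Ec v1 v2 EM; rewrite Ln' => h1.
have p4 : 0 < 4 ^+ n :> R by rewrite exprn_gt0.
apply: le_trans (ler_wpM2l (ltW p4) h1) _.
have -> : 4 ^+ n * (4 * (e1 * (L / 2 ^+ n)) * (L / 2 ^+ n)) = e1 * (4 * L ^+ 2).
  have -> : 4 ^+ n = 2 ^+ n * 2 ^+ n :> R by rewrite -exprMn; congr (_ ^+ _); ring.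
  by field; rewrite expf_neq0 // pnatr_eq0.
by rewrite /e1 mulrAC ler_pdivrMr // ler_wpM2l ?(ltW e0) //; lra.
Qed.

End Goursat.

(** * Mean values and the maximum principle *)

Section MaximumPrinciple.
Variable R : realType.
Local Notation C := (R[i]).
Implicit Types (z w b : C) (a r s e x y : R).

Lemma ReC x : complex.Re x%:C%C = x. Proof. by []. Qed.

Lemma IntZ (f : R -> R) k x y : continuous f -> x <= y ->
  Int (fun t => k * f t) x y = k * Int f x y.
Proof.
move=> fc xy; rewrite /Int mulrBr.
apply: (@IntP _ _ (fun t => k * antider f t)) => //.
  by move=> t; apply: cvgM; [exact: cvg_cst|exact: fc].
move=> t _; have D := antiderP fc t.
have := is_deriveZ k; apply.
Qed.

Lemma cInt_cst k x y : x <= y -> cInt (fun=> k) x y = k * (y - x)%:C%C.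
Proof.
move=> xy; have H u : Int (fun=> u) x y = u * (y - x).
  have := Int_affine u 0 xy; rewrite !mul0r addr0 => <-.
  by congr (Int _ _ _); apply/funext => t; rewrite mul0r addr0.
by case: k => k1 k2; apply: complex_ext; rewrite [LHS]/= H /=; ring.
Qed.

(** The radial retraction onto a closed disc. Composition with it extends a function from the disc
    to one continuous on the whole plane, as the integrals require. *)
Definition clamp b r z : C := b + (z - b) * (r / Num.max r (cmod (z - b)))%:C%C.

Lemma clamp_id b r z : 0 < r -> cmod (z - b) <= r -> clamp b r z = z.
Proof.
by move=> r0 h; rewrite /clamp (max_l h) divff ?gt_eqF // mulr1 addrC subrK.
Qed.

Lemma clamp_le b r z : 0 < r -> cmod (clamp b r z - b) <= r.
Proof.
move=> r0; rewrite /clamp (addrC b) addrK cmodM cmod_real.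
have m0 : 0 < Num.max r (cmod (z - b)) by rewrite lt_max r0.
rewrite ger0_norm ?divr_ge0 ?(ltW r0) ?(ltW m0) // mulrCA ger_pMr // ler_pdivrMr // mul1r.
by rewrite le_max lexx orbT.
Qed.

Lemma clamp_cont b r z : 0 < r -> ccont (clamp b r) z.
Proof.
move=> r0; apply: ccontD; first exact: ccont_cst.
apply: ccontM; first by apply: ccontB; [exact: ccont_id|exact: ccont_cst].
move=> e e0; exists (e * r); first by rewrite mulr_gt0.
move=> w hw; rewrite -rmorphB cmod_real.
set m := Num.max r (cmod (w - b)); set n := Num.max r (cmod (z - b)).
have rm : r <= m by rewrite le_max lexx.
have rn : r <= n by rewrite le_max lexx.
have m0 : 0 < m := lt_le_trans r0 rm. have n0 : 0 < n := lt_le_trans r0 rn.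
have -> : r / m - r / n = r * (n - m) / (m * n) by field; rewrite !gt_eqF.
have nm : `|n - m| <= cmod (w - z).
  have h1 : cmod (w - b) - cmod (z - b) <= cmod (w - z).
    by apply: le_trans (cmod_subl _ _) _; rewrite opprB addrA subrK.
  have h2 : cmod (z - b) - cmod (w - b) <= cmod (w - z).
    by apply: le_trans (cmod_subl _ _) _; rewrite opprB addrA subrK cmodB.
  have c0 := cmod_ge0 (w - z).
  by rewrite /m /n; have [h3|h3] := leP r (cmod (w - b)); have [h4|h4] := leP r (cmod (z - b));
    rewrite ler_norml; apply/andP; split; lra.
rewrite !normrM (gtr0_norm r0) (@ger0_norm _ (m * n)^-1); last by rewrite invr_ge0 mulr_ge0 // ltW.
rewrite ltr_pdivrMr ?mulr_gt0 //.
apply: le_lt_trans (_ : r * cmod (w - z) < _); first by rewrite ler_wpM2l // ltW.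
apply: lt_le_trans (_ : r * (e * r) <= _); first by rewrite ltr_pM2l.
by rewrite mulrCA ler_pM2l //; apply: ler_pM => //; exact: ltW.
Qed.

(** Through [z |-> b + cexp z], circles about [b] are vertical segments of length [2 * pi]. In
    Goursat's theorem the horizontal sides cancel by periodicity, so the integral does not depend on
    the radius, which is then made small. *)
Lemma mean_value h b r s a : (forall z, ccont h z) ->
  (forall z, cmod (z - b) < r -> cdiff h z) -> expR s < r ->
  cInt (fun t => h (b + cexp (Complex s t))) a (a + pi *+ 2) = h b * (pi *+ 2)%:C%C.
Proof.
move=> hc hd sr; pose H z := h (b + cexp z).
have pi2 : 0 <= (pi : R) *+ 2 by rewrite mulrn_wge0 // pi_ge0.
have ap : a <= a + pi *+ 2 by rewrite lerDl.
have Ec z : ccont (fun z => b + cexp z) z.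
  by apply: ccontD; [exact: ccont_cst|apply/cdiff_cont; exact: cdiff_cexp].
have Hc z : ccont H z by apply: ccont_comp.
have V s0 : s0 <= s -> cInt (fun t => H (Complex s0 t)) a (a + pi *+ 2) =
   cInt (fun t => H (Complex s t)) a (a + pi *+ 2).
  move=> s0s; have := @goursat R H s0 s a (a + pi *+ 2) s0s ap Hc.
  have -> : rectInt H s0 s a (a + pi *+ 2) =
    'i%C * (cInt (fun t => H (Complex s t)) a (a + pi *+ 2) - cInt (fun t => H (Complex s0 t)) a (a + pi *+ 2)).
    rewrite /rectInt (_ : (fun t => H (Complex t (a + pi *+ 2))) = (fun t => H (Complex t a))).
      by ring.
    apply/funext => t; rewrite /H -(cexp_2pi (Complex t a)).
    by congr (h (b + cexp _)); apply: complex_ext; rewrite /= ?addr0.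
  move=> E; apply/esym/eqP; rewrite -subr_eq0.
  have /eqP : 'i%C * (cInt (fun t => H (Complex s t)) a (a + pi *+ 2) - cInt (fun t => H (Complex s0 t)) a (a + pi *+ 2)) = 0.
    apply: E => x y /andP[_ xs] _; apply: cdiff_comp.
      by apply: cdiffD; [exact: cdiff_cst|exact: cdiff_cexp].
    apply: hd; rewrite (addrC b) addrK cmod_cexp /=.
    by apply: le_lt_trans sr; rewrite ler_expR.
  by rewrite mulf_eq0 -cmod_eq0 cmod_i oner_eq0.
apply/eqP; rewrite -subr_eq0 -cmod_eq0; apply/eqP/le_anti; rewrite cmod_ge0 andbT.
apply/ler_addgt0Pr => e e0; rewrite add0r.
pose e1 := e / (2 * (pi *+ 2) + 1).
have D0 : 0 < 2 * ((pi : R) *+ 2) + 1 by rewrite ltr_wpDl // mulr_ge0.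
have e10 : 0 < e1 by rewrite divr_gt0.
have [d d0 hd'] := hc b _ e10.
pose s0 := Num.min s (ln (d / 2)).
have s0s : s0 <= s by rewrite ge_min lexx.
have s0d : expR s0 < d.
  apply: le_lt_trans (_ : d / 2 < _); last by rewrite ltr_pdivrMr // ltr_pMr // ltr1n.
  rewrite -[leRHS]lnK ?posrE ?divr_gt0 // ler_expR.
  by rewrite ge_min lexx orbT.
rewrite -(V _ s0s).
have apE : a + pi *+ 2 - a = pi *+ 2 :> R by rewrite addrC addKr.
have Bc : rcont (fun t => H (Complex s0 t) - h b).
  apply: (@rcont_ver R (fun z => H z - h b)) => z; apply: ccontB => //; exact: ccont_cst.
have cc : rcont (fun _ : R => h b) by split=> ?; exact: cvg_cst.
have -> : cInt (fun t => H (Complex s0 t)) a (a + pi *+ 2) - h b * (pi *+ 2)%:C%C =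
   cInt (fun t => H (Complex s0 t) - h b) a (a + pi *+ 2).
  have cE := cInt_cst (h b) ap; rewrite apE in cE.
  rewrite -cE; apply/eqP; rewrite subr_eq -cIntD //.
  by apply/eqP; congr (cInt _ _ _); apply/funext => t; rewrite subrK.
apply: le_trans (cInt_le Bc ap (M := e1) _) _.
  move=> t _; apply/ltW/hd'; rewrite (addrC b) addrK cmod_cexp //.
rewrite apE; have -> : 2 * e1 * (pi *+ 2) = e1 * (2 * (pi *+ 2)) by ring.
by rewrite /e1 mulrAC ler_pdivrMr // ler_wpM2l ?(ltW e0) //; lra.
Qed.

(** The equality case of the mean value property: the real part of [conj (h b) * h] is at most
    [|h b|^2] on the circle through [z] and has this mean, hence equals it everywhere on the
    circle. *)
Lemma max_disc h b r : (forall z, cmod (z - b) < r -> cdiff h z) ->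
  (forall z, cmod (z - b) < r -> cmod (h z) <= cmod (h b)) ->
  forall z, cmod (z - b) < r -> cmod (h z) = cmod (h b).
Proof.
move=> hd hm z zr; have [->//|zb] := eqVneq z b.
have zb0 : z - b != 0 by rewrite subr_eq0.
have c0 : 0 < cmod (z - b) by rewrite cmod_gt0.
pose r' := (cmod (z - b) + r) / 2.
have [r'1 r'2] : cmod (z - b) < r' /\ r' < r by rewrite /r'; split; lra.
have r'0 : 0 < r' by apply: lt_trans r'1.
pose h' w := h (clamp b r' w).
have h'E w : cmod (w - b) <= r' -> h' w = h w by move=> hw; rewrite /h' clamp_id.
have h'c w : ccont h' w.
  apply: ccont_comp; first exact: clamp_cont.
  by apply/cdiff_cont/hd; apply: le_lt_trans r'2; exact: clamp_le.
have h'd w : cmod (w - b) < r' -> cdiff h' w.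
  move=> hw; apply: cdiff_ext (hd w (lt_trans hw r'2)).
  exists (r' - cmod (w - b)); first by rewrite subr_gt0.
  move=> v hv; rewrite h'E //; apply: le_trans (cmod_tri v b w) _; lra.
apply/le_anti; rewrite hm //=.
have sr : expR (ln (cmod (z - b))) < r' by rewrite lnK.
have [t ht E] := cexp_surj zb0.
set s := ln _ in sr E.
(* Starting the turn at [t - pi] makes the argument [t] of [z - b] interior to the interval, where
   [Int_eq0] applies. *)
have := mean_value (t - pi) h'c h'd sr.
set V := cInt _ _ _ => VE.
pose p := complex.Re (h b); pose q := complex.Im (h b).
pose X t := complex.Re (h' (b + cexp (Complex s t))).
pose Y t := complex.Im (h' (b + cexp (Complex s t))).
have [Xc Yc] : rcont (fun t => h' (b + cexp (Complex s t))).
  apply: (@rcont_ver R (fun z => h' (b + cexp z))) => w.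
  apply: (@ccont_comp _ h' (fun z => b + cexp z)) => //.
  by apply: ccontD; [exact: ccont_cst|apply/cdiff_cont; exact: cdiff_cexp].
have CS w : p * complex.Re w + q * complex.Im w <= cmod (h b) * cmod w.
  have -> : cmod (h b) = cmod (Complex p (- q)).
    by rewrite /p /q; case: (h b) => u v; rewrite /cmod /= sqrrN.
  rewrite -cmodM; apply: le_trans (le_trans (ler_norm _) (cmod_re _)).
  by rewrite cReM /= mulNr opprK.
have hb2 : cmod (h b) ^+ 2 = p ^+ 2 + q ^+ 2 by rewrite cmod_sqr.
pose phi t := (p ^+ 2 + q ^+ 2 + (- p) * X t) + (- q) * Y t.
have pXc : continuous (fun t => p ^+ 2 + q ^+ 2 + (- p) * X t).
  by move=> x; apply: cvgD; [exact: cvg_cst|apply: cvgM; [exact: cvg_cst|exact: Xc]].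
have qYc : continuous (fun t => (- q) * Y t).
  by move=> x; apply: cvgM; [exact: cvg_cst|exact: Yc].
have phic : continuous phi by move=> x; apply: cvgD; [exact: pXc|exact: qYc].
have onc x : cmod (b + cexp (Complex s x) - b) = cmod (z - b).
  by rewrite (addrC b) addrK cmod_cexp /= lnK.
have phi0 x : 0 <= phi x.
  have h1 := CS (h' (b + cexp (Complex s x))).
  have h2 : cmod (h b) * cmod (h' (b + cexp (Complex s x))) <= cmod (h b) * cmod (h b).
    rewrite ler_wpM2l ?cmod_ge0 // h'E ?onc ?(ltW r'1) //.
    by apply: hm; rewrite onc.
  rewrite -expr2 hb2 in h2; rewrite /phi /X /Y; lra.
have pp := pi_gt0 R.
have tp : t - pi <= t - pi + pi *+ 2 by rewrite lerDl mulrn_wge0 // ltW.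
have Iphi : Int phi (t - pi) (t - pi + pi *+ 2) = 0.
  rewrite /phi IntD // IntD //; last 2 first.
  - by move=> x; exact: cvg_cst.
  - by move=> x; apply: cvgM; [exact: cvg_cst|exact: Xc].
  rewrite !IntZ //.
  have -> : Int (fun _ : R => p ^+ 2 + q ^+ 2) (t - pi) (t - pi + pi *+ 2) = (p ^+ 2 + q ^+ 2) * (pi *+ 2).
    have [|c _ ->] := @Int_mvt R (fun _ : R => p ^+ 2 + q ^+ 2) _ _ _ tp; first by move=> x; exact: cvg_cst.
    by congr (_ * _); ring.
  have h'b : h' b = h b by rewrite h'E // subrr cmod0 ltW.
  have VR : complex.Re V = p * (pi *+ 2).
    by rewrite VE h'b /p; case: (h b) => u v /=; ring.
  have VI : complex.Im V = q * (pi *+ 2).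
    by rewrite VE h'b /q; case: (h b) => u v /=; ring.
  rewrite /V /= -/X -/Y in VR VI; rewrite VR VI; ring.
have : phi t = 0.
  apply: (@Int_eq0 R phi (t - pi) (t - pi + pi *+ 2)) => //.
  by apply/andP; split; rewrite ?mulr2n; lra.
have zE : b + cexp (Complex s t) = z by rewrite E addrC subrK.
rewrite /phi /X /Y zE => p0.
have := CS (h' z); rewrite h'E ?(ltW r'1) // in p0 *.
have -> : p * complex.Re (h z) + q * complex.Im (h z) = cmod (h b) * cmod (h b).
  by rewrite -expr2 hb2; lra.
have [->|hb0] := eqVneq (cmod (h b)) 0; first by rewrite cmod_ge0.
by rewrite ler_pM2l // lt_def hb0 cmod_ge0.
Qed.

Lemma closure_bounded (W : set (Cplx R)) r : bounded_by W r -> bounded_by (closure W) r.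
Proof.
move=> bW z /closureC H; apply/ler_addgt0Pr => e e0.
have [w /bW Ww hw] := H e e0.
have -> : z = w + (z - w) by rewrite addrC subrK.
by apply: le_trans (cmodD _ _) _; apply: lerD => //; rewrite cmodB ltW.
Qed.

(** Among the points of maximal modulus take one of largest real part. If the bound failed it would
    lie in [W], and [max_disc] would provide another maximal point further to the right. *)
Lemma max_principle (W : set (Cplx R)) g M r : open W -> bounded_by W r ->
  (forall z, closure W z -> ccont g z) -> (forall z, W z -> cdiff g z) ->
  (forall z, closure W z -> ~ W z -> cmod (g z) <= M) ->
  forall z, closure W z -> cmod (g z) <= M.
Proof.
move=> Wo bW gc gd gM.
have bK := closure_bounded bW; have cK := @closed_closure _ W.
have lecont (A : set (Cplx R)) (u : C -> R) : (forall z w, `|u w - u z| <= cmod (w - z)) ->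
  forall z, A z -> forall e, 0 < e -> exists2 d, 0 < d & forall w, A w -> cmod (w - z) < d -> `|u w - u z| < e.
  move=> hu z _ e e0; exists e => // w _; exact: le_lt_trans.
move=> z0 Kz0.
have [||m Km hm] := @compact_max R (closure W) r (fun z => cmod (g z)) cK bK; first by exists z0.
  move=> z Kz e e0; have [d d0 hd] := cmod_cont (gc z Kz) e0.
  by exists d => // w _; exact: hd.
apply: le_trans (hm z0 Kz0) _; rewrite leNgt; apply/negP => Mlt.
pose A : set (Cplx R) := [set z | closure W z /\ cmod (g z) = cmod (g m)].
have cA : closed A.
  apply/closedC => z Hz.
  have Kz : closure W z.
    by apply/closureC => e e0; have [w [Kw _] hw] := Hz (e / 2) ltac:(by rewrite divr_gt0);
      have [v Wv hv] := (closureC _ _).1 Kw (e / 2) ltac:(by rewrite divr_gt0);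
      exists v => //; apply: le_lt_trans (cmod_tri v z w) _; rewrite (splitr e) ltrD.
  split => //; apply/eqP; rewrite -subr_eq0 -normr_eq0; apply/eqP/le_anti; rewrite normr_ge0 andbT.
  apply/ler_addgt0Pr => e e0; rewrite add0r.
  have [d d0 hd] := cmod_cont (gc z Kz) e0.
  by have [w [Kw <-] hw] := Hz d d0; rewrite distrC ltW // hd.
have bA : bounded_by A r by move=> z [/bK].
have [||a [Ka ga] ha] := @compact_max R A r (@complex.Re R) cA bA; first by exists m.
  by apply: lecont => z w; rewrite -cReB; exact: cmod_re.
have Wa : W a.
  by apply: contrapT => nWa; have := gM a Ka nWa; rewrite ga; lra.
have [e e0 he] := (openC _).1 Wo a Wa.
pose a' := a + (e / 2)%:C%C.
have aa' : cmod (a' - a) < e.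
  by rewrite /a' (addrC a) addrK cmod_real gtr0_norm ?divr_gt0 // ltr_pdivrMr // ltr_pMr // ltr1n.
have : cmod (g a') = cmod (g a).
  apply: (@max_disc g a e) => // z /he Wz; first exact: gd.
  by rewrite ga; apply: hm; exact: subset_closure.
move=> ga'; have : A a'.
  by split; [apply: subset_closure; exact: he|rewrite ga'].
by move=> /ha; rewrite /a' cReD /=; lra.
Qed.

Lemma bernoulli x n : 0 <= x -> 1 + n%:R * x <= (1 + x) ^+ n.
Proof.
move=> x0; elim: n => [|n IH]; first by rewrite mul0r addr0 expr0.
rewrite exprS; apply: le_trans (ler_wpM2l _ IH); last by rewrite addr_ge0.
have : 0 <= n%:R * x * x by rewrite !mulr_ge0.
by rewrite -natr1; lra.
Qed.

(** Constants disappear on taking [n]-th roots: were [x > y], the powers of [x / y] would outgrow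
    [k / c] by Bernoulli's inequality. *)
Lemma pow_le_limit x y c k : 0 <= x -> 0 <= y -> 0 < c -> (forall n, x ^+ n * c <= y ^+ n * k) ->
  x <= y.
Proof.
move=> x0 y0 c0 H; rewrite leNgt; apply/negP => yx.
have [y00|yn0] := eqVneq y 0.
  have xp : 0 < x * c by rewrite mulr_gt0 // -y00.
  by have := H 1%N; rewrite !expr1 y00 mul0r; lra.
have yp : 0 < y by rewrite lt_def yn0.
pose t := x / y - 1.
have t0 : 0 < t by rewrite subr_gt0 ltr_pdivlMr // mul1r.
have [n Hn] : exists n : nat, k < n%:R * t * c.
  exists (Num.truncn (k / (t * c))).+1.
  by rewrite -mulrA -ltr_pdivrMr ?mulr_gt0 // truncnS_gt.
have := H n; have -> : x = y * (1 + t) by rewrite /t addrC subrK mulrC divfK.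
rewrite exprMn -mulrA ler_pM2l ?exprn_gt0 // => h.
have := bernoulli n (ltW t0) => h2.
have : (1 + n%:R * t) * c <= (1 + t) ^+ n * c by rewrite ler_pM2r.
rewrite mulrDl mul1r; lra.
Qed.

(** One exceptional point [s] is removed at a time. The function [g ^+ n * (z - s)] is
    differentiable at [s] by mere continuity of [g], and the cost of the extra factor vanishes on
    taking [n]-th roots. At [s] itself the bound follows by continuity. *)
Lemma max_principle_except (W : set (Cplx R)) (S : seq C) r : open W -> bounded_by W r ->
  forall g M, 0 <= M ->
  (forall z, closure W z -> ccont g z) -> (forall z, W z -> z \notin S -> cdiff g z) ->
  (forall z, closure W z -> ~ W z -> cmod (g z) <= M) ->
  forall z, closure W z -> cmod (g z) <= M.
Proof.
move=> Wo bW; elim: S => [|s S IH] g M M0 gc gd gM.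
  by apply: max_principle bW _ _ _ => // z Wz; exact: gd.
have bK := closure_bounded bW.
pose K := r + cmod s.
have away z : closure W z -> z != s -> cmod (g z) <= M.
  move=> Kz zs; apply: (@pow_le_limit _ _ (cmod (z - s)) K) => //; first exact: cmod_ge0.
    by rewrite cmod_gt0 subr_eq0.
  move=> n; rewrite -cmodX -cmodM.
  have K0 : 0 <= K by rewrite addr_ge0 ?cmod_ge0 //; apply: le_trans (bK _ Kz); exact: cmod_ge0.
  apply: (IH (fun z => g z ^+ n * (z - s)) (M ^+ n * K)) => //.
  - by rewrite mulr_ge0 ?exprn_ge0.
  - move=> w Kw; apply: ccontM; last exact/cdiff_cont/cdiff_subz.
    elim: n => [|n IHn]; first exact: ccont_cst.
    by have := ccontM (gc w Kw) IHn; apply: ccont_ext; exists 1 => // v _; rewrite exprS.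
  - move=> w Ww wS; have [ws|ws] := eqVneq w s; last first.
      by apply: cdiffM (cdiff_subz _ _); apply: cdiffX; apply: gd; rewrite ?inE ?negb_or ?ws.
    exists (g w ^+ n); apply/cderP; exists (fun z => g z ^+ n).
      elim: n => [|n IHn]; first exact: ccont_cst.
      by have := ccontM (gc w (subset_closure Ww)) IHn; apply: ccont_ext; exists 1 => // v _; rewrite exprS.
    by split=> // v; rewrite ws subrr mulr0 subr0.
  - move=> w Kw nWw; rewrite cmodM cmodX; apply: ler_pM; rewrite ?exprn_ge0 ?cmod_ge0 //.
      by apply: lerXn2r; rewrite ?nnegrE ?cmod_ge0 //; exact: gM.
    by apply: le_trans (cmodD _ _) _; rewrite cmodN lerD2r; exact: bK.
move=> z Kz; have [zs|] := eqVneq z s; last exact: away.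
have [Wz|nWz] := pselect (W z); last exact: gM.
apply/ler_addgt0Pr => e e0; have [d d0 hd] := cmod_cont (gc z Kz) e0.
have [e' e'0 he'] := (openC _).1 Wo z Wz.
pose m := Num.min d e' / 2.
have m0 : 0 < Num.min d e' by rewrite lt_min d0.
have mm : m < Num.min d e' by rewrite /m ltr_pdivrMr // ltr_pMr // ltr1n.
have mp : 0 < m by rewrite divr_gt0.
clearbody m; move: mm; rewrite lt_min => /andP[md me].
pose w := z + m%:C%C.
have wz : cmod (w - z) = m by rewrite /w (addrC z) addrK cmod_real gtr0_norm.
have h1 : cmod (g w) <= M.
  apply: away; first by apply: subset_closure; apply: he'; rewrite wz.
  by rewrite -zs -subr_eq0 -cmod_gt0 wz.
have := hd w; rewrite wz => /(_ md); rewrite ltr_norml => /andP[]; lra.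
Qed.

End MaximumPrinciple.

(** * Difference quotients, removable points and derivatives *)

Section Holomorphic.
Variable R : realType.
Local Notation C := (R[i]).
Implicit Types (z w a b l : C) (r s e x y : R) (f g h k : C -> C).

Definition cdisc a r : set (Cplx R) := [set z | cmod (z - a) < r].

Lemma cdisc_open a r : open (cdisc a r).
Proof.
apply/openC => z hz; exists (r - cmod (z - a)); first by rewrite subr_gt0.
move=> w hw; apply: le_lt_trans (cmod_tri w a z) _; rewrite /cdisc /= in hz; lra.
Qed.

Lemma cdisc_bounded a r : bounded_by (cdisc a r) (cmod a + r).
Proof.
move=> z /ltW hz; rewrite -(subrK a z); apply: le_trans (cmodD _ _) _.
by rewrite addrC lerD2l.
Qed.

Lemma closure_cdisc a r z : closure (cdisc a r) z -> cmod (z - a) <= r.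
Proof.
move=> /closureC H; apply/ler_addgt0Pr => e e0; have [w Ww hw] := H e e0.
by apply: le_trans (cmod_tri z a w) _; rewrite cmodB addrC lerD // ltW.
Qed.

Lemma max_principle_disc (S : seq C) a r g M : 0 <= M ->
  (forall z, cmod (z - a) <= r -> ccont g z) ->
  (forall z, cmod (z - a) < r -> z \notin S -> cdiff g z) ->
  (forall z, cmod (z - a) = r -> cmod (g z) <= M) ->
  forall z, cmod (z - a) <= r -> cmod (g z) <= M.
Proof.
move=> M0 gc gd gM z; rewrite le_eqVlt => /orP[/eqP|zr]; first exact: gM.
apply: (@max_principle_except R (cdisc a r) S _ (@cdisc_open a r) (@cdisc_bounded a r)) => //.
- by move=> w /closure_cdisc; exact: gc.
- by move=> w /closure_cdisc h1 /negP; rewrite -leNgt => h2; apply: gM; apply/le_anti/andP.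
- exact: subset_closure.
Qed.

Lemma bounded_on_disc g a r : 0 <= r -> (forall z, cmod (z - a) <= r -> ccont g z) ->
  exists2 M, 0 <= M & forall z, cmod (z - a) <= r -> cmod (g z) <= M.
Proof.
move=> r0 gc; pose K : set (Cplx R) := [set z | cmod (z - a) <= r].
have [||||m Km hm] := @compact_max R K (cmod a + r) (fun z => cmod (g z)).
- apply/closedC => z H; apply/ler_addgt0Pr => e e0; have [w Ww hw] := H e e0.
  by apply: le_trans (cmod_tri z a w) _; rewrite cmodB addrC lerD // ltW.
- move=> z hz; rewrite -(subrK a z); apply: le_trans (cmodD _ _) _.
  by rewrite addrC lerD2l.
- by exists a; rewrite /K /= subrr cmod0.
- move=> z Kz e e0; have [d d0 hd] := cmod_cont (gc z Kz) e0.
  by exists d => // w _; exact: hd.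
by exists (cmod (g m)) => //; exact: cmod_ge0.
Qed.

Definition dquot g a l z := if z == a then l else (g z - g a) / (z - a).

Lemma dquot_cont g a l : cder g a l -> ccont (dquot g a l) a.
Proof.
move=> /cderP [q qc [ql hq]]; apply: ccont_ext qc; exists 1 => // w _.
rewrite /dquot; case: eqVneq => [->//|wa].
by rewrite hq mulfK // subr_eq0.
Qed.

Lemma dquot_cont_off g a l z : z != a -> ccont g z -> ccont (dquot g a l) z.
Proof.
move=> za gc; have : ccont (fun w => (g w - g a) / (w - a)) z.
  apply: ccontM; first by apply: ccontB => //; exact: ccont_cst.
  by apply: ccontV; [rewrite subr_eq0|exact/cdiff_cont/cdiff_subz].
apply: ccont_ext; exists (cmod (z - a)); first by rewrite cmod_gt0 subr_eq0.
move=> w hw; rewrite /dquot; case: eqVneq => // wa.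
by move: hw; rewrite wa cmodB ltxx.
Qed.

Lemma dquot_cdiff_off g a l z : z != a -> cdiff g z -> cdiff (dquot g a l) z.
Proof.
move=> za gc; have : cdiff (fun w => (g w - g a) / (w - a)) z.
  apply: cdiff_div; [by rewrite subr_eq0| |exact: cdiff_subz].
  by apply: cdiffB => //; exact: cdiff_cst.
apply: cdiff_ext; exists (cmod (z - a)); first by rewrite cmod_gt0 subr_eq0.
move=> w hw; rewrite /dquot; case: eqVneq => // wa.
by move: hw; rewrite wa cmodB ltxx.
Qed.

Lemma dquotE g a l z : g z = g a + (z - a) * dquot g a l z.
Proof.
rewrite /dquot; case: eqVneq => [->|za]; first by rewrite subrr mul0r addr0.
by rewrite mulrC divfK ?subr_eq0 // addrC subrK.
Qed.

Lemma dquot_diff g a b b' l l' r M z : cmod (z - a) = r -> 0 < r ->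
  (forall z, cmod (z - a) <= r -> cmod (g z) <= M) ->
  cmod (b - a) <= r / 2 -> cmod (b' - a) <= r / 2 ->
  cmod (dquot g b l z - dquot g b' l' z) <=
    2 * M * cmod (b - b') * (4 / r ^+ 2) + cmod (g b' - g b) * (2 / r).
Proof.
move=> zr r0 gM hb hb'.
have far c : cmod (c - a) <= r / 2 -> r / 2 <= cmod (z - c).
  by move=> hc; have := cmod_tri z a c; rewrite zr; lra.
have nz c : cmod (c - a) <= r / 2 -> z != c.
  by move=> /far hc; rewrite -subr_eq0 -cmod_gt0; lra.
have zb := nz _ hb; have zb' := nz _ hb'.
rewrite /dquot (negPf zb) (negPf zb').
have zb0 : z - b != 0 by rewrite subr_eq0.
have zb0' : z - b' != 0 by rewrite subr_eq0.
have -> : (g z - g b) / (z - b) - (g z - g b') / (z - b') =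
   (g z - g b) * (b - b') * ((z - b)^-1 * (z - b')^-1) + (g b' - g b) * (z - b')^-1.
  by field; apply/andP.
have i1 c : cmod (c - a) <= r / 2 -> cmod ((z - c)^-1) <= 2 / r.
  move=> /far hc; rewrite cmodV (_ : 2 / r = (r / 2)^-1); last by rewrite invf_div.
  by rewrite lef_pV2 // posrE; [apply: lt_le_trans hc|]; rewrite divr_gt0.
have M0 : 0 <= M by apply: le_trans (gM z _); rewrite ?cmod_ge0 // zr.
apply: le_trans (cmodD _ _) _; rewrite !cmodM; apply: lerD.
  apply: ler_pM; rewrite ?mulr_ge0 ?cmod_ge0 //.
    apply: ler_wpM2r; first exact: cmod_ge0.
    apply: le_trans (cmodD _ _) _; rewrite cmodN mulr_natl mulr2n; apply: lerD; apply: gM.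
      by rewrite zr.
    by apply: le_trans hb _; lra.
  have -> : 4 / r ^+ 2 = (2 / r) * (2 / r) by field; rewrite gt_eqF.
  by apply: ler_pM; rewrite ?cmod_ge0 // i1.
by apply: ler_wpM2l; [exact: cmod_ge0|exact: i1].
Qed.

(** The points [z] of the circle stay at distance at least [r / 2] from the base points, so the
    quotient depends on its base point uniformly continuously near [a]. *)
Lemma dquot_close g a r e : 0 < r -> (forall z, cmod (z - a) <= r -> ccont g z) -> 0 < e ->
  exists2 d, 0 < d <= r / 2 & forall b b' l l' z, cmod (b - a) < d -> cmod (b' - a) < d ->
    cmod (z - a) = r -> cmod (dquot g b l z - dquot g b' l' z) <= e.
Proof.
move=> r0 gc e0.
have [M M0 gM] := bounded_on_disc (ltW r0) gc.
pose K := 2 * M * (4 / r ^+ 2) + 1.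
have K0 : 0 < K by rewrite ltr_wpDl // !mulr_ge0 // ?invr_ge0 ?exprn_ge0 // ltW.
have e1 : 0 < e * r / 8 by rewrite divr_gt0 // mulr_gt0.
have [d d0 hd] := gc a ltac:(by rewrite subrr cmod0 ltW) _ e1.
pose d' := Num.min d (Num.min (r / 2) (e / (4 * K))).
have d'0 : 0 < d' by rewrite !lt_min d0 divr_gt0 //= divr_gt0 // mulr_gt0.
have [dd dr dK] : [/\ d' <= d, d' <= r / 2 & d' <= e / (4 * K)].
  by rewrite /d' !ge_min !lexx !orbT.
clearbody d'; exists d'; first by rewrite d'0.
move=> b b' l l' z hb hb' zr.
apply: le_trans (dquot_diff l l' zr r0 gM (le_trans (ltW hb) dr) (le_trans (ltW hb') dr)) _.
have c1 : cmod (b - b') <= e / (2 * K).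
  apply: le_trans (cmod_tri b b' a) _; rewrite (cmodB a).
  have -> : e / (2 * K) = e / (4 * K) + e / (4 * K) by field; rewrite gt_eqF.
  by apply: lerD; apply: ltW; apply: lt_le_trans dK.
have c2 : cmod (g b' - g b) <= e * r / 4.
  apply: le_trans (cmod_tri (g b') (g b) (g a)) _; rewrite (cmodB (g a)).
  have h1 := hd b (lt_le_trans hb dd); have h2 := hd b' (lt_le_trans hb' dd); lra.
have -> : e = e / 2 + (e * r / 4) * (2 / r) by field; rewrite gt_eqF.
apply: lerD; last by rewrite ler_wpM2r // divr_ge0 // ltW.
have -> : 2 * M * cmod (b - b') * (4 / r ^+ 2) = cmod (b - b') * (K - 1) by rewrite /K; ring.
apply: le_trans (_ : e / (2 * K) * K <= _); last by have -> : e / (2 * K) * K = e / 2 by field; rewrite gt_eqF.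
by apply: ler_pM => //; [exact: cmod_ge0|rewrite /K addrK !mulr_ge0 // ?invr_ge0 ?exprn_ge0 // ltW|lra].
Qed.

(** The quotient of [g] between [a] and [b] is the value at [a] of the quotient based at [b]. Two
    such functions, for [b] and [b'], are close on the circle and differentiable off [a], [b], [b'];
    the maximum principle makes them close at [a], so the quotients at [a] are Cauchy. *)
Lemma removable g a r : 0 < r -> (forall z, cmod (z - a) <= r -> ccont g z) ->
  (forall z, cmod (z - a) < r -> z != a -> cdiff g z) -> cdiff g a.
Proof.
move=> r0 gc gd.
pose Q b := (g b - g a) / (b - a).
have QE b l : b != a -> dquot g b l a = Q b.
  move=> ba; rewrite /dquot eq_sym (negPf ba) /Q.
  have b0 : b - a != 0 by rewrite subr_eq0.
  have b1 : a - b != 0 by rewrite subr_eq0 eq_sym.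
  by field; apply/andP.
have cauchy e : 0 < e -> exists2 d, 0 < d <= r / 2 & forall b b', b != a -> b' != a ->
    cmod (b - a) < d -> cmod (b' - a) < d -> cmod (Q b - Q b') <= e.
  move=> e0; have [d /andP[d0 dr] hd] := dquot_close r0 gc e0.
  exists d; rewrite ?d0 // => b b' ba ba' hb hb'.
  have inr c : cmod (c - a) < d -> cmod (c - a) < r by move=> h; lra.
  have [l hl] := gd b (inr _ hb) ba; have [l' hl'] := gd b' (inr _ hb') ba'.
  rewrite -(QE b l) // -(QE b' l') //.
  apply: (@max_principle_disc [:: a; b; b'] a r (fun z => dquot g b l z - dquot g b' l' z)) => //.
  - exact: ltW.
  - move=> z hz; apply: ccontB.
      have [->|zb] := eqVneq z b; first exact: dquot_cont.
      by apply: dquot_cont_off => //; exact: gc.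
    have [->|zb] := eqVneq z b'; first exact: dquot_cont.
    by apply: dquot_cont_off => //; exact: gc.
  - move=> z hz; rewrite !inE !negb_or => /and3P[za zb zb'].
    by apply: cdiffB; apply: dquot_cdiff_off => //; exact: gd.
  - by move=> z; apply: hd.
  - by rewrite subrr cmod0 ltW.
have [d1 /andP[d10 d1r] h1] := cauchy 1 ltr01.
pose b n : C := a + (d1 / n.+2%:R)%:C%C.
have bE n : cmod (b n - a) = d1 / n.+2%:R.
  by rewrite /b (addrC a) addrK cmod_real gtr0_norm // divr_gt0 // ltr0n.
have bd n : cmod (b n - a) < d1.
  by rewrite bE ltr_pdivrMr ?ltr0n // ltr_pMr // ltr1n.
have ba n : b n != a by rewrite -subr_eq0 -cmod_gt0 bE divr_gt0 // ltr0n.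
have [|phi phim [l hl]] := @bwC R (fun n => Q (b n)) (cmod (Q (b 0%N)) + 1).
  move=> n; rewrite -(subrK (Q (b 0%N)) (Q (b n))); apply: le_trans (cmodD _ _) _.
  by rewrite addrC lerD2l; apply: h1.
have phin n : (n <= phi n)%N.
  by elim: n => // n IH; apply: leq_ltn_trans IH _; exact: phim.
exists l => e e0; have e2 : 0 < e / 2 by rewrite divr_gt0.
have [d /andP[d0 dr] hd] := cauchy _ e2.
have [N hN] := hl _ e2.
exists d => // h hh; have [->|h0] := eqVneq h 0.
  by rewrite addr0 subrr mulr0 subr0 cmod0 mulr0.
pose n := maxn N (Num.truncn (d1 / d)).
have bn : cmod (b (phi n) - a) < d.
  rewrite bE ltr_pdivrMr ?ltr0n // mulrC -ltr_pdivrMr //.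
  apply: lt_le_trans (truncnS_gt _) _; rewrite ler_nat.
  by apply: leqW; rewrite ltnS; apply: leq_trans (leq_maxr N _) (phin _).
have aha : a + h != a by rewrite -subr_eq0 (addrC a) addrK.
have hQ : cmod (Q (a + h) - l) <= e.
  apply: le_trans (cmod_tri _ _ (Q (b (phi n)))) _; rewrite (splitr e).
  by apply: lerD; [apply: hd => //; rewrite (addrC a) addrK|apply/ltW/hN; exact: leq_maxl].
have -> : g (a + h) - g a - l * h = (Q (a + h) - l) * h.
  by rewrite /Q (addrC a) addrK mulrBl divfK.
by rewrite cmodM ler_wpM2r // cmod_ge0.
Qed.

Lemma dquot_cdiff g a l r : (forall z, cmod (z - a) < r -> cdiff g z) -> cder g a l ->
  forall z, cmod (z - a) < r -> cdiff (dquot g a l) z.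
Proof.
move=> gd gl z zr; have r0 : 0 < r := le_lt_trans (cmod_ge0 _) zr.
have [->|za] := eqVneq z a; last by apply: dquot_cdiff_off => //; exact: gd.
apply: (@removable _ a (r / 2)); first by rewrite divr_gt0.
  move=> w hw; have [->|wa] := eqVneq w a; first exact: dquot_cont.
  by apply: dquot_cont_off => //; apply/cdiff_cont/gd; lra.
by move=> w hw wa; apply: dquot_cdiff_off => //; apply: gd; lra.
Qed.

Definition cderiv f z : C := xget 0 [set l | cder f z l].

Lemma cderivP f z : cdiff f z -> cder f z (cderiv f z).
Proof. by move=> [l hl]; exact: (@xgetI _ 0 [set l | cder f z l] l hl). Qed.

Lemma cderiv_eq f z l : cder f z l -> cderiv f z = l.
Proof. by move=> fl; exact: (cder_unique (cderivP (ex_intro _ l fl)) fl). Qed.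

(** The maximum principle compares the quotients based at [b] and at [a]. At the point [b] the first
    is the derivative at [b], while the second tends to the derivative at [a]. *)
Lemma cderiv_cont f a r : 0 < r -> (forall z, cmod (z - a) < r -> cdiff f z) ->
  ccont (cderiv f) a.
Proof.
move=> r0 fd e e0.
have fda := cderivP (fd a ltac:(by rewrite subrr cmod0)).
pose s := r / 2; have s0 : 0 < s by rewrite divr_gt0.
have sr : s < r by rewrite /s; lra.
have fc z : cmod (z - a) <= s -> ccont f z by move=> h; apply/cdiff_cont/fd; lra.
have e3 : 0 < e / 3 by rewrite divr_gt0.
have [d /andP[d0 ds] hd] := dquot_close s0 fc e3.
have [d' d'0 hd'] := dquot_cont fda e3.
exists (Num.min d d'); first by rewrite lt_min d0.
move=> b; rewrite lt_min => /andP[bd bd'].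
have fdb := cderivP (fd b ltac:(lra)).
have E : cmod (dquot f b (cderiv f b) b - dquot f a (cderiv f a) b) <= e / 3.
  apply: (@max_principle_disc [:: a; b] a s (fun z => dquot f b (cderiv f b) z - dquot f a (cderiv f a) z)).
  - exact: ltW.
  - move=> z hz; apply: ccontB.
      have [->|zb] := eqVneq z b; first exact: dquot_cont.
      by apply: dquot_cont_off => //; exact: fc.
    have [->|zb] := eqVneq z a; first exact: dquot_cont.
    by apply: dquot_cont_off => //; exact: fc.
  - move=> z hz; rewrite !inE !negb_or => /andP[za zb].
    by apply: cdiffB; apply: dquot_cdiff_off => //; apply: fd; lra.
  - by move=> z; apply: hd => //; rewrite subrr cmod0.
  - lra.
have E2 := hd' b bd'.
rewrite {1}/dquot eqxx in E; rewrite {2}/dquot eqxx in E2.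
apply: le_lt_trans (cmod_tri _ _ (dquot f a (cderiv f a) b)) _.
lra.
Qed.

(** With [f z = f a + (z - a) * q z] the derivative is [q z + (z - a) * cderiv q z]; the second
    summand is differentiable at [a] because [cderiv q] is continuous there. *)
Lemma cderiv_cdiff f a r : 0 < r -> (forall z, cmod (z - a) < r -> cdiff f z) ->
  cdiff (cderiv f) a.
Proof.
move=> r0 fd.
have fda := cderivP (fd a ltac:(by rewrite subrr cmod0)).
set l := cderiv f a in fda; pose q := dquot f a l.
have qd := dquot_cdiff fd fda; rewrite -/q in qd.
have qa := qd a ltac:(by rewrite subrr cmod0).
have cq : ccont (cderiv q) a := cderiv_cont r0 qd.
have D : cdiff (fun z => q z + (z - a) * cderiv q z) a.
  apply: cdiffD => //; exists (cderiv q a); apply/cderP; exists (cderiv q) => //.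
  by split=> // w; rewrite subrr mul0r subr0 mulrC.
apply: cdiff_ext D; exists r => // w hw; apply/esym/cderiv_eq.
have D1 : cder (fun z => z - a) w 1.
  by rewrite -(subr0 1); apply: cderB; [exact: cder_id|exact: cder_cst].
have := cderD (cder_cst (f a) w) (cderM D1 (cderivP (qd w hw))).
rewrite add0r mul1r; apply: cder_ext; exists 1 => // v _.
by rewrite -dquotE.
Qed.

End Holomorphic.

(** * Primitives and logarithms on discs *)

Section Logarithm.
Variable R : realType.
Local Notation C := (R[i]).
Implicit Types (z w a b l : C) (r s e x y : R) (f g h k F G : C -> C).

Lemma cInt_swap (h : R -> C) x y : cInt h x y = - cInt h y x.
Proof. by apply: complex_ext => /=; rewrite Int_swap. Qed.

Lemma cInt_le_sym (h : R -> C) x y M : rcont h ->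
  (forall t, Num.min x y <= t <= Num.max x y -> cmod (h t) <= M) ->
  cmod (cInt h x y) <= 2 * M * `|y - x|.
Proof.
move=> hc H; have [xy|yx] := leP x y.
  rewrite ger0_norm ?subr_ge0 //; apply: cInt_le => // t ht; apply: H.
  by rewrite (min_l xy) (max_r xy).
rewrite cInt_swap cmodN distrC gtr0_norm ?subr_gt0 //; apply: cInt_le => //.
  exact: ltW.
by move=> t ht; apply: H; rewrite (min_r (ltW yx)) (max_l (ltW yx)).
Qed.

Lemma goursat_sym h x x' y y' : (forall z, ccont h z) ->
  (forall s t, Num.min x x' <= s <= Num.max x x' -> Num.min y y' <= t <= Num.max y y' ->
     cdiff h (Complex s t)) -> rectInt h x x' y y' = 0.
Proof.
move=> hc hd.
have sx u v p q : rectInt h u v p q = - rectInt h v u p q.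
  by rewrite /rectInt (cInt_swap _ u v) (cInt_swap (fun t => h (Complex t q)) u v); ring.
have sy u v p q : rectInt h u v p q = - rectInt h u v q p.
  by rewrite /rectInt !(cInt_swap _ p q); ring.
have [xx|xx] := leP x x'; have [yy|yy] := leP y y'.
- by apply: goursat => // s t hs ht; apply: hd; rewrite ?(min_l xx) ?(max_r xx) ?(min_l yy) ?(max_r yy).
- rewrite sy goursat ?oppr0 // ?ltW // => s t hs ht; apply: hd;
    by rewrite ?(min_l xx) ?(max_r xx) ?(min_r (ltW yy)) ?(max_l (ltW yy)).
- rewrite sx goursat ?oppr0 // ?ltW // => s t hs ht; apply: hd;
    by rewrite ?(min_l yy) ?(max_r yy) ?(min_r (ltW xx)) ?(max_l (ltW xx)).
- rewrite sx sy goursat ?oppr0 // ?ltW // => s t hs ht; apply: hd;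
    by rewrite ?(min_r (ltW yy)) ?(max_l (ltW yy)) ?(min_r (ltW xx)) ?(max_l (ltW xx)).
Qed.

Lemma between_norm (x y t c d : R) : Num.min x y <= t <= Num.max x y ->
  `|x - c| <= d -> `|y - c| <= d -> `|t - c| <= d.
Proof.
by have [xy|yx] := leP x y; rewrite !ler_norml => /andP[h1 h2] /andP[h3 h4] /andP[h5 h6];
  apply/andP; split; lra.
Qed.

Lemma cmod_mono (x y x' y' : R) : `|x| <= `|x'| -> `|y| <= `|y'| ->
  cmod (Complex x y) <= cmod (Complex x' y').
Proof.
move=> hx hy; apply: ler_wsqrtr; apply: lerD; rewrite -[leLHS]real_normK ?num_real //
  -[leRHS]real_normK ?num_real //; exact: lerXn2r.
Qed.

(** Integration along a horizontal and then a vertical segment. By Goursat's theorem the other order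
    gives the same value, so an increment is the integral over a vertical and a horizontal segment
    close to [z]. *)
Lemma primitive h b r s : r < s -> (forall z, cmod (z - b) < s -> cdiff h z) ->
  exists G, forall z, cmod (z - b) < r -> cder G z (h z).
Proof.
move=> rs hd; have [r0|r0] := leP r 0.
  by exists h => z hz; have := cmod_ge0 (z - b); lra.
pose r' := (r + s) / 2; have [rr' r's] : r < r' /\ r' < s by rewrite /r'; split; lra.
have r'0 : 0 < r' by lra.
pose h' w := h (clamp b r' w).
have h'E w : cmod (w - b) <= r' -> h' w = h w by move=> hw; rewrite /h' clamp_id.
have h'c w : ccont h' w.
  apply: ccont_comp; first exact: clamp_cont.
  by apply/cdiff_cont/hd; apply: le_lt_trans r's; exact: clamp_le.
have h'd w : cmod (w - b) < r' -> cdiff h' w.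
  move=> hw; apply: cdiff_ext (hd w (lt_trans hw r's)).
  exists (r' - cmod (w - b)); first by rewrite subr_gt0.
  move=> v hv; rewrite h'E //; apply: le_trans (cmod_tri v b w) _; lra.
case: b => b1 b2 in h' h'E h'c h'd hd *.
pose G1 x y := cInt (fun t => h' (Complex t b2)) b1 x + 'i%C * cInt (fun t => h' (Complex x t)) b2 y.
pose G2 x y := 'i%C * cInt (fun t => h' (Complex b1 t)) b2 y + cInt (fun t => h' (Complex t y)) b1 x.
have G12 x y : cmod (Complex x y - Complex b1 b2) < r' -> G1 x y = G2 x y.
  move=> xy; apply/eqP; rewrite -subr_eq0; apply/eqP.
  rewrite -(@goursat_sym h' b1 x b2 y) //; last first.
    move=> s' t hs ht; apply: h'd; apply: le_lt_trans xy; apply: cmod_mono => /=.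
      by apply: between_norm hs _ _; rewrite ?subrr ?normr0.
    by apply: between_norm ht _ _; rewrite ?subrr ?normr0.
  by rewrite /G1 /G2 /rectInt; ring.
exists (fun z => G1 (complex.Re z) (complex.Im z)) => z zr e e0.
(* A factor 2 is lost in [cInt_le_sym], another in [|k1| + |k2| <= 2 * |k|]. *)
have e4 : 0 < e / 4 by rewrite divr_gt0.
have [d d0 hdel] := h'c z _ e4.
exists (Num.min d (r' - cmod (z - Complex b1 b2))); first by rewrite lt_min d0 subr_gt0; lra.
move=> k; rewrite lt_min => /andP[kd kr].
case: z => x y in zr hdel kr *; case: k => k1 k2 in kd kr *.
rewrite -[Complex x y + Complex k1 k2]/(Complex (x + k1) (y + k2)) /=.
have kle1 : cmod (Complex 0 k2) <= cmod (Complex k1 k2) by apply: cmod_mono; rewrite ?normr0.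
have in1 : cmod (Complex (x + k1) (y + k2) - Complex b1 b2) < r'.
  have -> : Complex (x + k1) (y + k2) - Complex b1 b2 = Complex k1 k2 + (Complex x y - Complex b1 b2).
    by apply: complex_ext => /=; ring.
  by apply: le_lt_trans (cmodD _ _) _; lra.
have in2 : cmod (Complex x (y + k2) - Complex b1 b2) < r'.
  have -> : Complex x (y + k2) - Complex b1 b2 = Complex 0 k2 + (Complex x y - Complex b1 b2).
    by apply: complex_ext => /=; ring.
  by apply: le_lt_trans (cmodD _ _) _; lra.
have hh : h (Complex x y) = h' (Complex x y) by rewrite h'E //; lra.
have E1 : G1 (x + k1) (y + k2) - G1 x (y + k2) = cInt (fun t => h' (Complex t (y + k2))) x (x + k1).
  rewrite G12 // G12 // /G2 -(cInt_cat _ b1 x (x + k1)); ring.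
have E2 : G1 x (y + k2) - G1 x y = 'i%C * cInt (fun t => h' (Complex x t)) y (y + k2).
  rewrite /G1 -(cInt_cat _ b2 y (y + k2)); ring.
set c := h (Complex x y) in hh *.
have cst (f : R -> C) p q : rcont f ->
    cInt f p q - c * (q - p)%:C%C = cInt (fun t => f t - c) p q.
  move=> fc; have cc : rcont (fun _ : R => c) by split=> ?; exact: cvg_cst.
  have fcc : rcont (fun t => f t - c).
    move: fc => [f1 f2]; split.
      have -> : (fun t => complex.Re (f t - c)) = (fun t => complex.Re (f t) - complex.Re c).
        by apply/funext => t; rewrite cReB.
      by move=> u; apply: cvgB; [exact: f1|exact: cvg_cst].
    have -> : (fun t => complex.Im (f t - c)) = (fun t => complex.Im (f t) - complex.Im c).
      by apply/funext => t; rewrite cImB.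
    by move=> u; apply: cvgB; [exact: f2|exact: cvg_cst].
  have main p' q' : p' <= q' -> cInt f p' q' - c * (q' - p')%:C%C = cInt (fun t => f t - c) p' q'.
    move=> pq; rewrite -(cInt_cst c pq); apply/eqP; rewrite subr_eq -cIntD //.
    by apply/eqP; congr (cInt _ _ _); apply/funext => t; rewrite subrK.
  have [pq|pq] := leP p q; first exact: main.
  rewrite (cInt_swap _ p q) (cInt_swap (fun t => f t - c)) -main ?(ltW pq) //.
  by rewrite -(opprB p q) rmorphN; ring.
have -> : G1 (x + k1) (y + k2) - G1 x y - c * Complex k1 k2 =
  (cInt (fun t => h' (Complex t (y + k2))) x (x + k1) - c * (x + k1 - x)%:C%C)
  + 'i%C * (cInt (fun t => h' (Complex x t)) y (y + k2) - c * (y + k2 - y)%:C%C).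
  have -> : Complex k1 k2 = (x + k1 - x)%:C%C + 'i%C * (y + k2 - y)%:C%C.
    by apply: complex_ext => /=; ring.
  rewrite (_ : G1 (x + k1) (y + k2) - G1 x y =
     (G1 (x + k1) (y + k2) - G1 x (y + k2)) + (G1 x (y + k2) - G1 x y)); last by ring.
  by rewrite E1 E2; ring.
rewrite cst; last exact: rcont_hor.
rewrite cst; last exact: rcont_ver.
have mid (t p q : R) : Num.min p (p + q) <= t <= Num.max p (p + q) -> `|t - p| <= `|q|.
  by move=> ht; apply: between_norm ht _ _; rewrite ?subrr ?normr0 // (addrC p) addrK.
have hb : rcont (fun t => h' (Complex t (y + k2)) - c).
  apply: (@rcont_hor R (fun z => h' z - c)) => z; apply: ccontB => //; exact: ccont_cst.
have vb : rcont (fun t => h' (Complex x t) - c).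
  apply: (@rcont_ver R (fun z => h' z - c)) => z; apply: ccontB => //; exact: ccont_cst.
have B1 : cmod (cInt (fun t => h' (Complex t (y + k2)) - c) x (x + k1)) <= 2 * (e / 4) * `|x + k1 - x|.
  apply: cInt_le_sym => // t /mid ht; rewrite hh; apply/ltW/hdel.
  rewrite -[Complex t _ - _]/(Complex (t - x) (y + k2 - y)); apply: le_lt_trans kd.
  by apply: cmod_mono => //; rewrite addrC addKr.
have B2 : cmod (cInt (fun t => h' (Complex x t) - c) y (y + k2)) <= 2 * (e / 4) * `|y + k2 - y|.
  apply: cInt_le_sym => // t /mid ht; rewrite hh; apply/ltW/hdel.
  rewrite -[Complex x t - _]/(Complex (x - x) (t - y)); apply: le_lt_trans kd.
  by apply: cmod_mono => //; rewrite subrr normr0.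
rewrite (addrC x) addrK (addrC y) addrK in B1 B2 *.
apply: le_trans (cmodD _ _) _; rewrite cmodM cmod_i mul1r.
have r1 := cmod_re (Complex k1 k2); have r2 := cmod_im (Complex k1 k2); rewrite /= in r1 r2.
apply: le_trans (lerD B1 B2) _; rewrite -mulrDr.
have -> : 2 * (e / 4) * (`|k1| + `|k2|) = e * ((`|k1| + `|k2|) / 2) by field.
by rewrite ler_wpM2l ?(ltW e0) //; lra.
Qed.

Lemma is_derive_of (u : R -> R) (x l : R) : (forall e, 0 < e -> exists2 d, 0 < d &
  forall k : R, `|k| < d -> `|u (x + k) - u x - l * k| <= e * `|k|) -> is_derive x 1 u l.
Proof.
move=> H.
have L : (fun h : R => h^-1 *: (u (h *: (1 : R) + x) - u x)) @ 0^' --> l.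
  apply/cvgrPdist_le => e e0; have [d d0 hd] := H e e0.
  apply/nbhs_ballP; exists d => // k hk k0; rewrite /GRing.scale /= mulr1.
  have := hd k; move: hk; rewrite -ball_normE /= sub0r normrN => hk /(_ hk) h1.
  rewrite distrC (addrC k).
  have -> : k^-1 * (u (x + k) - u x) - l = (u (x + k) - u x - l * k) / k.
    by rewrite mulrBl mulfK // mulrC.
  by rewrite normrM normfV ler_pdivrMr ?normr_gt0.
by apply: DeriveDef; [apply/cvg_ex; exists l|exact: cvg_lim L].
Qed.

Lemma cder0_cst P b r : (forall z, cmod (z - b) < r -> cder P z 0) ->
  forall z, cmod (z - b) < r -> P z = P b.
Proof.
move=> Pd z zr.
pose p t := b + t%:C%C * (z - b).
have pin t : 0 <= t <= 1 -> cmod (p t - b) < r.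
  move=> /andP[t0 t1]; rewrite /p (addrC b) addrK cmodM cmod_real ger0_norm //.
  by apply: le_lt_trans zr; rewrite ler_piMl // cmod_ge0.
have base t : 0 <= t <= 1 -> forall e, 0 < e -> exists2 d, 0 < d &
    forall k : R, `|k| < d -> cmod (P (p (t + k)) - P (p t)) <= e * `|k|.
  move=> ht e e0; pose e1 := e / (cmod (z - b) + 1).
  have D0 : 0 < cmod (z - b) + 1 by rewrite ltr_wpDl // cmod_ge0.
  have e10 : 0 < e1 by rewrite divr_gt0.
  have [d d0 hd] := Pd _ (pin t ht) _ e10.
  exists (d / (cmod (z - b) + 1)); first by rewrite divr_gt0.
  move=> k; rewrite ltr_pdivlMr // => hk.
  have kk : `|k| * cmod (z - b) <= `|k| * (cmod (z - b) + 1) by rewrite ler_wpM2l // lerDl.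
  have := hd (k%:C%C * (z - b)); rewrite cmodM cmod_real mul0r subr0.
  have -> : p t + k%:C%C * (z - b) = p (t + k) by rewrite /p rmorphD; ring.
  move=> /(_ (le_lt_trans kk hk)) h1; apply: le_trans h1 _.
  have <- : e1 * (cmod (z - b) + 1) = e by rewrite divfK // gt_eqF.
  by rewrite -mulrA (mulrC _ `|k|) ler_wpM2l // ltW.
have p0 : p 0 = b by rewrite /p rmorph0 mul0r addr0.
have p1 : p 1 = z by rewrite /p rmorph1 mul1r addrC subrK.
rewrite -p0 -p1; apply: complex_ext.
- apply/esym/(@deriv0_cst R (fun t => complex.Re (P (p t)))) => // t ht.
  apply: is_derive_of => e e0; have [d d0 hd] := base t ht e e0; exists d => // k /hd h1.
  by rewrite mul0r subr0 -cReB; apply: le_trans h1; exact: cmod_re.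
- apply/esym/(@deriv0_cst R (fun t => complex.Im (P (p t)))) => // t ht.
  apply: is_derive_of => e e0; have [d d0 hd] := base t ht e e0; exists d => // k /hd h1.
  by rewrite mul0r subr0 -cImB; apply: le_trans h1; exact: cmod_im.
Qed.

(** For a primitive [G] of [cderiv g / g], the product [g * cexp (- G)] has zero derivative; its
    constant nonzero value has a logarithm, which is added to [G]. *)
Lemma log_branch g b r s : r < s -> (forall z, cmod (z - b) < s -> cdiff g z) ->
  (forall z, cmod (z - b) < s -> g z != 0) ->
  exists F, forall z, cmod (z - b) < r -> cdiff F z /\ cexp (F z) = g z.
Proof.
move=> rs gd g0; have [r0|r0] := leP r 0.
  by exists g => z hz; exfalso; have := cmod_ge0 (z - b); lra.
have hd z : cmod (z - b) < s -> cdiff (fun w => cderiv g w / g w) z.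
  move=> zs; apply: cdiff_div; [exact: g0| |exact: gd].
  apply: (@cderiv_cdiff _ g z (s - cmod (z - b))); first by rewrite subr_gt0.
  by move=> w hw; apply: gd; apply: le_lt_trans (cmod_tri w b z) _; lra.
have [G hG] := primitive rs hd.
pose P z := g z * cexp (- G z).
have Pd z : cmod (z - b) < r -> cder P z 0.
  move=> zr; have zs : cmod (z - b) < s by lra.
  have E : cder (fun w => cexp (- G w)) z (cexp (- G z) * (- (cderiv g z / g z))).
    by apply: cder_comp (cderN (hG z zr)) _; exact: cder_cexp.
  have := cderM (cderivP (gd z zs)) E.
  rewrite (_ : _ + _ = 0) //; field; exact: g0.
have Pc := cder0_cst Pd.
have bb : cmod (b - b) < r by rewrite subrr cmod0.
have Pb0 : P b != 0 by rewrite mulf_neq0 ?cexp_neq0 ?g0 // subrr cmod0; lra.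
have [t _ ht] := cexp_surj Pb0.
set c := Complex _ _ in ht.
exists (fun z => G z + c) => z zr; split.
  by apply: cdiffD (cdiff_cst _ _); exists (cderiv g z / g z); exact: hG.
rewrite cexpD ht -(Pc z zr) /P mulrCA -cexpD subrr cexp0 mulr1 //.
Qed.

End Logarithm.

(** * Schwarz, Harnack, three circles and omitted values *)

Section Harnack.
Variable R : realType.
Local Notation C := (R[i]).
Implicit Types (z w a b l : C) (r s e x y M : R) (f g h F G : C -> C).

(** The maximum principle for the difference quotient at [a], on circles of radius [s < r], with [s]
    then tending to [r]. *)
Lemma schwarz g a r M : (forall z, cmod (z - a) < r -> cdiff g z) -> g a = 0 ->
  (forall z, cmod (z - a) < r -> cmod (g z) <= M) ->
  forall z, cmod (z - a) < r -> cmod (g z) * r <= M * cmod (z - a).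
Proof.
move=> gd ga gM z zr.
have r0 : 0 < r := le_lt_trans (cmod_ge0 _) zr.
have M0 : 0 <= M by apply: le_trans (gM _ zr); exact: cmod_ge0.
have gda := cderivP (gd a ltac:(by rewrite subrr cmod0)).
pose q := dquot g a (cderiv g a).
have qd := dquot_cdiff gd gda; rewrite -/q in qd.
have key s : cmod (z - a) < s -> s < r -> cmod (g z) * s <= M * cmod (z - a).
  move=> zs sr; have s0 : 0 < s := le_lt_trans (cmod_ge0 _) zs.
  have qle : cmod (q z) <= M / s.
    apply: (@max_principle_disc R [::] a s q) => //.
    - by rewrite divr_ge0 // ltW.
    - by move=> w hw; apply/cdiff_cont/qd; lra.
    - by move=> w hw _; apply: qd; lra.
    - move=> w hw; have wa : w != a by rewrite -subr_eq0 -cmod_gt0 hw.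
      rewrite /q /dquot (negPf wa) ga subr0 cmodM cmodV hw.
      by rewrite ler_wpM2r ?invr_ge0 ?(ltW s0) // gM // hw.
    - exact: ltW.
  rewrite (dquotE g a (cderiv g a) z) -/q ga add0r cmodM -mulrA mulrC.
  by rewrite ler_wpM2r ?cmod_ge0 // -ler_pdivlMr.
rewrite leNgt; apply/negP => H.
have g0 : 0 < cmod (g z).
  rewrite lt_def cmod_ge0 andbT; apply/negP => /eqP g0; move: H; rewrite g0 mul0r.
  by rewrite ltNge mulr_ge0 ?cmod_ge0.
pose K := M * cmod (z - a) / cmod (g z).
have Kr : K < r by rewrite /K ltr_pdivrMr // (mulrC r).
pose s := (Num.max K (cmod (z - a)) + r) / 2.
have mr : Num.max K (cmod (z - a)) < r by rewrite gt_max Kr.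
have [s1 s2] : Num.max K (cmod (z - a)) < s /\ s < r by rewrite /s; split; lra.
clearbody s; move: s1; rewrite gt_max => /andP[Ks zs].
have := key s zs s2; rewrite mulrC -ler_pdivlMr // -/K; lra.
Qed.

(** The Schwarz lemma for [(F - F a) / (F + conj (F a))], which maps the right half-plane into the
    unit disc. On the half disc its modulus is at most 1/2, whence the constants 2 and 3. *)
Lemma harnack F a r : (forall z, cmod (z - a) < r -> cdiff F z) ->
  (forall z, cmod (z - a) < r -> 0 < complex.Re (F z)) ->
  forall z, cmod (z - a) < r -> cmod (z - a) <= r / 2 ->
  cmod (F z - F a) <= 2 * complex.Re (F a) /\
  complex.Re (F a) <= 3 * complex.Re (F z).
Proof.
move=> Fd F0 z zr zr2.
have r0 : 0 < r := le_lt_trans (cmod_ge0 _) zr.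
have A0 := F0 a ltac:(by rewrite subrr cmod0).
pose c := Complex (complex.Re (F a)) (- complex.Im (F a)).
have dE w : complex.Re (F w + c) = complex.Re (F w) + complex.Re (F a) by rewrite cReD.
have d0 w : cmod (w - a) < r -> F w + c != 0.
  move=> wr; apply/eqP => E; have := dE w; rewrite E /=; have := F0 w wr; lra.
pose g w := (F w - F a) / (F w + c).
have sq w : cmod (F w - F a) ^+ 2 = cmod (F w + c) ^+ 2 - 4 * complex.Re (F w) * complex.Re (F a).
  rewrite !cmod_sqr cReB cImB cReD cImD /=; ring.
have gle w : cmod (w - a) < r -> cmod (g w) <= 1.
  move=> wr; rewrite cmodM cmodV ler_pdivrMr ?cmod_gt0 ?d0 // mul1r.
  rewrite -(@ler_pXn2r _ 2) ?nnegrE ?cmod_ge0 // sq lerBlDr lerDl.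
  by rewrite !mulr_ge0 // ltW // F0.
have gd w : cmod (w - a) < r -> cdiff g w.
  move=> wr; apply: cdiff_div; first exact: d0.
    by apply: cdiffB; [exact: Fd|exact: cdiff_cst].
  by apply: cdiffD; [exact: Fd|exact: cdiff_cst].
have ga : g a = 0 by rewrite /g subrr mul0r.
have := schwarz gd ga gle zr; rewrite mul1r => h1.
have g2 : cmod (g z) <= 1 / 2.
  by rewrite -(@ler_pM2r _ r) //; apply: le_trans h1 _; lra.
have dz : 0 < cmod (F z + c) by rewrite cmod_gt0 d0.
have h2 : 2 * cmod (F z - F a) <= cmod (F z + c).
  by move: g2; rewrite cmodM cmodV ler_pdivrMr //; lra.
have Az := F0 z zr.
split.
  have : cmod (F z + c) <= cmod (F z - F a) + cmod (F a + c).
    by apply: le_trans (cmodD _ _); rewrite addrA subrK.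
  have -> : F a + c = (2 * complex.Re (F a))%:C%C.
    by rewrite /c; case: (F a) => u v; apply: complex_ext => /=; ring.
  by rewrite cmod_real gtr0_norm ?mulr_gt0 //; lra.
have h3 : (2 * cmod (F z - F a)) ^+ 2 <= cmod (F z + c) ^+ 2.
  by rewrite ler_pXn2r // ?nnegrE ?cmod_ge0 // mulr_ge0 // cmod_ge0.
rewrite exprMn !cmod_sqr cReB cImB cReD cImD /= in h3.
set A := complex.Re (F z) in Az h3 *; set B := complex.Re (F a) in A0 h3 *.
set P := complex.Im (F z) in h3; set Q := complex.Im (F a) in h3.
have PQ : 0 <= (P - Q) ^+ 2 by rewrite sqr_ge0.
rewrite leNgt; apply/negP => AB.
have : 0 < (B - 3 * A) * (3 * B - A) by apply: mulr_gt0; lra.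
nra.
Qed.

(** Harnack's inequality for [2 * e - G], whose real part is at least [e]. *)
Lemma borel_carath G a r e : 0 < e -> (forall z, cmod (z - a) < r -> cdiff G z) -> G a = 0 ->
  (forall z, cmod (z - a) < r -> complex.Re (G z) <= e) ->
  forall z, cmod (z - a) < r -> cmod (z - a) <= r / 2 -> cmod (G z) <= 4 * e.
Proof.
move=> e0 Gd Ga Ge z zr z2.
have [||h _] := @harnack (fun w => (2 * e)%:C%C - G w) a r _ _ z zr z2.
- by move=> w wr; apply: cdiffB; [exact: cdiff_cst|exact: Gd].
- by move=> w wr; rewrite cReB ReC; have := Ge w wr; lra.
have E : ((2 * e)%:C%C - G z) - ((2 * e)%:C%C - G a) = - G z by rewrite Ga; ring.
by rewrite E cmodN Ga subr0 ReC in h; lra.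
Qed.

(** Harnack's inequality for minus a logarithm of [g]; its factor 3 becomes the cube. *)
Lemma small_at_center g a r s : r < s -> (forall z, cmod (z - a) < s -> cdiff g z) ->
  (forall z, cmod (z - a) < s -> 0 < cmod (g z) < 1) ->
  forall z, cmod (z - a) < r -> cmod (z - a) <= r / 2 -> cmod (g z) ^+ 3 <= cmod (g a).
Proof.
move=> rs gd g01 z zr z2.
have gn0 w : cmod (w - a) < s -> g w != 0 by move=> /g01; rewrite cmod_gt0 => /andP[].
have [F hF] := log_branch rs gd gn0.
have ra : cmod (a - a) < r by rewrite subrr cmod0; apply: le_lt_trans zr; exact: cmod_ge0.
have gE w : cmod (w - a) < r -> cmod (g w) = expR (complex.Re (F w)).
  by move=> wr; have [_ <-] := hF w wr; rewrite cmod_cexp.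
have [||_ h] := @harnack (fun w => - F w) a r _ _ z zr z2.
- by move=> w wr; apply: cdiffN; have [] := hF w wr.
- move=> w wr; have := g01 w (lt_trans wr rs); rewrite gE // expR_lt1 => /andP[_].
  by case: (F w) => u v /=; lra.
have rN w : complex.Re (- w) = - complex.Re w :> R by case: w.
rewrite !gE // -expRM_natl ler_expR !rN in h *.
by move: h; rewrite mulrN lerN2.
Qed.

(** The maximum principle for [G z / (z - a) ^+ p] on the ring. An integer [p] keeps the quotient
    single-valued; the exponent is optimised by each user. *)
Lemma three_circles G a r1 r3 A B p : 0 < r1 -> 0 <= A -> 0 <= B ->
  (forall z, r1 <= cmod (z - a) <= r3 -> cdiff G z) ->
  (forall z, cmod (z - a) = r1 -> cmod (G z) <= A) ->
  (forall z, cmod (z - a) = r3 -> cmod (G z) <= B) ->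
  forall z, r1 <= cmod (z - a) <= r3 ->
  cmod (G z) <= Num.max (A * (cmod (z - a) / r1) ^+ p) (B * (cmod (z - a) / r3) ^+ p).
Proof.
move=> r10 A0 B0 Gd GA GB z /andP[z1 z3].
have r30 : 0 < r3 := lt_le_trans r10 (le_trans z1 z3).
have z0 : 0 < cmod (z - a) := lt_le_trans r10 z1.
pose W : set (Cplx R) := [set w | r1 < cmod (w - a) < r3].
pose M := Num.max (A / r1 ^+ p) (B / r3 ^+ p).
have nz w : r1 <= cmod (w - a) -> w - a != 0 by move=> h; rewrite -cmod_gt0; lra.
have near w e : cmod (w - a) - e <= cmod (z - a) -> True by [].
have Wcl w : closure W w -> r1 <= cmod (w - a) <= r3.
  move=> /closureC H; apply/andP; split; apply/ler_addgt0Pr => e e0;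
    have [v /= /andP[v1 v2] hv] := H e e0.
    by have := cmod_tri v a w; lra.
  by have := cmod_tri w a v; rewrite (cmodB w v); lra.
suff key : cmod (G z / (z - a) ^+ p) <= M.
  move: key; rewrite cmodM cmodV cmodX ler_pdivrMr ?exprn_gt0 // => key.
  apply: le_trans key _; rewrite /M maxr_pMl ?exprn_ge0 ?cmod_ge0 //.
  by rewrite !expr_div_n !mulrA (mulrAC A) (mulrAC B).
have bd w : cmod (w - a) = r1 \/ cmod (w - a) = r3 -> cmod (G w / (w - a) ^+ p) <= M.
  rewrite cmodM cmodV cmodX /M le_max.
  by move=> [hw|hw]; apply/orP; [left|right]; rewrite hw ler_wpM2r ?invr_ge0 ?exprn_ge0 ?(ltW r10) ?(ltW r30) //; [exact: GA|exact: GB].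
have [zr1|zr1] := eqVneq (cmod (z - a)) r1; first by apply: bd; left.
have [zr3|zr3] := eqVneq (cmod (z - a)) r3; first by apply: bd; right.
have Qd w : r1 <= cmod (w - a) <= r3 -> cdiff (fun w => G w / (w - a) ^+ p) w.
  move=> hw; have /andP[h1 _] := hw; apply: cdiff_div; [by rewrite expf_neq0 // nz|exact: Gd|].
  by apply: cdiffX; exact: cdiff_subz.
apply: (@max_principle R W (fun w => G w / (w - a) ^+ p) M (cmod a + r3)).
- apply/openC => w /= /andP[w1 w3]; exists (Num.min (cmod (w - a) - r1) (r3 - cmod (w - a))).
    by rewrite lt_min !subr_gt0 w1.
  move=> v; rewrite lt_min => /andP[h1 h2].
  by have := cmod_tri v a w; have := cmod_tri w a v; rewrite (cmodB w v) => *; apply/andP; split; lra.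
- move=> w /= /andP[_ /ltW w3]; rewrite -(subrK a w); apply: le_trans (cmodD _ _) _.
  by rewrite addrC lerD2l.
- by move=> w /Wcl /Qd /cdiff_cont.
- by move=> w /= /andP[/ltW h1 /ltW h2]; apply: Qd; rewrite h1.
- move=> w /Wcl /andP[h1 h2] nW; apply: bd.
  move: h1 h2; rewrite !le_eqVlt => /orP[/eqP ->|h1]; first by left.
  move=> /orP[/eqP ->|h2]; first by right.
  by exfalso; apply: nW; rewrite /W /= h1 h2.
- by apply: subset_closure; rewrite /W /= !lt_def z1 z3 zr1 eq_sym zr3.
Qed.

(** If [w] were omitted, [1 / (g - w)] would be larger at the centre than on the circle. This stands
    in for Rouche's theorem. *)
Lemma exists_zero g a r m w : 0 < m -> (forall z, cmod (z - a) <= r -> cdiff g z) ->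
  (forall z, cmod (z - a) = r -> m <= cmod (g z - w)) -> 0 <= r -> cmod (g a - w) < m ->
  exists2 z, cmod (z - a) < r & g z = w.
Proof.
move=> m0 gd gm r0 gw; apply: contrapT => N.
have nz z : cmod (z - a) <= r -> g z - w != 0.
  rewrite le_eqVlt => /orP[/eqP zr|zr].
    by rewrite -cmod_gt0; apply: lt_le_trans (gm z zr).
  by rewrite subr_eq0; apply/eqP => gz; apply: N; exists z.
have : cmod ((g a - w)^-1) <= m^-1.
  have qd z : cmod (z - a) <= r -> cdiff (fun z => (g z - w)^-1) z.
    move=> zr; apply: cdiffV; first exact: nz.
    by apply: cdiffB; [exact: gd|exact: cdiff_cst].
  apply: (@max_principle_disc R [::] a r (fun z => (g z - w)^-1)).
  - by rewrite invr_ge0 ltW.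
  - by move=> z /qd /cdiff_cont.
  - by move=> z /ltW /qd.
  - move=> z zr; rewrite cmodV lef_pV2 ?posrE //; first exact: gm.
    by apply: lt_le_trans (gm z zr).
  - by rewrite subrr cmod0.
have ga0 : 0 < cmod (g a - w) by rewrite cmod_gt0 nz // subrr cmod0.
by rewrite cmodV lef_pV2 ?posrE //; lra.
Qed.

End Harnack.

(** * Growth of entire functions *)

Section Entire.
Variable R : realType.
Local Notation C := (R[i]).
Implicit Types (z w a b l : C) (r s e x y M : R) (f g h F G : C -> C).

Definition centire f := forall z, cdiff f z.

(** If zeros accumulate at [a], then [g] is divisible by every power of [z - a]. Comparing a point
    at distance less than [r] with the circle of radius [2 * r] gives [2 ^+ n * |g z| <= M] for all
    [n]. *)
Lemma isolated_zeros g a : centire g ->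
  (forall z, g z = 0) \/
  exists2 r, 0 < r & forall z, 0 < cmod (z - a) < r -> g z != 0.
Proof.
move=> gd; have [I|NI] := pselect (exists2 r, 0 < r & forall z, 0 < cmod (z - a) < r -> g z != 0).
  by right.
left.
have fac n : exists2 q, centire q & forall z, g z = (z - a) ^+ n * q z.
  elim: n => [|n [q qd qE]]; first by exists g => // z; rewrite expr0 mul1r.
  have qa : q a = 0.
    apply/eqP; apply: contrapT => /negP qa; apply: NI.
    have qa0 : 0 < cmod (q a) by rewrite cmod_gt0.
    have [d d0 hd] := cdiff_cont (qd a) qa0.
    exists d => // z /andP[z0 zd]; rewrite qE mulf_neq0 //.
      by rewrite expf_neq0 // -cmod_gt0.
    rewrite -cmod_gt0; have := hd z zd; have := cmod_subl (q a) (q z); rewrite (cmodB (q a)); lra.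
  have qda := cderivP (qd a).
  exists (dquot q a (cderiv q a)).
    move=> z; apply: (@dquot_cdiff R q a (cderiv q a) (cmod (z - a) + 1)) => //; lra.
  by move=> z; rewrite qE (dquotE q a (cderiv q a)) qa add0r exprSr mulrA.
move=> z; apply/eqP; rewrite -cmod_eq0; apply/negPn/negP => gz.
have gz0 : 0 < cmod (g z) by rewrite lt_def gz cmod_ge0.
pose r := cmod (z - a) + 1.
have r0 : 0 < r by rewrite ltr_wpDl // cmod_ge0.
have r20 : 0 < 2 * r by rewrite mulr_gt0.
have gc w : cmod (w - a) <= 2 * r -> ccont g w by move=> _; exact: cdiff_cont.
have [M M0 hM] := bounded_on_disc (ltW r20) gc.
suff : (2 : R) <= 1 by lra.
apply: (@pow_le_limit R 2 1 (cmod (g z)) M) => // n; rewrite expr1n mul1r.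
have [q qd qE] := fac n.
have qle w : cmod (w - a) <= 2 * r -> cmod (q w) <= M / (2 * r) ^+ n.
  apply: (@max_principle_disc R [::] a (2 * r) q).
  - by rewrite divr_ge0 ?exprn_ge0 // ltW.
  - by move=> v _; exact: cdiff_cont.
  - by [].
  - move=> v hv; rewrite ler_pdivlMr ?exprn_gt0 // mulrC -hv -cmodX -cmodM -qE.
    by apply: hM; rewrite hv.
have := qle z ltac:(rewrite /r; have := cmod_ge0 (z - a); lra).
rewrite ler_pdivlMr ?exprn_gt0 // => h1; apply: le_trans h1.
rewrite qE cmodM cmodX exprMn (mulrC (cmod (q z))) mulrA ler_wpM2r ?cmod_ge0 //.
rewrite ler_wpM2l ?exprn_ge0 //; apply: lerXn2r; rewrite ?nnegrE ?cmod_ge0 ?(ltW r0) //.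
by rewrite /r lerDl.
Qed.

Definition nonconst f := exists z w, f z != f w.

Lemma isolated_values f a : centire f -> nonconst f ->
  exists2 r, 0 < r & forall z, 0 < cmod (z - a) < r -> f z != f a.
Proof.
move=> fd [z [w fzw]].
have [|E|[r r0 hr]] := @isolated_zeros (fun z => f z - f a) a.
- by move=> v; apply: cdiffB => //; exact: cdiff_cst.
- have h v : f v = f a by apply/eqP; rewrite -subr_eq0 E.
  by move: fzw; rewrite !h eqxx.
- by exists r => // v /hr; rewrite subr_eq0.
Qed.

(** On a small circle about [a] the distance to [f a] has a positive minimum [mu], and [exists_zero]
    yields every value within [mu / 2]. *)
Lemma open_mapping f a e : centire f -> nonconst f -> 0 < e ->
  exists2 d, 0 < d & forall w, cmod (w - f a) < d -> exists2 z, cmod (z - a) < e & f z = w.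
Proof.
move=> fd fn e0; have [r r0 hr] := isolated_values a fd fn.
pose s := Num.min r e / 2.
have m0 : 0 < Num.min r e by rewrite lt_min r0.
have s0 : 0 < s by rewrite divr_gt0.
have : s < Num.min r e by rewrite /s; lra.
rewrite lt_min => /andP[sr se].
pose K : set (Cplx R) := [set z | cmod (z - a) = s].
have [||||m Km hm] := @compact_max R K (cmod a + s) (fun z => - cmod (f z - f a)).
- apply/closedC => z H; apply/le_anti/andP; split; apply/ler_addgt0Pr => t t0;
    have [w Kw hw] := H t t0.
    by have := cmod_tri z a w; rewrite (cmodB z w) Kw; lra.
  by have := cmod_tri w a z; rewrite Kw; lra.
- move=> z hz; rewrite -(subrK a z); apply: le_trans (cmodD _ _) _.
  by rewrite addrC hz.
- by exists (a + s%:C%C); rewrite /K /= (addrC a) addrK cmod_real gtr0_norm.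
- move=> z Kz t t0; have gc : ccont (fun z => f z - f a) z.
    by apply: ccontB; [exact: cdiff_cont|exact: ccont_cst].
  have [d d0 hd] := cmod_cont gc t0.
  by exists d => // w _ /hd; rewrite distrC opprK addrC.
pose mu := cmod (f m - f a).
have mu0 : 0 < mu by rewrite cmod_gt0 subr_eq0 hr // Km s0.
exists (mu / 2); first by rewrite divr_gt0.
move=> w hw.
have [|||||z zs fz] := @exists_zero R f a s (mu / 2) w.
- by rewrite divr_gt0.
- by move=> z _.
- move=> z /hm; rewrite lerN2 -/mu => h1.
  by have := cmod_tri (f z) (f a) w; rewrite -/mu; lra.
- exact: ltW.
- by rewrite cmodB.
by exists z => //; lra.
Qed.

Lemma centire_iter f n : centire f -> centire (iter n f).
Proof.
move=> fd; elim: n => [|n IH] z; first exact: cdiff_id.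
by apply: cdiff_comp (IH z) _; exact: fd.
Qed.

Lemma nonconst_comp f g : centire f -> nonconst f -> centire g -> nonconst g ->
  nonconst (fun z => f (g z)).
Proof.
move=> fd fn gd gn.
have [d d0 hd] := open_mapping 0 gd gn ltr01.
have [r r0 hr] := isolated_values (g 0) fd fn.
pose s := Num.min d r / 2.
have m0 : 0 < Num.min d r by rewrite lt_min r0 d0.
have s0 : 0 < s by rewrite divr_gt0.
have : s < Num.min d r by rewrite /s; lra.
rewrite lt_min => /andP[sd sr].
pose w := g 0 + s%:C%C.
have ws : cmod (w - g 0) = s by rewrite /w (addrC (g 0)) addrK cmod_real gtr0_norm.
have [z _ gz] := hd w ltac:(by rewrite ws).
by exists z, 0; rewrite gz hr // ws s0.
Qed.

Lemma nonconst_iter f n : centire f -> nonconst f -> nonconst (iter n f).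
Proof.
move=> fd fn; elim: n => [|n IH]; first by exists 1, 0; rewrite /= oner_neq0.
exact: (nonconst_comp fd fn (centire_iter n fd) IH).
Qed.

(** Liouville's theorem, then induction on the degree: the difference quotient at 0 loses one power
    of [r]. Bounds on arbitrarily large circles suffice, and this is what a failure of superlinear
    growth supplies. *)
Lemma polynomial_growth n f K : centire f ->
  (forall r0, exists2 r, r0 < r & forall z, cmod z = r -> cmod (f z) <= K * r ^+ n) ->
  exists p : {poly C}, forall z, f z = p.[z].
Proof.
elim: n f K => [|n IH] f K fd H.
  have K0 : 0 <= K.
    have [r r0 hr] := H 0; have := hr r%:C%C; rewrite cmod_real gtr0_norm // expr0 mulr1.
    by move=> /(_ erefl); apply: le_trans; exact: cmod_ge0.
  exists ((f 0)%:P) => z; rewrite hornerC.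
  have fK w : cmod (f w) <= K.
    have [r r0 hr] := H (cmod w).
    apply: (@max_principle_disc R [::] 0 r f) => //.
    - by move=> v _; exact: cdiff_cont.
    - by move=> v; rewrite subr0 => /hr; rewrite expr0 mulr1.
    - by rewrite subr0 ltW.
  apply/eqP; rewrite -subr_eq0 -cmod_eq0; apply/eqP/le_anti; rewrite cmod_ge0 andbT leNgt.
  apply/negP => d0.
  pose r := Num.max (cmod z + 1) (2 * K * cmod z / cmod (f z - f 0) + 1).
  have zr : cmod (z - 0) < r by rewrite subr0 lt_max ltrDl ltr01.
  have hs : cmod (f z - f 0) * r <= 2 * K * cmod (z - 0).
  apply: (@schwarz R (fun z => f z - f 0) 0 r (2 * K)) => //.
  - by move=> w _; apply: cdiffB => //; exact: cdiff_cst.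
  - by rewrite subrr.
  - move=> w _; apply: le_trans (cmodD _ _) _; rewrite cmodN mulr_natl mulr2n.
    by apply: lerD.
  move: hs; rewrite subr0 mulrC -ler_pdivlMr // => h.
  have : 2 * K * cmod z / cmod (f z - f 0) + 1 <= r by rewrite le_max lexx orbT.
  lra.
have fd0 := cderivP (fd 0).
have gd : centire (dquot f 0 (cderiv f 0)).
  by move=> z; apply: (@dquot_cdiff R f 0 (cderiv f 0) (cmod (z - 0) + 1)) => //; lra.
have [|p hp] := IH (dquot f 0 (cderiv f 0)) (K + cmod (f 0)) gd.
  move=> r0; have [r rr hr] := H (Num.max r0 1).
  move: rr; rewrite gt_max => /andP[r0r r1]; exists r => // z zr.
  have rp : 0 < r by lra.
  have z0 : z != 0 by rewrite -cmod_gt0 zr.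
  rewrite /dquot (negPf z0) subr0 cmodM cmodV zr ler_pdivrMr //.
  apply: le_trans (cmodD _ _) _; rewrite cmodN -mulrA -exprSr mulrDl.
  apply: lerD; first exact: hr.
  by rewrite ler_peMr ?cmod_ge0 // exprn_ege1 // ltW.
exists ((f 0)%:P + 'X * p) => z.
by rewrite (dquotE f 0 (cderiv f 0) z) subr0 hornerD hornerC hornerM hornerX hp.
Qed.

Definition transc f := centire f /\ ~ exists p : {poly C}, forall z, f z = p.[z].

Lemma transc_nonconst f : transc f -> nonconst f.
Proof.
move=> [_ fp]; apply: contrapT => N; apply: fp; exists ((f 0)%:P) => z.
rewrite hornerC; apply/eqP; apply: contrapT => /negP fz; apply: N.
by exists z, 0.
Qed.

Definition maxmod f r : R := sup [set cmod (f z) | z in [set z | cmod z <= r]].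

Lemma maxmod_attained f r : centire f -> 0 <= r ->
  (forall z, cmod z <= r -> cmod (f z) <= maxmod f r) /\
  exists2 z, cmod z = r & cmod (f z) = maxmod f r.
Proof.
move=> fd r0.
have fc z : cmod (z - 0) <= r -> ccont f z by move=> _; exact: cdiff_cont.
have [M M0 hM] := bounded_on_disc r0 fc.
have ub : has_ubound [set cmod (f z) | z in [set z | cmod z <= r]].
  by exists M => _ [z /= zr <-]; apply: hM; rewrite subr0.
have le z : cmod z <= r -> cmod (f z) <= maxmod f r.
  by move=> zr; apply: ub_le_sup => //; exists z.
split=> //.
pose K : set (Cplx R) := [set z | cmod z = r].
have [||||m Km hm] := @compact_max R K r (fun z => cmod (f z)).
- apply/closedC => z H; apply/le_anti/andP; split; apply/ler_addgt0Pr => t t0;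
    have [w Kw hw] := H t t0; rewrite /K /= in Kw.
    by have := cmod_subl z w; rewrite cmodB Kw; lra.
  by have := cmod_subl w z; rewrite Kw; lra.
- by move=> z ->.
- by exists r%:C%C; exact: etrans (cmod_real r) (ger0_norm r0).
- move=> z Kz t t0; have [d d0 hd] := cmod_cont (cdiff_cont (fd z)) t0.
  by exists d => // w _ /hd.
exists m => //; apply/le_anti; rewrite le ?Km //=.
apply: ge_sup; first by exists (cmod (f 0)), 0 => //; rewrite /mkset cmod0.
move=> _ [z /= zr <-].
apply: (@max_principle_disc R [::] 0 r f) => //.
- exact: cmod_ge0.
- by move=> w; rewrite subr0; exact: hm.
- by rewrite subr0.
Qed.

Lemma maxmod_le f r z : centire f -> cmod z <= r -> cmod (f z) <= maxmod f r.
Proof.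
move=> fd zr; have r0 : 0 <= r by apply: le_trans zr; exact: cmod_ge0.
by have [h _] := maxmod_attained fd r0; exact: h.
Qed.

Lemma maxmod_mono f r s : centire f -> 0 <= r -> r <= s -> maxmod f r <= maxmod f s.
Proof.
move=> fd r0 rs; have [_ [z zr <-]] := maxmod_attained fd r0.
by apply: maxmod_le => //; rewrite zr.
Qed.

Lemma maxmod_gt0 f r : centire f -> nonconst f -> 0 < r -> 0 < maxmod f r.
Proof.
move=> fd fn r0; have [e e0 he] := isolated_values 0 fd fn.
pose s := Num.min e r / 2.
have m0 : 0 < Num.min e r by rewrite lt_min e0.
have s0 : 0 < s by rewrite divr_gt0.
have : s < Num.min e r by rewrite /s; lra.
rewrite lt_min => /andP[se sr].
have sc : cmod (s%:C%C : C) = s by rewrite cmod_real gtr0_norm.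
have ne : f s%:C%C != f 0 by apply: he; rewrite subr0 sc s0.
have h1 := @maxmod_le f r s%:C%C fd; have h0 := @maxmod_le f r 0 fd.
rewrite cmod0 (ltW r0) in h0; rewrite sc (ltW sr) in h1.
rewrite lt_neqAle; apply/andP; split; last by apply: le_trans (h0 isT); exact: cmod_ge0.
apply/eqP => E; rewrite -E in h0 h1; move/negP: ne; apply; apply/eqP.
have z0 w : cmod (f w) <= 0 -> f w = 0.
  by move=> hw; apply/eqP; rewrite -cmod_eq0; apply/eqP/le_anti; rewrite hw cmod_ge0.
by rewrite (z0 _ (h0 isT)) (z0 _ (h1 isT)).
Qed.

(** Logarithmic coordinates for both the radius and the modulus, in which the three circles theorem
    is convexity. *)
Definition lmax f t : R := ln (maxmod f (expR t)).

Lemma lmaxE f t : centire f -> nonconst f -> expR (lmax f t) = maxmod f (expR t).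
Proof. by move=> fd fn; rewrite /lmax lnK // posrE maxmod_gt0 // expR_gt0. Qed.

Lemma lmax_mono f s t : centire f -> nonconst f -> s <= t -> lmax f s <= lmax f t.
Proof.
move=> fd fn st; rewrite -ler_expR !lmaxE //; by apply: maxmod_mono; rewrite ?expR_ge0 ?ler_expR.
Qed.

(* Three circles applied to [f ^+ q] with [p / q] close to the slope of the chord. *)
Lemma lmax_convex f t1 t t3 : centire f -> nonconst f -> t1 < t < t3 ->
  lmax f t <= lmax f t1 + (lmax f t3 - lmax f t1) / (t3 - t1) * (t - t1).
Proof.
move=> fd fn /andP[t1t tt3].
set s := (_ - _) / _; set L := _ + _.
have s0 : 0 <= s.
  by rewrite divr_ge0 ?subr_ge0 ?lmax_mono // ?ltW //; lra.
have LE : lmax f t3 - s * (t3 - t) = L.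
  have : s * (t3 - t1) = lmax f t3 - lmax f t1 by rewrite /s divfK // gt_eqF // subr_gt0; lra.
  by rewrite /L; lra.
(* Rounding [s * q] down to [p] costs less than 1, multiplied by [t3 - t], whatever [q] is; a large
   [q] then forces [lmax f t <= L]. *)
have key q : (0 < q)%N -> q%:R * (lmax f t - L) <= t3 - t.
  move=> q0; pose p := Num.truncn (s * q%:R).
  have sq0 : 0 <= s * q%:R by rewrite mulr_ge0.
  have /andP[p1 p2] : p%:R <= s * q%:R < p.+1%:R by exact: truncn_itv.
  clearbody p.
  have [_ [z zt fz]] := maxmod_attained fd (expR_ge0 t).
  have M0 u : 0 < maxmod f (expR u) by rewrite maxmod_gt0 // expR_gt0.
  have zE : cmod (z - 0) = expR t by rewrite subr0.
  have := @three_circles R (fun z => f z ^+ q) 0 (expR t1) (expR t3)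
     (maxmod f (expR t1) ^+ q) (maxmod f (expR t3) ^+ q) p (expR_gt0 _).
  have A1 u : 0 <= maxmod f (expR u) ^+ q by rewrite exprn_ge0 // ltW.
  move=> /(_ (A1 _) (A1 _)) /(_ (fun w _ => cdiffX q (fd w))).
  have bd u w : cmod (w - 0) = expR u -> cmod (f w ^+ q) <= maxmod f (expR u) ^+ q.
    rewrite subr0 cmodX => wE; apply: lerXn2r; rewrite ?nnegrE ?cmod_ge0 ?(ltW (M0 _)) //.
    by apply: maxmod_le; rewrite // wE.
  move=> /(_ (bd t1) (bd t3) z).
  rewrite zE !ler_expR (ltW t1t) (ltW tt3) => /(_ isT).
  have E1 u : (expR t / expR u) ^+ p = expR (p%:R * (t - u)).
    by rewrite expRM_natl expRD expRN.
  have E2 u : maxmod f (expR u) ^+ q = expR (q%:R * lmax f u).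
    by rewrite expRM_natl lmaxE.
  have P1 u : maxmod f (expR u) ^+ q * (expR t / expR u) ^+ p =
      expR (q%:R * lmax f u + p%:R * (t - u)).
    by rewrite expRD E1 E2.
  have toln u : cmod (f z ^+ q) <= maxmod f (expR u) ^+ q * (expR t / expR u) ^+ p ->
      q%:R * lmax f t <= q%:R * lmax f u + p%:R * (t - u).
    by rewrite P1 cmodX fz E2 ler_expR.
  rewrite le_max => /orP[/toln h|/toln h].
    have : p%:R * (t - t1) <= s * q%:R * (t - t1) by rewrite ler_wpM2r // subr_ge0 ltW.
    rewrite /L; lra.
  have : (s * q%:R - 1) * (t3 - t) <= p%:R * (t3 - t).
    by apply: ler_wpM2r; [rewrite subr_ge0 ltW|rewrite -natr1 in p2; lra].
  rewrite -LE; lra.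
rewrite leNgt; apply/negP => H.
have d0 : 0 < lmax f t - L by rewrite subr_gt0.
have := key (Num.truncn ((t3 - t) / (lmax f t - L))).+1 isT.
by rewrite -ler_pdivlMr // leNgt truncnS_gt.
Qed.

(** Otherwise [|f|] would be at most [r ^+ n] on arbitrarily large circles, and [f] would be a
    polynomial. *)
Lemma lmax_superlinear f k : transc f -> exists T, forall t, T <= t -> k * t <= lmax f t.
Proof.
move=> ft; have [fd fp] := ft; have fn := transc_nonconst ft.
pose n := (Num.truncn `|k|).+1.
have kn : k <= n%:R by apply: le_trans (ler_norm k) _; rewrite ltW // truncnS_gt.
apply: contrapT => N; apply: fp; apply: (@polynomial_growth n f 1) => // r0.
have [t [t0 tr tk]] : exists t, [/\ 0 <= t, r0 < expR t & lmax f t < k * t].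
  apply: contrapT => N'; apply: N; exists (Num.max 0 (ln (Num.max r0 0 + 1))) => t.
  rewrite ge_max => /andP[t0 tl]; rewrite leNgt; apply/negP => h; apply: N'; exists t; split=> //.
  have m0 : 0 <= Num.max r0 0 by rewrite le_max lexx orbT.
  have h1 : r0 <= Num.max r0 0 by rewrite le_max lexx.
  have h2 : Num.max r0 0 + 1 <= expR t.
    by rewrite -[leLHS]lnK ?ler_expR // posrE; lra.
  lra.
exists (expR t) => // z zt; rewrite mul1r -expRM_natl.
apply: le_trans (_ : expR (lmax f t) <= _); first by rewrite lmaxE //; apply: maxmod_le; rewrite // zt.
by rewrite ler_expR; apply: le_trans (ltW tk) _; rewrite ler_wpM2r.
Qed.

End Entire.

(** * Convex functions of superlinear growth *)

Section ConvexGrowth.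
Variable R : realType.
Implicit Types (t x y h K eta : R) (Phi N : R -> R).

Definition convex_chord Phi := forall t1 t t3, t1 < t < t3 ->
  Phi t <= Phi t1 + (Phi t3 - Phi t1) / (t3 - t1) * (t - t1).

Definition superlinear Phi := forall k : R, exists T, forall t, T <= t -> k * t <= Phi t.

Lemma slope_le Phi t1 t t3 : convex_chord Phi -> t1 < t < t3 ->
  (Phi t - Phi t1) / (t - t1) <= (Phi t3 - Phi t) / (t3 - t).
Proof.
move=> cv ht; have := cv _ _ _ ht; move: ht => /andP[h1 h2] h.
have u0 : 0 < t - t1 by rewrite subr_gt0.
have v0 : 0 < t3 - t by rewrite subr_gt0.
have w0 : 0 < t3 - t1 by lra.
rewrite ler_pdivrMr // mulrAC ler_pdivlMr //.
have : (Phi t - Phi t1) * (t3 - t1) <= (Phi t3 - Phi t1) * (t - t1).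
  rewrite -ler_pdivlMr // mulrAC; lra.
lra.
Qed.

(** The supremum of the slopes of the chords ending at [y] lies below the slope of every chord
    starting there. *)
Lemma subgradient Phi y : convex_chord Phi -> exists n, forall x, Phi y + n * (x - y) <= Phi x.
Proof.
move=> cv; pose S := [set (Phi y - Phi x) / (y - x) | x in [set x | x < y]].
have ub x' : y < x' -> ubound S ((Phi x' - Phi y) / (x' - y)).
  by move=> yx _ [x /= xy <-]; apply: slope_le => //; rewrite xy.
have S0 : S !=set0 by exists ((Phi y - Phi (y - 1)) / (y - (y - 1))), (y - 1) => //=; lra.
exists (sup S) => x; case: (ltgtP x y) => [xy|yx|->]; last by rewrite subrr mulr0 addr0.
  have : (Phi y - Phi x) / (y - x) <= sup S.
    apply: ub_le_sup; last by exists x.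
    by exists ((Phi (y + 1) - Phi y) / (y + 1 - y)); apply: ub; lra.
  by rewrite ler_pdivrMr ?subr_gt0 //; lra.
have : sup S <= (Phi x - Phi y) / (x - y) by apply: ge_sup => //; exact: ub.
by rewrite ler_pdivlMr ?subr_gt0 //; lra.
Qed.

(* Borel's growth lemma: the slope cannot grow by a fixed factor on every window of length
   comparable to its inverse, since these windows would have a finite total length. *)
Lemma flat_window Phi K eta : convex_chord Phi -> superlinear Phi -> 0 < K -> 0 < eta ->
  exists T, forall t, T <= t -> exists x nu, [/\ t <= x, 0 < nu, x + K / nu <= t + 1 &
    forall h, `|h| <= K / nu -> Phi (x + h) <= Phi x + nu * h + eta].
Proof.
move=> cv sl K0 eta0.
have /choice [N hN] : forall y, exists n, forall x, Phi y + n * (x - y) <= Phi x.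
  by move=> y; exact: subgradient.
have Nmono y y' : y <= y' -> N y <= N y'.
  rewrite le_eqVlt => /orP[/eqP ->//|yy].
  have h1 := hN y y'; have h2 := hN y' y.
  rewrite -(@ler_pM2r _ (y' - y)) ?subr_gt0 //; lra.
pose q := eta / K; have q0 : 0 < q by rewrite divr_gt0.
(* The solution of [2 * K + c / (1 + q) = c]: if the slope grows by the factor [1 + q] across each
   window, [c / N y] bounds the total length of the windows from [y] on. *)
pose c := 2 * K * (1 + q^-1).
have c0 : 0 < c by rewrite !mulr_gt0 // addr_gt0 // invr_gt0.
have cE : 2 * K + c / (1 + q) = c by rewrite /c; field; rewrite !gt_eqF //; lra.
(* A slope of at least [n0] makes the total length at most 1/2 and [K / N y] at most 1/4, so
   everything stays below [t + 1]. *)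
pose n0 := 2 * c + 4 * K.
have n0E : n0 = 2 * c + 4 * K by [].
have n00 : 0 < n0 by rewrite addr_gt0 // mulr_gt0.
clearbody n0.
have [T hT] : exists T, forall t, T <= t -> n0 <= N t.
  have [T hT] := sl (n0 + `|Phi 0|).
  exists (Num.max T 1) => t; rewrite ge_max => /andP[/hT h1 t1].
  have := hN t 0; rewrite sub0r => h2.
  have t0 : 0 < t by lra.
  rewrite -(@ler_pM2r _ t) //.
  have h3 : Phi 0 <= `|Phi 0| := ler_norm _.
  have h4 : `|Phi 0| <= `|Phi 0| * t by rewrite ler_peMr.
  lra.
exists T => t /hT Nt.
have Npos y : t <= y -> 0 < N y by move=> ty; apply: lt_le_trans (Nmono _ _ ty); lra.
have [y [ty yt Hy]] : exists y, [/\ t <= y, y <= t + 1 / 2 & N (y + 2 * K / N y) <= (1 + q) * N y].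
  apply: contrapT => Nex.
  pose u := fix u k := if k is k'.+1 then u k' + 2 * K / N (u k') else t.
  have uS k : u k.+1 = u k + 2 * K / N (u k) by [].
  (* The bound [u k + c / N (u k)] on what can still be reached does not increase with [k], so all
     [u k] stay below [t + 1 / 2] while the slopes grow geometrically, against monotonicity of
     [N]. *)
  have inv k : [/\ t <= u k, u k + c / N (u k) <= t + 1 / 2 & (1 + q) ^+ k * n0 <= N (u k)].
    elim: k => [|k [i1 i2 i3]].
      have h : c / N t <= 1 / 2 by rewrite ler_pdivrMr ?Npos //; lra.
      by split; [exact: lexx|rewrite lerD2l|rewrite expr0 mul1r].
    have Nk := Npos _ i1.
    have cN : 0 < c / N (u k) by rewrite divr_gt0.
    have up : u k <= t + 1 / 2 by lra.
    have gr : (1 + q) * N (u k) < N (u k.+1).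
      rewrite ltNge; apply/negP => H; apply: Nex; exists (u k); split => //.
    have st : 0 < 2 * K / N (u k) by rewrite divr_gt0 // mulr_gt0.
    split; first by rewrite uS; lra.
      apply: le_trans i2; rewrite uS -addrA lerD2l -uS.
      have h : c / N (u k.+1) <= c / (1 + q) / N (u k).
        rewrite -mulrA -invfM ler_wpM2l ?(ltW c0) // lef_pV2 ?posrE ?mulr_gt0 //; try lra.
        by apply: Npos; rewrite uS; lra.
      by rewrite -[in leRHS]cE mulrDl; lra.
    rewrite exprS -mulrA; apply: le_trans (ltW gr).
    by rewrite ler_wpM2l //; lra.
  suff : 1 + q <= 1 by lra.
  apply: (@pow_le_limit R _ _ n0 (N (t + 1 / 2))) => //; first lra.
  move=> k; rewrite expr1n mul1r; have [i1 i2 i3] := inv k; apply: le_trans i3 _.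
  apply: Nmono; have : 0 < c / N (u k) by rewrite divr_gt0 // Npos.
  lra.
have Ny := Npos y ty.
(* The midpoint of a window on which [N] varies by at most [q * N y]; over the length [K / N y] this
   produces an error of at most [q * K = eta]. *)
pose x := y + K / N y.
have Ky : 0 < K / N y by rewrite divr_gt0.
have yx : y <= x by rewrite /x; lra.
have tx : t <= x by lra.
have Nx := Npos x tx.
have Nyx := Nmono _ _ yx.
have Kx : K / N x <= K / N y by rewrite ler_wpM2l ?(ltW K0) // lef_pV2 ?posrE.
have Kn0 : K / N y <= 1 / 4.
  rewrite ler_pdivrMr //; have := Nmono _ _ ty; lra.
exists x, (N x); split=> //; first by rewrite /x; lra.
move=> h hh; have hh' : `|h| <= K / N y by lra.
have h1 := hN (x + h) x.
have win : N y <= N (x + h) <= (1 + q) * N y.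
  move: hh'; rewrite ler_norml => /andP[a1 a2]; apply/andP; split.
    by apply: Nmono; rewrite /x; lra.
  by apply: le_trans Hy; apply: Nmono; rewrite /x -mulrA; lra.
have Nx2 : N x <= (1 + q) * N y.
  by apply: le_trans Hy; apply: Nmono; rewrite /x -mulrA; lra.
have dN : `|N (x + h) - N x| <= q * N y.
  by move: win => /andP[a1 a2]; rewrite ler_norml; apply/andP; split; lra.
have : (N (x + h) - N x) * h <= eta.
  apply: le_trans (ler_norm _) _; rewrite normrM.
  apply: le_trans (_ : (q * N y) * (K / N y) <= _); first by apply: ler_pM.
  by rewrite /q (_ : eta / K * N y * (K / N y) = eta) //; field; rewrite !gt_eqF.
rewrite (_ : x - (x + h) = - h) in h1; last by ring.
lra.
Qed.

(** Beyond [t] chord slopes are at least that of the chord from 1 to [t], and this is at least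
    [Phi t / t] as soon as [Phi 1 * t <= Phi t]. *)
Lemma superlinear_scale Phi : convex_chord Phi -> superlinear Phi ->
  exists T, forall t c, T <= t -> 1 <= c -> c * Phi t <= Phi (c * t).
Proof.
move=> cv sl.
have [T hT] := sl (`|Phi 1|); exists (Num.max T 2) => t c.
rewrite ge_max => /andP[/hT h1 t2]; rewrite le_eqVlt => /orP[/eqP <-|c1]; first by rewrite !mul1r.
have t0 : 0 < t by lra.
have tc : t < c * t by rewrite -[ltLHS]mul1r ltr_pM2r.
have := @slope_le Phi 1 t (c * t) cv ltac:(apply/andP; split; lra).
have d0 : 0 < t - 1 by lra.
have d1 : 0 < c * t - t by lra.
rewrite ler_pdivlMr // mulrAC ler_pdivrMr // => h2.
have h3 : Phi 1 * t <= Phi t by apply: le_trans h1; rewrite ler_wpM2r ?(ltW t0) // ler_norm.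
rewrite -(@ler_pM2r _ (t - 1)) //.
have : (Phi t - Phi 1) * (c * t - t) = (c - 1) * (t * Phi t - Phi 1 * t) by ring.
have : (c - 1) * (Phi 1 * t) <= (c - 1) * Phi t by rewrite ler_wpM2l //; lra.
have -> : Phi (c * t) * (t - 1) = (Phi (c * t) - Phi t) * (t - 1) + Phi t * (t - 1) by ring.
have -> : c * Phi t * (t - 1) = (c - 1) * (t * Phi t) - (c - 1) * Phi t + Phi t * (t - 1) by ring.
lra.
Qed.

End ConvexGrowth.

(** * Circles covered by the image of a disc *)

Section CoveredCircles.
Variable R : realType.
Local Notation C := (R[i]).
Implicit Types (z w a b l : C) (r s e t x y M : R) (f g h F G : C -> C).

(* Near a point of maximum modulus [zr] with [|zr| = expR x] taken in a flat window of slope [nu],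
   [f (zr * cexp t)] is close to [f zr * cexp (nu * t)]. *)
Lemma covered_circle f : transc f -> exists T, forall t, T <= t ->
  exists2 s, lmax f t <= s & forall w, cmod w = expR s ->
    exists2 z, cmod z <= expR (t + 1) & f z = w.
Proof.
move=> ft; have [fd _] := ft; have fn := transc_nonconst ft.
have half : 0 < 1 / 2 :> R by lra.
have [d d0 hd] := @cder_cexp0 R _ half.
pose r0 := Num.min d 1 / 2.
have m0 : 0 < Num.min d 1 by rewrite lt_min d0 ltr01.
have r00 : 0 < r0 by rewrite divr_gt0.
have : r0 < Num.min d 1 by rewrite /r0; lra.
rewrite lt_min => /andP[r0d r01]; clearbody r0.
have e1 : 0 < expR 1 :> R := expR_gt0 _.
(* Then [expR 1 * (4 * eps) = r0 / 4], where 4 is the constant of [borel_carath] and [expR 1] bounds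
   [cexp] on the unit disc. *)
pose eps := r0 / (16 * expR 1).
have eps0 : 0 < eps by rewrite divr_gt0 // mulr_gt0.
have lneps : 0 < ln (1 + eps) by apply: ln_gt0; lra.
have p0 := pi_ge0 R.
(* In the scale of [nu], half the window must hold any argument up to [pi] plus a perturbation of
   size at most 1. *)
pose K := 2 * (pi + 1) : R.
have K0 : 0 < K by rewrite mulr_gt0 //; lra.
have cv : convex_chord (lmax f) by move=> t1 t t3; exact: lmax_convex.
have sl : superlinear (lmax f) by move=> k; exact: lmax_superlinear.
have [T hT] := flat_window cv sl K0 lneps.
exists T => t /hT [x [nu [tx nu0 xt hx]]].
exists (lmax f x); first exact: lmax_mono.
move=> w hw.
have [_ [zr zrE fzr]] := maxmod_attained fd (expR_ge0 x).
have fzr0 : f zr != 0 by rewrite -cmod_gt0 fzr maxmod_gt0 // expR_gt0.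
pose tau := K / nu.
have tau0 : 0 < tau by rewrite divr_gt0.
(* The relative error of the model [f zr * cexp (nu * u)]. The flat window bounds its real part from
   above by [eps], and [borel_carath] turns this into a bound on its modulus. *)
pose G (u : C) := f (zr * cexp u) * cexp (- (nu%:C%C * u)) / f zr - 1.
have Gd u : cdiff G u.
  apply: cdiffB; last exact: cdiff_cst.
  apply: cdiffM; last exact: cdiff_cst.
  apply: cdiffM.
    apply: (@cdiff_comp R f (fun u => zr * cexp u)); last exact: fd.
    by apply: cdiffM; [exact: cdiff_cst|exact: cdiff_cexp].
  have A : cdiff (fun u : C => - (nu%:C%C * u)) u.
    by apply: cdiffN; apply: cdiffM; [exact: cdiff_cst|exact: cdiff_id].
  exact: (cdiff_comp A (cdiff_cexp _)).
have G0 : G 0 = 0 by rewrite /G mulr0 oppr0 cexp0 !mulr1 mulfV // subrr.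
have Gle u : cmod (u - 0) < tau -> complex.Re (G u) <= eps.
  rewrite subr0 => hu.
  rewrite cReB lerBlDr; apply: le_trans (le_trans (ler_norm _) (cmod_re _)) _.
  have re : `|complex.Re u| <= K / nu by apply: le_trans (cmod_re u) (ltW hu).
  have h1 : cmod (f (zr * cexp u)) <= expR (lmax f (x + complex.Re u)).
    rewrite lmaxE //; apply: maxmod_le => //.
    by rewrite cmodM zrE cmod_cexp expRD.
  have -> : complex.Re (1 : C) = 1 by [].
  rewrite (cmodM _ (f zr)^-1) (cmodM (f _)) cmodV fzr -lmaxE // cmod_cexp.
  have -> : complex.Re (- (nu%:C%C * u)) = - (nu * complex.Re u).
    by case: (u) => u1 u2 /=; rewrite mul0r subr0.
  rewrite -ler_pdivlMr ?invr_gt0 ?expR_gt0 // invrK.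
  rewrite -ler_pdivlMr ?expR_gt0 //.
  apply: le_trans h1 _.
  have -> : eps + 1 = expR (ln (1 + eps)) by rewrite lnK ?posrE 1?addrC //; lra.
  rewrite expRN invrK.
  rewrite -(expRD (ln (1 + eps)) (lmax f x)) -(expRD (ln (1 + eps) + lmax f x) (nu * complex.Re u)).
  rewrite ler_expR; have := hx _ re; lra.
have Gsmall u : cmod u <= tau / 2 -> cmod (G u) <= 4 * eps.
  move=> hu; apply: (@borel_carath R G 0 tau eps eps0 (fun z _ => Gd z) G0 Gle u);
    rewrite subr0 //; lra.
have wf0 : w / f zr != 0.
  by rewrite mulf_neq0 ?invr_eq0 // -cmod_gt0 hw expR_gt0.
have [be /andP[be1 be2] hbe] := cexp_surj wf0.
have wf1 : cmod (w / f zr) = 1.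
  by rewrite cmodM cmodV hw fzr -lmaxE // mulfV // gt_eqF // expR_gt0.
rewrite wf1 ln1 in hbe.
pose U (S : C) := (S + Complex 0 be) / nu%:C%C.
have nuC : nu%:C%C != 0 :> C by rewrite -cmod_gt0 cmod_real gtr0_norm.
have Ule S : cmod S <= 1 -> cmod (U S) <= tau / 2.
  move=> hS; rewrite cmodM cmodV cmod_real gtr0_norm // ler_pdivrMr //.
  have -> : tau / 2 * nu = 1 + pi by rewrite /tau /K; field; rewrite gt_eqF.
  apply: le_trans (cmodD _ _) _; apply: lerD => //.
  apply: le_trans (cmod_le _) _; rewrite /= normr0 add0r ler_norml; apply/andP; split; lra.
(* As [w = f zr * cexp ('i * be)], the value of [f] at [zr * cexp (U S)] is [w * k S], so [k S = 1]
   is to be solved. It is solved near [S = 0], where [cexp S - 1] dominates the error. *)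
pose k S := cexp S * (1 + G (U S)).
have kd S : cdiff k S.
  apply: cdiffM; first exact: cdiff_cexp.
  apply: cdiffD; first exact: cdiff_cst.
  apply: (@cdiff_comp R G U); last exact: Gd.
  apply: cdiffM; last exact: cdiff_cst.
  by apply: cdiffD; [exact: cdiff_id|exact: cdiff_cst].
have epsE : expR 1 * (4 * eps) = r0 / 4 by rewrite /eps; field; rewrite gt_eqF.
have e11 : 1 < expR 1 :> R by rewrite expR_gt1.
have [S Sr kS] : exists2 S, cmod (S - 0) < r0 & k S = 1.
  apply: (@exists_zero R k 0 r0 (r0 / 4) 1).
  - by rewrite divr_gt0.
  - by move=> z _; exact: kd.
  - move=> S; rewrite subr0 => Sr.
    have h1 := hd S ltac:(by rewrite Sr).
    rewrite add0r cexp0 mul1r Sr in h1.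
    have h2 : cmod (cexp S * G (U S)) <= r0 / 4.
      rewrite -epsE cmodM; apply: ler_pM; rewrite ?cmod_ge0 //.
        rewrite cmod_cexp ler_expR; apply: le_trans (le_trans (ler_norm _) (cmod_re S)) _; lra.
      by apply: Gsmall; apply: Ule; lra.
    have h3 : r0 / 2 <= cmod (cexp S - 1).
      have := cmod_subl S (S - (cexp S - 1)).
      have -> : S - (S - (cexp S - 1)) = cexp S - 1 by ring.
      have -> : S - (cexp S - 1) = - (cexp S - 1 - S) by ring.
      rewrite cmodN Sr; lra.
    have := cmod_subl (cexp S - 1) (- (cexp S * G (U S))).
    have -> : cexp S - 1 - - (cexp S * G (U S)) = k S - 1 by rewrite /k; ring.
    rewrite cmodN; lra.
  - exact: ltW.
  - rewrite /k cexp0 mul1r addrC addKr.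
    have h : cmod (G (U 0)) <= 4 * eps by apply: Gsmall; apply: Ule; rewrite cmod0.
    apply: le_lt_trans h _; rewrite -epsE -[ltLHS]mul1r ltr_pM2r // mulr_gt0 //.
rewrite subr0 in Sr.
exists (zr * cexp (U S)).
  rewrite cmodM zrE cmod_cexp -expRD ler_expR.
  have := le_trans (le_trans (ler_norm _) (cmod_re (U S))) (Ule S ltac:(lra)).
  rewrite /tau; have : 0 < K / nu by []; lra.
move: kS; rewrite /k /G (addrC 1) subrK.
have -> : nu%:C%C * U S = S + Complex 0 be by rewrite /U mulrC divfK.
rewrite cexpN cexpD hbe => E.
have cS := cexp_neq0 S.
have w0 : w != 0 by rewrite -cmod_gt0 hw expR_gt0.
have := congr1 (fun v => v * w) E; rewrite mul1r => <-.
by field; rewrite cS w0 fzr0.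
Qed.

End CoveredCircles.

(** * Growth estimates uniform over all iterates *)

Section IterateGrowth.
Variable R : realType.
Local Notation C := (R[i]).
Implicit Types (z w : C) (t B : R) (f : C -> C).

(* By [covered_circle], [f] maps the disc of radius [expR t] onto a set containing a circle of
   radius at least [maxmod f (expR (t - 1))], so the loss against the iterates of [lmax f] is
   additive, hence summable relative to these iterates. *)
Lemma iter_growth f : transc f -> exists T, 1 <= T /\ forall t n, T <= t ->
  4 * lmax (iter n f) t <= lmax (iter n f) (8 * t).
Proof.
move=> ft; have [fd _] := ft; have fn := transc_nonconst ft.
have cv : convex_chord (lmax f) by move=> t1 t t3; exact: lmax_convex.
have sl : superlinear (lmax f) by move=> k; exact: lmax_superlinear.
have [T1 h1] := covered_circle ft.
have [T2 h2] := superlinear_scale cv sl.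
have [T3 h3] := sl 2.
pose T := Num.max (Num.max 1 T1) (Num.max T2 T3).
have [T_1 T_T1 T_T2 T_T3] : [/\ 1 <= T, T1 <= T, T2 <= T & T3 <= T].
  by rewrite /T !le_max !lexx !orbT.
clearbody T; exists T; split => //.
have fdn n : centire (iter n f) by exact: centire_iter.
have fnn n : nonconst (iter n f) by exact: nonconst_iter.
have up t n : lmax (iter n.+1 f) t <= lmax (iter n f) (lmax f t).
  have [_ [z zt fz]] := maxmod_attained (fdn n.+1) (expR_ge0 t).
  rewrite -ler_expR (lmaxE t (fdn n.+1) (fnn n.+1)) (lmaxE (lmax f t) (fdn n) (fnn n)).
  rewrite -fz iterSr; apply: maxmod_le => //.
  by rewrite lmaxE //; apply: maxmod_le => //; rewrite zt.
have low t n : T <= t -> lmax (iter n f) (lmax f t) <= lmax (iter n.+1 f) (t + 1).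
  move=> Tt; have [s st hs] := h1 t (le_trans T_T1 Tt).
  apply: le_trans (lmax_mono (fdn n) (fnn n) st) _.
  have [_ [w ws fw]] := maxmod_attained (fdn n) (expR_ge0 s).
  have [z zt fz] := hs w ws.
  rewrite -ler_expR (lmaxE s (fdn n) (fnn n)) (lmaxE (t + 1) (fdn n.+1) (fnn n.+1)).
  by rewrite -fw -fz -iterSr; apply: maxmod_le.
(* The slack [4 / t] pays for all losses: one step replaces [B] by [B - 1 / t] and [t] by
   [lmax f t >= 2 * t], and [3 / t] still exceeds [4 / lmax f t]. For [t >= 1] one may take
   [B = 8]. *)
have claim n : forall t B, T <= t -> 4 + 4 / t <= B -> 4 * lmax (iter n f) t <= lmax (iter n f) (B * t).
  elim: n => [|n IH] t B Tt hB.
    have lid u : lmax (iter 0 f) u = u.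
      apply: (@expR_inj R); rewrite (lmaxE u (fdn 0%N) (fnn 0%N)).
      have [_ [z zu <-]] := maxmod_attained (fdn 0%N) (expR_ge0 u).
      exact: zu.
    rewrite !lid; have t0 : 0 < t by lra.
    have q0 : 0 < 4 / t by rewrite divr_gt0.
    by rewrite ler_pM2r //; lra.
  have t0 : 0 < t by lra.
  have it0 : 0 < t^-1 by rewrite invr_gt0.
  have it1 : t^-1 <= 1 by rewrite invf_le1 //; lra.
  have P2t : 2 * t <= lmax f t by apply: h3; exact: le_trans Tt.
  have TP : T <= lmax f t by lra.
  have P0 : 0 < lmax f t by lra.
  apply: le_trans (_ : 4 * lmax (iter n f) (lmax f t) <= _); first by rewrite ler_pM2l.
  have B1 : 1 <= B - t^-1 by lra.
  have invP : (lmax f t)^-1 <= t^-1 / 2.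
    rewrite (_ : t^-1 / 2 = (2 * t)^-1) ?lef_pV2 ?posrE ?mulr_gt0 //.
    by rewrite invfM mulrC.
  apply: le_trans (IH (lmax f t) (B - t^-1) TP ltac:(lra)) _.
  have Bt : B * t = (B - t^-1) * t + 1 by rewrite mulrBl mulVf ?gt_eqF //; ring.
  rewrite Bt.
  have TBt : T <= (B - t^-1) * t by apply: le_trans Tt _; rewrite ler_peMl // ltW.
  apply: le_trans _ (low _ n TBt).
  by apply: lmax_mono => //; apply: h2 => //; exact: le_trans Tt.
move=> t n Tt; apply: claim => //.
have : t^-1 <= 1 by rewrite invf_le1; lra.
lra.
Qed.

End IterateGrowth.

(** * Loops in the plane *)

Section LatticeLoops.
Local Open Scope int_scope.
Local Notation V := (int * int)%type.
Implicit Types (p q a b c v x y : V) (s : seq V).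

Definition adjacent p q := (`|p.1 - q.1| + `|p.2 - q.2| <= 1)%N.

Definition sumP (F : V -> V -> int) : V -> seq V -> int :=
  fix sumP b s := if s is x :: s' then F b x + sumP x s' else 0.

Lemma sumP_cat F b s1 s2 : sumP F b (s1 ++ s2) = sumP F b s1 + sumP F (last b s1) s2.
Proof. by elim: s1 b => [|x s1 IH] b /=; rewrite ?add0r // IH addrA. Qed.

Lemma sumP_telescope (g : V -> int) b s :
  sumP (fun p q => g q - g p) b s = g (last b s) - g b.
Proof. by elim: s b => [|x s IH] b /=; rewrite ?subrr // IH; lia. Qed.

Lemma sumP_eq (e : rel V) (F G : V -> V -> int) b s : path e b s ->
  (forall p q, p \in b :: s -> q \in b :: s -> e p q -> F p q = G p q) ->
  sumP F b s = sumP G b s.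
Proof.
elim: s b => //= x s IH b /andP[bx ps] H; rewrite H ?inE ?eqxx ?orbT //.
by rewrite (IH x) // => p q hp hq; apply: H; rewrite inE ?hp ?hq orbT.
Qed.

Lemma sumP_eq0 (e : rel V) F b s : path e b s ->
  (forall p q, p \in b :: s -> q \in b :: s -> e p q -> F p q = 0) -> sumP F b s = 0.
Proof.
move=> ps H; rewrite (@sumP_eq e F (fun p q => 0 - 0) b s ps) ?(sumP_telescope (fun=> 0)) ?subrr //.
Qed.

Lemma sumP_neq0 (e : rel V) F b s : path e b s -> sumP F b s != 0 ->
  exists p q, [/\ p \in b :: s, q \in b :: s, e p q & F p q != 0].
Proof.
move=> ps H; apply: contrapT => N; move/eqP: H; apply; apply: (sumP_eq0 ps) => p q hp hq pq.
by apply/eqP; apply: contrapT => /negP Fpq; apply: N; exists p, q.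
Qed.

(* The signed number of crossings of the horizontal ray going right from the unit cell with
   lower left corner [(i, j)]. *)
Definition crossing (i j : int) p q : int :=
  if (p.1 == q.1) && (i < p.1) then
    if (p.2 == j) && (q.2 == j + 1) then 1 else
    if (p.2 == j + 1) && (q.2 == j) then -1 else 0
  else 0.

Definition winding i j b s := sumP (crossing i j) b s.

(** The two rays differ only by the edge shared by the two cells, so a change of the winding number
    forces the loop to run along it. *)
Lemma winding_horizontal (e : rel V) i j b s : (forall p q, e p q -> adjacent p q) ->
  path e b s -> winding (i - 1) j b s != winding i j b s ->
  exists p q, e p q /\ (p = (i, j) /\ q = (i, j + 1) \/ p = (i, j + 1) /\ q = (i, j)).
Proof.
move=> ea ps /eqP H; apply: contrapT => N; apply: H.
apply: (sumP_eq ps) => p q _ _ pq; rewrite /crossing.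
have pq1 : ~ (p = (i, j) /\ q = (i, j + 1)) by move=> h; apply: N; exists p, q; split => //; left.
have pq2 : ~ (p = (i, j + 1) /\ q = (i, j)) by move=> h; apply: N; exists p, q; split => //; right.
move: pq1 pq2; case: p q {pq N} => p1 p2 [q1 q2] /= n1 n2.
have {}n1 : ~~ [&& p1 == i, p2 == j, q1 == i & q2 == j + 1].
  by apply/negP => /and4P[/eqP h1 /eqP h2 /eqP h3 /eqP h4]; apply: n1; rewrite h1 h2 h3 h4.
have {}n2 : ~~ [&& p1 == i, p2 == j + 1, q1 == i & q2 == j].
  by apply/negP => /and4P[/eqP h1 /eqP h2 /eqP h3 /eqP h4]; apply: n2; rewrite h1 h2 h3 h4.
by repeat (case: ifP => ?); lia.
Qed.

(** Off the shared edge, the crossings of the two rays differ by the coboundary [g q - g p], whose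
    sum around a loop is zero. *)
Lemma winding_vertical (e : rel V) i j b s : (forall p q, e p q -> adjacent p q) ->
  path e b s -> last b s = b -> winding i (j - 1) b s != winding i j b s ->
  exists p q, e p q /\ (p = (i, j) /\ q = (i + 1, j) \/ p = (i + 1, j) /\ q = (i, j)).
Proof.
move=> ea ps lb /eqP H; apply: contrapT => N; apply: H.
pose g p : int := if (i < p.1) && (p.2 == j) then 1 else 0.
suff -> : winding i (j - 1) b s = sumP (fun p q => crossing i j p q + (g q - g p)) b s.
  have -> t : sumP (fun p q => crossing i j p q + (g q - g p)) t s =
     winding i j t s + sumP (fun p q => g q - g p) t s.
    by rewrite /winding; elim: s t {ps lb N} => //= x s IH t; rewrite IH; lia.
  by rewrite sumP_telescope lb subrr addr0.
apply: (sumP_eq ps) => p q _ _ pq; rewrite /crossing /g.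
have pq1 : ~ (p = (i, j) /\ q = (i + 1, j)) by move=> h; apply: N; exists p, q; split => //; left.
have pq2 : ~ (p = (i + 1, j) /\ q = (i, j)) by move=> h; apply: N; exists p, q; split => //; right.
have := ea _ _ pq; rewrite /adjacent; move: pq1 pq2; case: p q {pq N} => p1 p2 [q1 q2] /= n1 n2.
have {}n1 : ~~ [&& p1 == i, p2 == j, q1 == i + 1 & q2 == j].
  by apply/negP => /and4P[/eqP h1 /eqP h2 /eqP h3 /eqP h4]; apply: n1; rewrite h1 h2 h3 h4.
have {}n2 : ~~ [&& p1 == i + 1, p2 == j, q1 == i & q2 == j].
  by apply/negP => /and4P[/eqP h1 /eqP h2 /eqP h3 /eqP h4]; apply: n2; rewrite h1 h2 h3 h4.
by repeat (case: ifP => ?); lia.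
Qed.

(** A loop crosses a full horizontal line zero times in total, so the ray going left may be used
    with the opposite sign. The column [p.1 - 1] makes the ray condition inside [crossing] true,
    leaving only the test [p.1 <= i]. *)
Lemma winding_left i j b s (e : rel V) : (forall p q, e p q -> adjacent p q) ->
  path e b s -> last b s = b ->
  winding i j b s = - sumP (fun p q => if p.1 <= i then crossing (p.1 - 1) j p q else 0) b s.
Proof.
move=> ea ps lb.
pose g p : int := if j < p.2 then 1 else 0.
suff H : forall t, path e t s -> winding i j t s +
    sumP (fun p q => if p.1 <= i then crossing (p.1 - 1) j p q else 0) t s =
    sumP (fun p q => g q - g p) t s.
  by have := H b ps; rewrite sumP_telescope lb subrr; lia.
rewrite /winding; elim: s {ps lb} => //= x s IH t /andP[tx px].
rewrite -(IH x px); have := ea _ _ tx.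
move: (sumP _ x s) (sumP _ x s) => A B.
by rewrite /adjacent /crossing /g; case: t x {tx px IH} => t1 t2 [x1 x2] /=; repeat (case: ifP => ?); lia.
Qed.

Variables (e : rel V) (tri : V -> V -> V -> Prop).

Definition corner (i j : int) p := ((p.1 == i) || (p.1 == i + 1)) && ((p.2 == j) || (p.2 == j + 1)).

Hypothesis e_adj : forall p q, e p q -> adjacent p q.
Hypothesis e_sym : forall p q, e p q -> e q p.
Hypothesis e_refl : forall p q, e p q -> e p p.
Hypothesis tri_edge : forall p q a b c, e p q -> (a == p) || (a == q) ->
  (b == p) || (b == q) -> (c == p) || (c == q) -> tri a b c.
(** The only access of the combinatorics to the topology of the domain: whatever a loop encircles
    may be filled. *)
Hypothesis cell_in : forall b s i j, path e b s -> last b s = b -> winding i j b s != 0 ->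
  (forall a x y, corner i j a -> corner i j x -> corner i j y -> tri a x y) /\
  (forall a x, corner i j a -> corner i j x -> adjacent a x -> e a x).

(** A move shifts one vertex and sweeps the two triangles required of it. Lengths are preserved, so
    the polygonal loops of both lists have the same parameter interval. *)
Inductive lhom : seq V -> seq V -> Prop :=
| lhom_refl l : lhom l l
| lhom_step A a x y c B l : tri a x y -> tri x y c ->
    lhom (A ++ [:: a, y, c & B]) l -> lhom (A ++ [:: a, x, c & B]) l.

Lemma lhom_trans l1 l2 l3 : lhom l1 l2 -> lhom l2 l3 -> lhom l1 l3.
Proof. by elim => // A a x y c B l t1 t2 _ IH /IH; exact: lhom_step. Qed.

Lemma lhom_ctx A B l1 l2 : lhom l1 l2 -> lhom (A ++ l1 ++ B) (A ++ l2 ++ B).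
Proof.
elim => [l|A' a x y c B' l t1 t2 _ IH]; first exact: lhom_refl.
rewrite -catA catA; apply: lhom_step t1 t2 _.
by rewrite -catA; move: IH; rewrite -catA.
Qed.

(** Since moves preserve the length, a loop gets shorter by pushing a stationary step to its end. *)
Lemma lhom_stutter a s : path e a s -> lhom [:: a, a & s] (rcons (a :: s) (last a s)).
Proof.
elim: s a => [|x s IH] a /=; first by move=> _; exact: lhom_refl.
move=> /andP[ax px].
apply: (@lhom_step [::] a a x x s).
- by apply: (tri_edge ax); rewrite eqxx ?orbT.
- by apply: (tri_edge ax); rewrite eqxx ?orbT.
- by have := lhom_ctx [:: a] [::] (IH x px); rewrite !cats0.
Qed.

Lemma repeated_split (l : seq V) : ~~ uniq l -> exists A a M B, l = A ++ a :: M ++ a :: B.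
Proof.
elim: l => //= x l IH; rewrite negb_and negbK => /orP[xl|/IH [A [a [M [B ->]]]]].
  by case/splitPr: xl => M B; exists [::], x, M, B.
by exists (x :: A), a, M, B.
Qed.

Definition lnorm b v := (`|v.1 - b.1| + `|v.2 - b.2|)%N.

Lemma max_norm b s : s != [::] -> exists2 v, v \in s & forall u, u \in s -> (lnorm b u <= lnorm b v)%N.
Proof.
elim: s => //= x [|y s] IH _; first by exists x; rewrite ?inE // => u; rewrite inE => /eqP ->.
have [v vs hv] := IH isT.
have [h|h] := leqP (lnorm b x) (lnorm b v).
  by exists v; [rewrite inE vs orbT|move=> u; rewrite inE => /orP[/eqP ->//|/hv]].
exists x; first by rewrite inE eqxx.
move=> u; rewrite inE => /orP[/eqP ->//|/hv h']; exact: leq_trans h' (ltnW h).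
Qed.

(** At a vertex farthest from [b] the two edges turn back towards [b], one in each coordinate. The
    horizontal ray from the cell of this corner, on the side away from [b], crosses the loop only at
    the vertical edge at [v]: any other crossing edge would have an endpoint farther than [v]. So
    the cell is encircled, and [d] is its fourth corner. *)
Lemma winding_corner b A a v c B : path e b (A ++ [:: v, c & B]) -> last b (A ++ [:: v, c & B]) = b ->
  a = last b A -> v \notin b :: A -> v \notin c :: B -> a != c ->
  (forall u, u \in b :: A ++ [:: v, c & B] -> (lnorm b u <= lnorm b v)%N) ->
  exists i j, [/\ winding i j b (A ++ [:: v, c & B]) != 0,
    corner i j a, corner i j v, corner i j c &
    exists d, [/\ corner i j d, adjacent a d, adjacent d c & (lnorm b d < lnorm b v)%N]].
Proof.
move=> ps lb aE vA vB ac mx.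
have ps' := ps; move: ps'; rewrite cat_path /= -aE => /and4P[pA av vc pB].
have avN : a != v.
  by apply/eqP => E; move: vA; rewrite -E aE mem_last.
have cvN : c != v.
  by apply/eqP => E; move: vB; rewrite E inE eqxx.
have ma : (lnorm b a <= lnorm b v)%N by apply: mx; rewrite -cat_cons mem_cat aE mem_last.
have mc : (lnorm b c <= lnorm b v)%N by apply: mx; rewrite -cat_cons mem_cat !inE eqxx !orbT.
have hav := e_adj av; have hvc := e_adj vc.
have split_sum F : (forall p q, p \in b :: A ++ [:: v, c & B] -> q \in b :: A ++ [:: v, c & B] ->
     p != v -> q != v -> e p q -> F p q = 0) ->
     sumP F b (A ++ [:: v, c & B]) = F a v + F v c.
  move=> H; rewrite sumP_cat /= -aE.
  have -> : sumP F b A = 0.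
    apply: (sumP_eq0 pA) => p q hp hq pq; apply: H => //.
    - by rewrite -cat_cons mem_cat hp.
    - by rewrite -cat_cons mem_cat hq.
    - by apply: contraNneq vA => <-.
    - by apply: contraNneq vA => <-.
  have -> : sumP F c B = 0.
    apply: (sumP_eq0 pB) => p q hp hq pq; apply: H => //.
    - by rewrite -cat_cons mem_cat (in_cons v) hp !orbT.
    - by rewrite -cat_cons mem_cat (in_cons v) hq !orbT.
    - by apply: contraNneq vB => <-.
    - by apply: contraNneq vB => <-.
  by rewrite add0r addr0.
(* The signs point from [b] to [v]. As [a] and [c] are distinct and no farther than [v], each is one
   step back, in different coordinates. *)
have nbr (s1 s2 : int) : (s1 = 1 /\ 0 <= v.1 - b.1) \/ (s1 = -1 /\ v.1 - b.1 < 0) ->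
    (s2 = 1 /\ 0 <= v.2 - b.2) \/ (s2 = -1 /\ v.2 - b.2 < 0) ->
    [/\ a = (v.1 - s1, v.2), c = (v.1, v.2 - s2), v.1 != b.1 & v.2 != b.2] \/
    [/\ a = (v.1, v.2 - s2), c = (v.1 - s1, v.2), v.1 != b.1 & v.2 != b.2].
  move: ac avN cvN ma mc hav hvc {split_sum mx ps lb aE vA vB pA av vc pB}.
  rewrite /lnorm /adjacent; case: (a) (v) (b) (c) => a1 a2 [v1 v2] [b1 b2] [c1 c2] /=.
  rewrite !xpair_eqE => n1 n2 n3 m1 m2 d1 d2.
  have step (p1 p2 : int) : ~~ ((p1 == v1) && (p2 == v2)) -> (`|p1 - v1| + `|p2 - v2| <= 1)%N ->
    (`|p1 - b1| + `|p2 - b2| <= `|v1 - b1| + `|v2 - b2|)%N ->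
    [\/ [/\ p1 = v1 + 1, p2 = v2 & v1 - b1 < 0], [/\ p1 = v1 - 1, p2 = v2 & 0 < v1 - b1],
       [/\ p1 = v1, p2 = v2 + 1 & v2 - b2 < 0] | [/\ p1 = v1, p2 = v2 - 1 & 0 < v2 - b2]].
    move=> k1 k2 k3; have [h|[h|[h|h]]] : (p1 = v1 + 1 /\ p2 = v2) \/ (p1 = v1 - 1 /\ p2 = v2) \/
       (p1 = v1 /\ p2 = v2 + 1) \/ (p1 = v1 /\ p2 = v2 - 1) by clear -k1 k2; lia.
    - by move: h k3 => [-> ->]; clear; move=> k3; constructor 1; split=> //; lia.
    - by move: h k3 => [-> ->]; clear; move=> k3; constructor 2; split=> //; lia.
    - by move: h k3 => [-> ->]; clear; move=> k3; constructor 3; split=> //; lia.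
    - by move: h k3 => [-> ->]; clear; move=> k3; constructor 4; split=> //; lia.
  have e1' : (`|c1 - v1| + `|c2 - v2| <= 1)%N by move: d2; clear; lia.
  have cA := step a1 a2 n2 d1 m1; have cC := step c1 c2 n3 e1' m2.
  move: n1 cA cC; clear => n1 cA cC s1E s2E.
  move: n1; case: cA => [] [-> -> x1]; case: cC => [] [-> -> x2] n1;
    case: s1E => [] [-> s1']; case: s2E => [] [-> s2']; try (exfalso; lia);
    first [by left; split; [congr (_, _); lia|congr (_, _); lia|lia|lia]
          |by right; split; [congr (_, _); lia|congr (_, _); lia|lia|lia]].
have zero (i j : int) p q : p \in b :: A ++ [:: v, c & B] -> q \in b :: A ++ [:: v, c & B] ->
    p != v -> q != v ->
    (i < p.1 -> (0 <= v.1 - b.1 /\ v.1 <= p.1) \/ (v.1 - b.1 < 0 /\ p.1 <= v.1)) ->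
    (j = v.2 \/ j + 1 = v.2) -> crossing i j p q = 0.
  move=> hp hq pv qv h1 h2; rewrite /crossing; case: ifP => // /andP[/eqP pq1 /h1 h].
  have np := mx _ hp; have nq := mx _ hq; rewrite /lnorm in np nq.
  have off (u : V) : u != v -> u.1 = p.1 -> (`|u.1 - b.1| + `|u.2 - b.2| <= `|v.1 - b.1| + `|v.2 - b.2|)%N ->
      u.2 = v.2 -> False.
    move=> uv e1 nu e2; have e3 : u.1 <> v.1.
      by move=> e3; move/eqP: uv; apply; case: (u) (v) e2 e3 => ? ? [? ?] /= -> ->.
    by move: nu e3 h; rewrite e2 e1; clear; lia.
  have pv2 := off p pv erefl np; have qv2 := off q qv (esym pq1) nq.
  by case: ifP => [/andP[/eqP e1 /eqP e2]|_]; [|case: ifP => // /andP[/eqP e1 /eqP e2]];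
    exfalso; move: h2 => [] h2; [apply: pv2|apply: qv2|apply: qv2|apply: pv2]; rewrite ?e1 ?e2.
have up i j (x : int) : i < x -> crossing i j (x, j) (x, j + 1) = 1.
  by move=> ix; rewrite /crossing /= !eqxx ix.
have down i j (x : int) : i < x -> crossing i j (x, j + 1) (x, j) = -1.
  move=> ix; rewrite /crossing /= !eqxx ix /=.
  by rewrite (_ : (j + 1 == j) = false) //; apply/negbTE; clear; lia.
have flat i j p q : p.1 != q.1 -> crossing i j p q = 0.
  by move=> h; rewrite /crossing (negPf h).
have vE : v = (v.1, v.2) by case: (v).
suff final i j (s1 s2 : int) :
    (s1 = 1 /\ 0 <= v.1 - b.1) /\ i = v.1 - 1 \/ (s1 = -1 /\ v.1 - b.1 < 0) /\ i = v.1 ->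
    (s2 = 1 /\ 0 <= v.2 - b.2) /\ j = v.2 - 1 \/ (s2 = -1 /\ v.2 - b.2 < 0) /\ j = v.2 ->
    exists i j, [/\ winding i j b (A ++ [:: v, c & B]) != 0,
      corner i j a, corner i j v, corner i j c &
      exists d, [/\ corner i j d, adjacent a d, adjacent d c & (lnorm b d < lnorm b v)%N]].
  have [x0|x0] := lerP 0 (v.1 - b.1); have [y0|y0] := lerP 0 (v.2 - b.2).
  - by apply: (final (v.1 - 1) (v.2 - 1) 1 1); left.
  - by apply: (final (v.1 - 1) v.2 1 (-1)); [left|right].
  - by apply: (final v.1 (v.2 - 1) (-1) 1); [right|left].
  - by apply: (final v.1 v.2 (-1) (-1)); right.
move=> hi hj; exists i, j.
have jv : j = v.2 \/ j + 1 = v.2 by move: hj; clear; lia.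
have {}nbr := nbr s1 s2 ltac:(by case: hi => [] [h _]; [left|right]) ltac:(by case: hj => [] [h _]; [left|right]).
have vert k w : (k < v.1) -> w = (v.1, v.2 - s2) -> crossing k j w v != 0 /\ crossing k j v w != 0.
  move=> kv ->; rewrite vE /=; case: hj => [] [[-> _] ->].
    by have := up k (v.2 - 1) _ kv; have := down k (v.2 - 1) _ kv; rewrite !subrK => -> ->.
  rewrite (_ : v.2 - -1 = v.2 + 1); last by clear; lia.
  by have := up k v.2 _ kv; have := down k v.2 _ kv => -> ->.
have horiz k w : w = (v.1 - s1, v.2) -> crossing k j w v = 0 /\ crossing k j v w = 0.
  have h : v.1 - s1 != v.1 by move: hi; clear; lia.
  by move=> ->; split; apply: flat => //=; rewrite eq_sym.
split.
- case: (hi) => [] [[s1E x0] iE].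
    have iv : i < v.1 by rewrite iE; clear; lia.
    rewrite /winding split_sum.
      case: nbr => [] [aE' cE' _ _].
        by have [-> _] := horiz i _ aE'; have [_ h] := vert i _ iv cE'; rewrite add0r.
      by have [h _] := vert i _ iv aE'; have [_ ->] := horiz i _ cE'; rewrite addr0.
    move=> p q hp hq pv qv _; apply: zero => // ip; left; split => //.
    by move: ip; rewrite iE; clear; lia.
  have iv : v.1 - 1 < v.1 by clear; lia.
  rewrite (winding_left _ _ e_adj ps lb) split_sum.
    rewrite oppr_eq0 iE lexx.
    case: nbr => [] [aE' cE' _ _].
      rewrite [a.1 <= _](_ : _ = false); last by rewrite aE' s1E /=; clear; lia.
      by have [_ h] := vert _ _ iv cE'; rewrite add0r.
    rewrite [a.1 <= _](_ : _ = true); last by rewrite aE' /= lexx.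
    have -> : a.1 = v.1 by rewrite aE'.
    by have [h _] := vert _ _ iv aE'; have [_ ->] := horiz (v.1 - 1) _ cE'; rewrite addr0.
  move=> p q hp hq pv qv _; case: ifP => // pi; apply: zero => // _; right; split => //.
  by move: pi; rewrite iE.
- by case: nbr => [] [aE' _ _ _]; rewrite aE' /corner /=; move: hi hj; clear; lia.
- by move: hi hj; rewrite /corner; clear; lia.
- by case: nbr => [] [_ cE' _ _]; rewrite cE' /corner /=; move: hi hj; clear; lia.
- exists (v.1 - s1, v.2 - s2); move: hi hj nbr; rewrite /corner /adjacent /lnorm; case: (v) (b) => v1 v2 [b1 b2] /=.
  by clear; move=> hi hj [] [-> -> h1 h2] /=; split; lia.
Qed.

(* A loop visiting a vertex twice splits off a shorter loop; a simple loop has a convex corner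
   at a vertex farthest from the base point, and the cell at this corner can be removed. *)
Lemma lhom_const n b s : (size s <= n)%N -> path e b s -> last b s = b ->
  lhom (b :: s) (nseq (size s).+1 b).
Proof.
elim: n b s => [|n IHn] b s; first by case: s => // _ _ _; exact: lhom_refl.
(* At fixed length, the inner induction is on the sum of the distances to [b], which drops when [v]
   is replaced by [d]. *)
move: {2}(sumn [seq lnorm b v | v <- s]).+1 (leqnn (sumn [seq lnorm b v | v <- s]).+1) => m.
elim: m s => // m IHm s; rewrite ltnS => sm sn ps lb.
have [-> |s0] := eqVneq s [::]; first exact: lhom_refl.
have sE : b :: s = rcons (belast b s) b by rewrite lastI lb.
have [U|] := boolP (uniq (belast b s)); last first.
  move=> /repeated_split [A [a [M [B E]]]].
  have {}sE : b :: s = A ++ a :: M ++ a :: rcons B b by rewrite sE E rcons_cat /= rcons_cat.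
  have pA (X Y : seq V) : b :: s = X ++ a :: Y -> path e a Y /\ forall Z, path e a Z ->
      exists s', [/\ X ++ a :: Z = b :: s', path e b s' & last b s' = last a Z].
    case: X => [|x X] /= [bE sE']; move: ps; rewrite bE sE'.
      by move=> pY; split=> // Z pZ; exists Z.
    rewrite cat_path /= => /and3P[pX lX pY]; split=> // Z pZ.
    by exists (X ++ a :: Z); split; rewrite ?last_cat // cat_path /= pX lX.
  have [pM pext] := pA _ _ sE.
  move: pM; rewrite cat_path /= => /and3P[pM eM pB].
  have eaa : e a a by exact: e_refl (e_sym eM).
  have szE : (size s).+1 = (size A + (size M + (size B).+1).+2)%N.
    by rewrite -[LHS]/(size (b :: s)) sE size_cat /= size_cat /= size_rcons; clear; lia.
  have h1 : lhom (a :: rcons M a) (nseq (size M).+2 a).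
    have := IHn a (rcons M a); rewrite size_rcons rcons_path pM eM last_rcons; apply=> //.
    by move: szE sn; clear; lia.
  (* Contracting the inner loop leaves stationary steps at [a]; one of them moves to the end as a
     repetition of [b], and the rest is a loop shorter by one. *)
  pose T := nseq (size M) a ++ rcons B b.
  have pn k : path e a (nseq k a) by elim: k => //= k ->; rewrite eaa.
  have ln k : last a (nseq k a) = a by elim: k => //= k; case: k.
  have pT : path e a T by rewrite cat_path pn ln.
  have lT : last a T = b by rewrite last_cat ln last_rcons.
  have h2 : lhom (b :: s) ((A ++ a :: T) ++ [:: b]).
    rewrite sE (_ : A ++ a :: M ++ a :: rcons B b = A ++ (a :: rcons M a) ++ rcons B b); last first.
      by rewrite /= cat_rcons.
    apply: lhom_trans (lhom_ctx A (rcons B b) h1) _.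
    have := lhom_ctx A [::] (lhom_stutter pT); rewrite !cats0 lT.
    by rewrite -cats1 -catA.
  apply: lhom_trans h2 _.
  have [s' [s'E ps' ls']] := pext T pT; rewrite s'E.
  have sz' : (size s').+1 = size s.
    have := congr1 size s'E; rewrite size_cat /= size_cat size_nseq size_rcons /=.
    by move: szE; clear; lia.
  have := lhom_ctx [::] [:: b] (IHn b s' ltac:(by move: sz' sn; clear; lia) ps' (etrans ls' lT)).
  rewrite /= -sz' (_ : nseq (size s') b ++ [:: b] = b :: nseq (size s') b) //.
  by elim: (size s') => //= k ->.
have [v vs mx] := max_norm b s0.
have [vb|vb] := eqVneq v b.
  have all_b u : u \in s -> u = b.
    move=> /mx; rewrite vb /lnorm; case: u b {IHm sm mx lb ps sE U vb} => u1 u2 [b1 b2] /= h.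
    by congr (_, _); move: h; clear; lia.
  case: s s0 all_b U sE lb {vs mx sm sn ps} => // x [|y s] _ all_b U sE lb.
    by rewrite (all_b x) ?inE //; exact: lhom_refl.
  by move: U; rewrite (all_b x) /= ?inE ?eqxx.
have mxb u : u \in b :: s -> (lnorm b u <= lnorm b v)%N.
  by rewrite inE => /orP[/eqP ->|/mx //]; rewrite /lnorm !subrr.
move: sm sn ps lb s0 sE U mxb {mx}.
case/splitPr: vs => s1 s2; case: s2 => [|c B] sm sn ps lb s0 sE U mxb.
  by move: lb; rewrite last_cat /= => E; rewrite E eqxx in vb.
pose a := last b s1.
have s1E : b :: s1 = rcons (belast b s1) a by exact: lastI.
have BE : c :: B = rcons (belast c B) b.
  by rewrite lastI; congr rcons; move: lb; rewrite last_cat.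
move: U; rewrite belast_cat /= cat_uniq /= => /and3P[U1 U2 /andP[U3 /andP[U4 U5]]].
have av : a != v by move: U3; rewrite inE negb_or => /andP[].
have vA : v \notin b :: s1.
  rewrite s1E mem_rcons inE negb_or eq_sym av /=.
  by move: U2; rewrite /= !negb_or => /and3P[].
have vB : v \notin c :: B by rewrite BE mem_rcons inE negb_or vb.
have lE : b :: s1 ++ [:: v, c & B] = belast b s1 ++ [:: a, v, c & B].
  by rewrite -cat_cons s1E cat_rcons.
have eav : e a v by move: ps; rewrite cat_path /= => /and3P[].
(* Without repetition, equal neighbours of [v] occur only in the loop [b], [v], [b]. *)
have [ac|ac] := eqVneq a c.
  have B0 : B = [::].
    by move: U3; rewrite -/a ac; case: (B) => // y B'; rewrite /= !inE eqxx orbT.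
  have cb : c = b by move: BE; rewrite B0 => -[].
  have s10 : s1 = [::].
    have aN : a \notin belast b s1 by move: U2; rewrite /= negb_or => /andP[].
    by move: aN; rewrite ac cb; case: (s1) => //= y s'; rewrite inE eqxx.
  rewrite s10 B0 cb /=; rewrite /a s10 /= in eav.
  by apply: (@lhom_step [::] b v b b [::]); [apply: (tri_edge eav)|apply: (tri_edge eav)|exact: lhom_refl];
    rewrite eqxx ?orbT.
have [i [j [w0 ca cv cc [d [cd ad dc nd]]]]] := winding_corner ps lb erefl vA vB ac mxb.
have [T1 T2] := cell_in ps lb w0.
rewrite lE; apply: (@lhom_step _ a v d c B); [exact: T1|exact: T1|].
have -> : belast b s1 ++ [:: a, d, c & B] = b :: s1 ++ [:: d, c & B].
  by rewrite -cat_cons s1E cat_rcons.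
have -> : size (s1 ++ [:: v, c & B]) = size (s1 ++ [:: d, c & B]) by rewrite !size_cat.
apply: IHm.
- by move: sm; rewrite !map_cat !sumn_cat /=; move: nd; clear; lia.
- by move: sn; rewrite !size_cat.
- by move: ps; rewrite !cat_path /= => /and4P[-> _ _ ->]; rewrite !T2.
- by move: lb; rewrite !last_cat.
Qed.

End LatticeLoops.

(** * Lattice cells in the plane and the absence of holes *)

Section Cells.
Variable R : realType.
Local Notation C := (R[i]).
Local Notation V := (int * int)%type.
Variables (U : set (Cplx R)) (b0 : C) (eta : R).
Hypothesis eta0 : 0 < eta.
(** The absence of holes in terms of sets: a compact [S] whose frontier lies in [U] is filled by
    [U]. *)
Hypothesis no_hole : forall S : set (Cplx R), closed S -> (exists r, bounded_by S r) ->
  (forall z, S z -> ~ U z -> exists2 e, 0 < e & forall w, cmod (w - z) < e -> S w) ->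
  S `<=` U.
Implicit Types (z w : C) (p q a c x y : V) (s : seq V).

Definition node p : C := b0 + Complex (eta * p.1%:~R) (eta * p.2%:~R).

Definition triU (a x y : C) := forall r1 r2 r3 : R, 0 <= r1 -> 0 <= r2 -> 0 <= r3 ->
  r1 + r2 + r3 = 1 -> U (r1%:C%C * a + r2%:C%C * x + r3%:C%C * y).

Definition segU (a x : C) := forall t : R, 0 <= t <= 1 -> U ((1 - t)%:C%C * a + t%:C%C * x).

Definition edgeU p q := `[< adjacent p q /\ segU (node p) (node q) >].

Definition cx z := (complex.Re z - complex.Re b0) / eta.
Definition cy z := (complex.Im z - complex.Im b0) / eta.

Lemma cxE z : eta * cx z = complex.Re z - complex.Re b0.
Proof. by rewrite /cx mulrC divfK // gt_eqF. Qed.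

Lemma cyE z : eta * cy z = complex.Im z - complex.Im b0.
Proof. by rewrite /cy mulrC divfK // gt_eqF. Qed.

Lemma coordE z : z = b0 + Complex (eta * cx z) (eta * cy z).
Proof. by rewrite cxE cyE; apply: complex_ext; rewrite ?cReD ?cImD /=; ring. Qed.

Definition cell (i j : int) z := i%:~R <= cx z <= (i + 1)%:~R /\ j%:~R <= cy z <= (j + 1)%:~R.

Lemma edgeU_adj p q : edgeU p q -> adjacent p q.
Proof. by move=> /asboolP[]. Qed.

Lemma segU_sym (a x : C) : segU a x -> segU x a.
Proof.
move=> H t /andP[t0 t1]; have := H (1 - t) ltac:(apply/andP; split; lra).
suff -> : (1 - (1 - t))%:C%C * a + (1 - t)%:C%C * x = (1 - t)%:C%C * x + t%:C%C * a by [].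
by rewrite subKr addrC.
Qed.

Lemma edgeU_sym p q : edgeU p q -> edgeU q p.
Proof.
move=> /asboolP[h1 h2]; apply/asboolP; split; last exact: segU_sym.
by move: h1; rewrite /adjacent; clear; lia.
Qed.

Lemma edgeU_node p q : edgeU p q -> U (node p).
Proof.
move=> /asboolP[_ H]; have := H 0 ltac:(by rewrite lexx ler01).
by rewrite subr0 rmorph0 rmorph1 mul1r mul0r addr0.
Qed.

Lemma edgeU_refl p q : edgeU p q -> edgeU p p.
Proof.
move=> /edgeU_node h; apply/asboolP; split; first by rewrite /adjacent !subrr.
by move=> t _; rewrite -mulrDl -rmorphD subrK rmorph1 mul1r.
Qed.

Lemma tri_edgeU p q a b c : edgeU p q -> (a == p) || (a == q) -> (b == p) || (b == q) ->
  (c == p) || (c == q) -> triU (node a) (node b) (node c).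
Proof.
move=> /asboolP[_ H] ha hb hc r1 r2 r3 h1 h2 h3 hs.
pose t := (if a == p then 0 else r1) + (if b == p then 0 else r2) + (if c == p then 0 else r3).
have t01 : 0 <= t <= 1 by rewrite /t; case: ifP => _; case: ifP => _; case: ifP => _; apply/andP; split; lra.
have := H t t01.
suff -> : (1 - t)%:C%C * node p + t%:C%C * node q =
   r1%:C%C * node a + r2%:C%C * node b + r3%:C%C * node c by [].
have pick u (k : R) : (u == p) || (u == q) -> k%:C%C * node u =
    (k - (if u == p then 0 else k))%:C%C * node p + (if u == p then 0 else k)%:C%C * node q.
  case: (eqVneq u p) => [-> _|_ /= /eqP ->]; first by rewrite subr0 rmorph0 mul0r addr0.
  by rewrite subrr rmorph0 mul0r add0r.
rewrite (pick a r1) // (pick b r2) // (pick c r3) // -hs /t !(rmorphD, rmorphB); ring.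
Qed.

Lemma near_int (x : R) : exists2 e : R, 0 < e & forall (x' : R) (i : int), `|x' - x| < e ->
  i%:~R <= x' <= (i + 1)%:~R -> i%:~R <= x <= (i + 1)%:~R.
Proof.
pose k := Num.floor x.
have k1 : k%:~R <= x by exact: floor_le.
have k2 : x < (k + 1)%:~R by exact: floorD1_gt.
have [xk|xk] := eqVneq x k%:~R.
  exists 1 => // x' i; rewrite ltr_norml => /andP[h1 h2] /andP[h3 h4].
  have i1 : i < k + 1.
    by rewrite -(ltr_int R) rmorphD /= rmorph1 -xk; lra.
  have i2 : k - 1 < i + 1.
    by rewrite -(ltr_int R) rmorphB /= rmorph1 -xk; lra.
  by rewrite xk !ler_int; apply/andP; split; move: i1 i2; clear; lia.
have k1' : k%:~R < x by rewrite lt_neqAle eq_sym xk.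
exists (Num.min (x - k%:~R) ((k + 1)%:~R - x)); first by rewrite lt_min !subr_gt0 k1'.
move=> x' i; rewrite lt_min !ltr_norml => /andP[/andP[h1 _] /andP[_ h2]] /andP[h3 h4].
have i1 : i < k + 1 by rewrite -(ltr_int R); lra.
have i2 : k < i + 1 by rewrite -(ltr_int R); lra.
have -> : i = k by move: i1 i2; clear; lia.
by rewrite k1 ltW.
Qed.

Lemma edge_vertical p q (i j : int) z : edgeU p q ->
  (p = (i, j) /\ q = (i, j + 1) \/ p = (i, j + 1) /\ q = (i, j)) ->
  cx z = i%:~R -> j%:~R <= cy z <= (j + 1)%:~R -> U z.
Proof.
move=> pq H xz yz.
have {pq H} /asboolP[_ H] : edgeU (i, j) (i, j + 1).
  by move: pq; case: H => [] [-> ->] // /edgeU_sym.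
have := H (cy z - j%:~R); rewrite rmorphD /= rmorph1 in yz *.
move=> /(_ ltac:(move: yz => /andP[? ?]; apply/andP; split; lra)).
suff -> : (1 - (cy z - j%:~R))%:C%C * node (i, j) + (cy z - j%:~R)%:C%C * node (i, j + 1) = z by [].
have E : (j + 1)%:~R = j%:~R + 1 :> R by rewrite rmorphD rmorph1.
rewrite [RHS]coordE xz /node /= E.
by apply: complex_ext; rewrite !(cReD, cImD, cReM, cImM) /=; ring.
Qed.

Lemma edge_horizontal p q (i j : int) z : edgeU p q ->
  (p = (i, j) /\ q = (i + 1, j) \/ p = (i + 1, j) /\ q = (i, j)) ->
  cy z = j%:~R -> i%:~R <= cx z <= (i + 1)%:~R -> U z.
Proof.
move=> pq H yz xz.
have {pq H} /asboolP[_ H] : edgeU (i, j) (i + 1, j).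
  by move: pq; case: H => [] [-> ->] // /edgeU_sym.
have := H (cx z - i%:~R); rewrite rmorphD /= rmorph1 in xz *.
move=> /(_ ltac:(move: xz => /andP[? ?]; apply/andP; split; lra)).
suff -> : (1 - (cx z - i%:~R))%:C%C * node (i, j) + (cx z - i%:~R)%:C%C * node (i + 1, j) = z by [].
have E : (i + 1)%:~R = i%:~R + 1 :> R by rewrite rmorphD rmorph1.
rewrite [RHS]coordE yz /node /= E.
by apply: complex_ext; rewrite !(cReD, cImD, cReM, cImM) /=; ring.
Qed.

Lemma int_touch (i i' : int) (x : R) : i%:~R <= x <= (i + 1)%:~R -> i'%:~R <= x <= (i' + 1)%:~R ->
  [\/ i' = i, i' = i + 1 /\ x = i'%:~R | i = i' + 1 /\ x = i%:~R].
Proof.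
move=> /andP[h1 h2] /andP[h3 h4].
have a1 : i' <= i + 1 by rewrite -(ler_int R); lra.
have a2 : i <= i' + 1 by rewrite -(ler_int R); lra.
have [h|[h|h]] : i' = i \/ i' = i + 1 \/ i = i' + 1 by move: a1 a2; clear; lia.
- by constructor 1.
- by constructor 2; split=> //; apply/le_anti; rewrite h3 h h2.
- by constructor 3; split=> //; apply/le_anti; rewrite h1 h h4.
Qed.

Section ClosedPath.
Variables (b : V) (s : seq V).
Hypothesis ps : path edgeU b s.
Hypothesis lb : last b s = b.

Definition winding_set : set (Cplx R) := [set z | exists i j, winding i j b s != 0 /\ cell i j z].

(** Winding numbers of neighbouring cells differ only across an edge of the loop, and such edges lie
    in [U]. *)
Lemma winding_same (i j i' j' : int) z : ~ U z -> cell i j z -> cell i' j' z ->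
  winding i j b s = winding i' j' b s.
Proof.
move=> nU [cx1 cy1] [cx2 cy2].
have H (k l : int) : cx z = k%:~R -> l%:~R <= cy z <= (l + 1)%:~R ->
    winding (k - 1) l b s = winding k l b s.
  move=> xk yl; apply/eqP; apply: contrapT => /negP w.
  have [p [q [pq hpq]]] := winding_horizontal edgeU_adj ps w.
  by apply: nU; exact: edge_vertical pq hpq xk yl.
have W (k l : int) : cy z = l%:~R -> k%:~R <= cx z <= (k + 1)%:~R ->
    winding k (l - 1) b s = winding k l b s.
  move=> yl xk; apply/eqP; apply: contrapT => /negP w.
  have [p [q [pq hpq]]] := winding_vertical edgeU_adj ps lb w.
  by apply: nU; exact: edge_horizontal pq hpq yl xk.
transitivity (winding i' j b s).
  case: (int_touch cx1 cx2) => [->//|[e1 e2]|[e1 e2]].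
    by rewrite -(H i' j e2 cy1) e1 addrK.
  by rewrite -(H i j e2 cy1) e1 addrK.
case: (int_touch cy1 cy2) => [->//|[e1 e2]|[e1 e2]].
  by rewrite -(W i' j' e2 cx2) e1 addrK.
by rewrite -(W i' j e2 cx2) e1 addrK.
Qed.

Lemma cx_close z w e : cmod (w - z) < eta * e -> `|cx w - cx z| < e /\ `|cy w - cy z| < e.
Proof.
move=> h; have r := cmod_re (w - z); have i := cmod_im (w - z).
have e1 : cx w - cx z = complex.Re (w - z) / eta by rewrite /cx cReB; field; rewrite gt_eqF.
have e2 : cy w - cy z = complex.Im (w - z) / eta by rewrite /cy cImB; field; rewrite gt_eqF.
by rewrite e1 e2 !normrM !normfV (gtr0_norm eta0) !ltr_pdivrMr // !(mulrC e); split; lra.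
Qed.

Lemma cell_near z : exists2 e, 0 < e & forall w i j, cmod (w - z) < e -> cell i j w -> cell i j z.
Proof.
have [e1 e10 h1] := near_int (cx z); have [e2 e20 h2] := near_int (cy z).
exists (eta * Num.min e1 e2); first by rewrite mulr_gt0 // lt_min e10.
move=> w i j /cx_close[]; rewrite !lt_min => /andP[d1 _] /andP[_ d2] [c1 c2].
by split; [exact: h1 c1|exact: h2 c2].
Qed.

(** The encircled cells form a closed set by local finiteness of the lattice, and a bounded one
    since the loop is finite. Around a point outside [U] all cells have the same winding number, so
    the point is interior and [no_hole] applies. *)
Lemma winding_set_sub : winding_set `<=` U.
Proof.
apply: no_hole.
- apply/closedC => z H; have [e e0 he] := cell_near z.
  have [w [i [j [w0 cw]]] hw] := H e e0.
  by exists i, j; split=> //; exact: he cw.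
- have [M hM] : exists M : nat, forall p, p \in b :: s -> (`|p.1| <= M)%N /\ (`|p.2| <= M)%N.
    elim: (b :: s) => [|p l [M hM]]; first by exists 0%N.
    exists (maxn M (maxn `|p.1| `|p.2|)) => q; rewrite inE => /orP[/eqP ->|/hM[h1 h2]].
      by split; rewrite !leq_max leqnn ?orbT.
    by split; rewrite leq_max ?h1 ?h2.
  exists (cmod b0 + 2 * (eta * (M.+2)%:R)) => z [i [j [w0 [cz1 cz2]]]].
  have [p [q [pm qm pq cr]]] := sumP_neq0 ps w0.
  have [i1 j1] : i <= (M : int) /\ (- (M.+1 : int) <= j <= (M : int)).
    have [p1 p2] := hM p pm; move: cr; rewrite /crossing.
    case: ifP => // /andP[_ ip]; case: ifP => [/andP[/eqP e1 _] _|_].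
      by move: p1 p2 ip e1; clear; lia.
    by case: ifP => [/andP[/eqP e1 _] _|//]; move: p1 p2 ip e1; clear; lia.
  (* The ray going right does not bound the column from below; the ray going left does. *)
  have i2 : - (M : int) <= i.
    move: w0; rewrite (winding_left _ _ edgeU_adj ps lb) oppr_eq0 => w0.
    have [p' [q' [pm' _ _]]] := sumP_neq0 ps w0; case: ifP => // hp _.
    by have [p1 _] := hM p' pm'; move: p1 hp; clear; lia.
  have bnd (k : int) (x : R) : - (M.+1 : int) <= k -> k <= (M : int) -> k%:~R <= x <= (k + 1)%:~R ->
      `|eta * x| <= eta * (M.+2)%:R.
    move=> k1 k2 /andP[x1 x2]; rewrite normrM (gtr0_norm eta0) ler_pM2l // ler_norml.
    have a1 : - (M.+1)%:R <= (k%:~R : R) by move: k1; rewrite -(ler_int R) rmorphN.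
    have a2 : ((k + 1)%:~R : R) <= (M.+1)%:R.
      by rewrite -[leRHS]/((M.+1)%:~R : R) ler_int; move: k2; clear; lia.
    have -> : (M.+2)%:R = (M.+1)%:R + 1 :> R by rewrite -natr1.
    by apply/andP; split; lra.
  rewrite [z]coordE; apply: le_trans (cmodD _ _) _; rewrite lerD2l.
  apply: le_trans (cmod_le _) _; rewrite /= mulr_natl mulr2n; apply: lerD.
    by apply: bnd cz1 => //; move: i2; clear; lia.
  by move: j1 => /andP[? ?]; exact: bnd cz2.
- move=> z [i [j [w0 cz]]] nU; have [e e0 he] := cell_near z; exists e => // w hw.
  pose i' := Num.floor (cx w); pose j' := Num.floor (cy w).
  have cw : cell i' j' w.
    by split; rewrite floor_le ltW // floorD1_gt.
  by exists i', j'; split=> //; rewrite -(winding_same nU cz (he w i' j' hw cw)).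
Qed.

Lemma cell_in_U i j : winding i j b s != 0 ->
  (forall a x y, corner i j a -> corner i j x -> corner i j y -> triU (node a) (node x) (node y)) /\
  (forall a x, corner i j a -> corner i j x -> adjacent a x -> edgeU a x).
Proof.
move=> w0.
have T a x y : corner i j a -> corner i j x -> corner i j y -> triU (node a) (node x) (node y).
  move=> ca cx' cy' r1 r2 r3 h1 h2 h3 hs; apply: winding_set_sub; exists i, j; split=> //.
  have rng p : corner i j p -> (i%:~R <= (p.1%:~R : R) <= (i + 1)%:~R) /\ (j%:~R <= (p.2%:~R : R) <= (j + 1)%:~R).
    by rewrite /corner !ler_int; clear; lia.
  have [/andP[a1 a2] /andP[a3 a4]] := rng _ ca; have [/andP[x1 x2] /andP[x3 x4]] := rng _ cx'.
  have [/andP[y1 y2] /andP[y3 y4]] := rng _ cy'.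
  set z := _ + _ + _.
  have zx : cx z = r1 * a.1%:~R + r2 * x.1%:~R + r3 * y.1%:~R.
    apply: (mulfI (lt0r_neq0 eta0)); rewrite cxE /z /node.
    have -> : r1 = 1 - r2 - r3 by lra.
    by rewrite !(cReD, cImD, cReM, cImM) /=; ring.
  have zy : cy z = r1 * a.2%:~R + r2 * x.2%:~R + r3 * y.2%:~R.
    apply: (mulfI (lt0r_neq0 eta0)); rewrite cyE /z /node.
    have -> : r1 = 1 - r2 - r3 by lra.
    by rewrite !(cReD, cImD, cReM, cImM) /=; ring.
  have cvx (lo hi u v w : R) : lo <= u -> u <= hi -> lo <= v -> v <= hi -> lo <= w -> w <= hi ->
      lo <= r1 * u + r2 * v + r3 * w <= hi.
    move=> *; have E k : k = r1 * k + r2 * k + r3 * k by rewrite -!mulrDl hs mul1r.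
    by apply/andP; split; [rewrite [leLHS]E|rewrite [leRHS]E]; rewrite !lerD // ler_wpM2l.
  by rewrite /cell zx zy; split; apply: cvx.
split=> // a x ca cx' ax; apply/asboolP; split=> // t /andP[t0 t1].
have -> : (1 - t)%:C%C * node a + t%:C%C * node x =
    (1 - t)%:C%C * node a + t%:C%C * node x + (0 : R)%:C%C * node x by rewrite rmorph0 mul0r addr0.
by apply: (T a x x) => //; lra.
Qed.

End ClosedPath.
End Cells.

(** * Homotopies of paths and polygonal lines *)

Section Homotopy.
Variables (R : realType) (U : set (Cplx R)).
Local Notation C := (R[i]).
Implicit Types (z w a x y : C) (g : R -> C) (s t u : R).

Lemma ccont_lip (f : C -> C) (K : R) z : (forall w, cmod (f w - f z) <= K * cmod (w - z)) -> ccont f z.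
Proof.
move=> H e e0; exists (e / (`|K| + 1)); first by rewrite divr_gt0 // ltr_wpDl.
move=> w; rewrite ltr_pdivlMr ?ltr_wpDl // => h; apply: le_lt_trans (H w) _.
apply: le_lt_trans _ h; rewrite mulrC ler_wpM2l ?cmod_ge0 //.
by apply: le_trans (ler_norm _) _; rewrite lerDl.
Qed.

Definition clip (lo hi u : R) : R := Num.max lo (Num.min u hi).

Lemma clipP lo hi u : lo <= hi ->
  [\/ u <= lo /\ clip lo hi u = lo, lo <= u <= hi /\ clip lo hi u = u | hi <= u /\ clip lo hi u = hi].
Proof.
rewrite /clip => lh; have [h1|h1] := leP u hi; have [h2|h2] := leP lo u.
- by constructor 2.
- by constructor 1; rewrite (ltW h2).
- by constructor 3; rewrite (ltW h1) max_r.
- by constructor 3; rewrite (ltW h1) max_r.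
Qed.

Lemma clip_lip lo hi u u' : lo <= hi -> `|clip lo hi u - clip lo hi u'| <= `|u - u'|.
Proof.
by move=> lh; case: (clipP u lh) => -[h1 ->]; case: (clipP u' lh) => -[h2 ->];
  rewrite ?subrr ?normr_ge0 //; rewrite ler_norml; have := ler_norm (u - u'); have := ler_norm (u' - u);
  rewrite (distrC u'); lra.
Qed.

(** Paths are read as functions on the plane depending on the imaginary part, and homotopies as
    functions of [Complex s t], so that the continuity rules for [ccont] serve for both. *)
Definition pathc g := forall z, ccont (fun z => g (complex.Im z)) z.

Definition gnull g := exists h : C -> C, [/\ forall z, ccont h z,
  forall s t, 0 <= s <= 1 -> 0 <= t <= 1 -> U (h (Complex s t)),
  forall t, 0 <= t <= 1 -> h (Complex 0 t) = g t,
  forall t, 0 <= t <= 1 -> h (Complex 1 t) = g 0 &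
  forall s, 0 <= s <= 1 -> h (Complex s 0) = g 0 /\ h (Complex s 1) = g 0].

Lemma gnull_cst g : U (g 0) -> (forall t, 0 <= t <= 1 -> g t = g 0) -> gnull g.
Proof.
move=> U0 gE; exists (fun=> g 0); split=> //; first by move=> z; exact: ccont_cst.
by move=> t /gE ->.
Qed.

(** For [s <= 1/2] the path [g] moves to [g'] along segments, afterwards the homotopy of [g'] runs.
    The clipped parameters [m] and [k] put both halves into one formula, with no gluing of
    continuous maps. *)
Lemma gnull_step g g' : pathc g -> pathc g' -> g 0 = g' 0 -> g 1 = g 0 -> g' 1 = g 0 ->
  (forall t, 0 <= t <= 1 -> segU U (g' t) (g t)) -> gnull g' -> gnull g.
Proof.
move=> gc gc' e0 e1 e1' sg [h [hc hU h0 h1 hs]].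
pose m z := Complex (clip 0 1 (2 * complex.Re z - 1)) (complex.Im z).
pose k z := (clip 0 1 (1 - 2 * complex.Re z))%:C%C.
have mk s t : 0 <= s <= 1 ->
    [\/ m (Complex s t) = Complex (2 * s - 1) t /\ k (Complex s t) = 0 /\ 1 <= 2 * s |
        m (Complex s t) = Complex 0 t /\ k (Complex s t) = (1 - 2 * s)%:C%C /\ 2 * s <= 1].
  move=> /andP[s0 s1]; have [h4|h4] := leP 1 (2 * s); [constructor 1|constructor 2]; rewrite /m /k /=.
    have -> : clip 0 1 (2 * s - 1) = 2 * s - 1 by case: (clipP (2 * s - 1) ler01) => -[h2 ->]; lra.
    by have -> : clip 0 1 (1 - 2 * s) = 0 by case: (clipP (1 - 2 * s) ler01) => -[h2 ->]; lra.
  have -> : clip 0 1 (2 * s - 1) = 0 by case: (clipP (2 * s - 1) ler01) => -[h2 ->]; lra.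
  have -> : clip 0 1 (1 - 2 * s) = 1 - 2 * s by case: (clipP (1 - 2 * s) ler01) => -[h2 ->]; lra.
  by rewrite (ltW h4).
exists (fun z => h (m z) + k z * (g (complex.Im z) - g' (complex.Im z))); split.
- move=> z; apply: ccontD.
    apply: ccont_comp; last exact: hc.
    apply: (@ccont_lip _ 3) => w; rewrite /m; apply: le_trans (cmod_le _) _ => /=.
    have r1 := cmod_re (w - z); have r2 := cmod_im (w - z).
    have r3 := clip_lip (2 * complex.Re w - 1) (2 * complex.Re z - 1) ler01.
    rewrite cReB in r1; rewrite cImB in r2.
    have r4 : `|2 * complex.Re w - 1 - (2 * complex.Re z - 1)| = 2 * `|complex.Re w - complex.Re z|.
      by rewrite -[in RHS](@ger0_norm _ 2) // -normrM; congr `|_|; ring.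
    by rewrite r4 in r3; lra.
  apply: ccontM; last by apply: ccontB; [exact: gc|exact: gc'].
  apply: (@ccont_lip _ 2) => w; rewrite /k -rmorphB cmod_real.
  have r1 := cmod_re (w - z); rewrite cReB in r1.
  apply: le_trans (clip_lip _ _ ler01) _.
  have -> : 1 - 2 * complex.Re w - (1 - 2 * complex.Re z) = - (2 * (complex.Re w - complex.Re z)) by ring.
  by rewrite normrN normrM (@ger0_norm _ 2) // ler_pM2l.
- move=> s t s01 t01 /=; case: (mk s t s01) => -[-> [-> h2]]; move: s01 => /andP[s0 s1].
    by rewrite mul0r addr0; apply: hU => //; apply/andP; split; lra.
  rewrite h0 //; have := sg t t01 (1 - 2 * s) ltac:(apply/andP; split; lra).
  have -> : (1 - (1 - 2 * s))%:C%C * g' t + (1 - 2 * s)%:C%C * g t =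
     g' t + (1 - 2 * s)%:C%C * (g t - g' t) by rewrite rmorphB rmorph1; ring.
  by [].
- move=> t t01; case: (mk 0 t) => [|[-> [-> h2]]|[-> [-> h2]]] /=; first by rewrite lexx ler01.
    by exfalso; clear -h2; lra.
  by rewrite h0 // mulr0 subr0 rmorph1; ring.
- move=> t t01; case: (mk 1 t) => [|[-> [-> h2]]|[-> [-> h2]]] /=; first by rewrite lexx ler01.
    have -> : 2 * 1 - 1 = 1 :> R by ring.
    by rewrite h1 // mul0r addr0 e0.
  by exfalso; clear -h2; lra.
- move=> s s01.
  have i0 : 0 <= (0 : R) <= 1 by rewrite lexx ler01.
  have i1 : 0 <= (1 : R) <= 1 by rewrite lexx ler01.
  have s01' := s01; move: s01' => /andP[s0 s1]; split.
    case: (mk s 0 s01) => -[-> [-> h2]] /=; rewrite ?h0 // e0 subrr mulr0 addr0 //.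
    by have [-> _] := hs (2 * s - 1) ltac:(apply/andP; split; lra).
  case: (mk s 1 s01) => -[-> [-> h2]] /=; rewrite ?h0 // e1 e1' subrr mulr0 addr0 //.
  by have [_ ->] := hs (2 * s - 1) ltac:(apply/andP; split; lra).
Qed.

(** One vertex per unit of time, constant before and after. A sum of clipped increments instead of a
    case distinction makes continuity an easy induction. *)
Fixpoint polyline a (l : seq C) u : C :=
  if l is x :: l' then polyline x l' (u - 1) + (1 - clip 0 1 u)%:C%C * (a - x) else a.

Lemma polyline_le0 a l u : u <= 0 -> polyline a l u = a.
Proof.
elim: l a u => //= x l IH a u u0; rewrite IH; last by lra.
case: (clipP u ler01) => -[h ->]; last by exfalso; lra.
  by rewrite subr0 rmorph1; ring.
have -> : u = 0 by lra.
by rewrite subr0 rmorph1; ring.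
Qed.

Lemma polyline_cons1 a x l u : 0 <= u <= 1 ->
  polyline a (x :: l) u = (1 - u)%:C%C * a + u%:C%C * x.
Proof.
move=> /andP[u0 u1] /=; rewrite polyline_le0; last by lra.
case: (clipP u ler01) => -[h ->]; rewrite ?rmorphB ?rmorph1 ?rmorph0; last 2 first.
- by ring.
- have -> : u = 1 by lra.
  by rewrite rmorph1; ring.
have -> : u = 0 by lra.
by rewrite rmorph0; ring.
Qed.

Lemma polyline_cons_ge1 a x l u : 1 <= u -> polyline a (x :: l) u = polyline x l (u - 1).
Proof.
move=> u1 /=; case: (clipP u ler01) => -[h ->]; first by exfalso; lra.
  have -> : u = 1 by lra.
  by rewrite subrr rmorph0 mul0r addr0.
by rewrite subrr rmorph0 mul0r addr0.
Qed.

Lemma polyline_last a l : polyline a l (size l)%:R = last a l.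
Proof.
elim: l a => //= x l IH a; rewrite -[polyline _ _ _ + _]/(polyline a (x :: l) (size l).+1%:R).
by rewrite polyline_cons_ge1 ?ler1n // -natr1 addrK IH.
Qed.

Lemma polyline_cont a l (c : R) : pathc (fun t => polyline a l (c * t)).
Proof.
suff H (d : R) z : ccont (fun z => polyline a l (c * complex.Im z - d)) z.
  move=> z; have -> : (fun z => polyline a l (c * complex.Im z)) = (fun z => polyline a l (c * complex.Im z - 0)).
    by apply/funext => w; rewrite subr0.
  exact: H.
elim: l a d => [|x l IH] a d /=; first exact: ccont_cst.
apply: ccontD.
  have -> : (fun z => polyline x l (c * complex.Im z - d - 1)) = (fun z => polyline x l (c * complex.Im z - (d + 1))).
    by apply/funext => w; rewrite opprD addrA.
  exact: IH.
apply: ccontM; last exact: ccont_cst.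
apply: (@ccont_lip _ `|c|) => w; rewrite -rmorphB cmod_real.
have -> : 1 - clip 0 1 (c * complex.Im w - d) - (1 - clip 0 1 (c * complex.Im z - d)) =
  - (clip 0 1 (c * complex.Im w - d) - clip 0 1 (c * complex.Im z - d)) by ring.
rewrite normrN; apply: le_trans (clip_lip _ _ ler01) _.
have -> : c * complex.Im w - d - (c * complex.Im z - d) = c * (complex.Im w - complex.Im z) by ring.
by rewrite normrM ler_wpM2l // -cImB cmod_im.
Qed.

Lemma polyline_in a l u : U a -> (forall A x y B, a :: l = A ++ [:: x, y & B] -> segU U x y) ->
  U (polyline a l u).
Proof.
elim: l a u => [//|x l IH] a u Ua H.
have sax : segU U a x := H [::] a x l erefl.
have Ux : U x by have := sax 1 ltac:(by rewrite lexx ler01); rewrite subrr rmorph0 rmorph1 mul0r mul1r add0r.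
have [u0|u0] := leP u 0; first by rewrite polyline_le0.
have [u1|u1] := leP u 1.
  by rewrite polyline_cons1; [apply: sax; rewrite (ltW u0)|rewrite (ltW u0)].
rewrite polyline_cons_ge1 ?(ltW u1) //; apply: IH => // A y y' B E.
by apply: (H (a :: A) y y' B); rewrite /= E.
Qed.

Definition lpoly (l : seq C) u := if l is a :: l' then polyline a l' u else 0.

Lemma segU_refl x : U x -> segU U x x.
Proof. by move=> Ux t _; rewrite -mulrDl -rmorphD subrK rmorph1 mul1r. Qed.

Definition chainU (l : seq C) := forall A x y B, l = A ++ [:: x, y & B] -> segU U x y.

Lemma triU_segU a x y : triU U a x y -> segU U a y /\ segU U x y.
Proof.
move=> H; split=> t /andP[t0 t1].
  have := H (1 - t) 0 t ltac:(lra) (lexx _) t0 ltac:(ring).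
  by rewrite rmorph0 mul0r [_ + 0]addr0.
have := H 0 (1 - t) t (lexx _) ltac:(lra) t0 ltac:(ring).
by rewrite rmorph0 mul0r [0 + _]add0r.
Qed.

(** On the two moved edges the segment lies in one of the two triangles; elsewhere both lines
    coincide. *)
Lemma lpoly_move A a x y c B u : triU U a x y -> triU U x y c ->
  chainU (A ++ [:: a, x, c & B]) ->
  segU U (lpoly (A ++ [:: a, y, c & B]) u) (lpoly (A ++ [:: a, x, c & B]) u).
Proof.
move=> t1 t2; elim: A u => [|a0 A IH] u V; last first.
  change (segU U (polyline a0 (A ++ [:: a, y, c & B]) u) (polyline a0 (A ++ [:: a, x, c & B]) u)).
  have V' : chainU (A ++ [:: a, x, c & B]).
    by move=> A' x' y' B' E; apply: (V (a0 :: A') x' y' B'); rewrite /= E.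
  have [z [r [r' [E E']]]] : exists z r r', A ++ [:: a, x, c & B] = z :: r /\ A ++ [:: a, y, c & B] = z :: r'.
    by case: (A) => [|z A']; [exists a, (x :: c :: B), (y :: c :: B)|
      exists z, (A' ++ [:: a, x, c & B]), (A' ++ [:: a, y, c & B])].
  have sz : segU U a0 z by apply: (V [::] a0 z r); rewrite /= E.
  rewrite E E'; have [u1|u1] := leP 1 u.
    by rewrite !polyline_cons_ge1 //; have := IH (u - 1) V'; rewrite E E'.
  have [u0|u0] := leP u 0.
    rewrite !polyline_le0 //; apply: segU_refl.
    by have := sz 0 ltac:(by rewrite lexx ler01); rewrite subr0 rmorph0 rmorph1 mul0r mul1r addr0.
  have u01 : 0 <= u <= 1 by rewrite !ltW.
  by rewrite !polyline_cons1 //; apply: segU_refl; exact: sz.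
change (segU U (polyline a (y :: c :: B) u) (polyline a (x :: c :: B) u)).
have Ua : U a.
  have := t1 1 0 0 ler01 (lexx _) (lexx _) ltac:(by rewrite !addr0).
  by rewrite rmorph0 rmorph1 !mul0r mul1r !addr0.
have Uc : U c.
  have := t2 0 0 1 (lexx _) (lexx _) ler01 ltac:(by rewrite !add0r).
  by rewrite rmorph0 rmorph1 !mul0r mul1r !add0r.
have [u0|u0] := leP u 0; first by rewrite !polyline_le0 //; exact: segU_refl.
have [u1|u1] := leP u 1.
  have u01 : 0 <= u <= 1 by rewrite (ltW u0).
  rewrite !polyline_cons1 // => t /andP[h0 h1].
  have := t1 (1 - u) (u * t) (u * (1 - t)) ltac:(lra) ltac:(by rewrite mulr_ge0 // ltW)
     ltac:(by rewrite mulr_ge0 ?(ltW u0) //; lra) ltac:(ring).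
  suff -> : (1 - u)%:C%C * a + (u * t)%:C%C * x + (u * (1 - t))%:C%C * y =
    (1 - t)%:C%C * ((1 - u)%:C%C * a + u%:C%C * y) + t%:C%C * ((1 - u)%:C%C * a + u%:C%C * x) by [].
  by rewrite !(rmorphB, rmorphM, rmorph1); ring.
rewrite !(@polyline_cons_ge1 a) ?(ltW u1) //.
have [u2|u2] := leP (u - 1) 1.
  have u01 : 0 <= u - 1 <= 1 by rewrite u2 subr_ge0 ltW.
  rewrite !polyline_cons1 //; set v := u - 1 in u01 *; move: u01 => /andP[v0 v1] t /andP[h0 h1].
  have := t2 ((1 - v) * t) ((1 - v) * (1 - t)) v ltac:(by rewrite mulr_ge0 //; lra)
     ltac:(by rewrite mulr_ge0 //; lra) ltac:(lra) ltac:(ring).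
  suff -> : ((1 - v) * t)%:C%C * x + ((1 - v) * (1 - t))%:C%C * y + v%:C%C * c =
    (1 - t)%:C%C * ((1 - v)%:C%C * y + v%:C%C * c) + t%:C%C * ((1 - v)%:C%C * x + v%:C%C * c) by [].
  by rewrite !(rmorphB, rmorphM, rmorph1); ring.
rewrite !polyline_cons_ge1 ?(ltW u2) //; apply: segU_refl; apply: polyline_in => // A x' y' B' E.
by apply: (V ([:: a, x & A]) x' y' B'); rewrite /= E.
Qed.

Lemma chain_move A a x y c B : triU U a x y -> triU U x y c ->
  chainU (A ++ [:: a, x, c & B]) -> chainU (A ++ [:: a, y, c & B]).
Proof.
move=> t1 t2; elim: A => [|a0 A IH] V A' x' y' B' /=.
  case: A' => [|a' A'] /=; first case=> <- <- _.
    by have [] := triU_segU t1.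
  case=> _; case: A' => [|a'' A'] /=; first case=> <- <- _.
    by have [] := triU_segU t2.
  by case=> _ E; apply: (V [:: a, x & A'] x' y' B'); rewrite /= E.
case: A' => [|a' A'] /=; last first.
  case=> _ E; apply: (IH _ A' x' y' B' E).
  by move=> A1 x1 y1 B1 E1; apply: (V (a0 :: A1) x1 y1 B1); rewrite /= E1.
case=> <-; case: A V {IH} => [|z A] V /=; case=> <- _.
  exact: (V [::] a0 a (x :: c :: B) erefl).
exact: (V [::] a0 z _ erefl).
Qed.

(** A Lebesgue number argument: points failing at the scales [n.+1%:R^-1] accumulate at some point,
    whose own scale contradicts them. *)
Lemma uniform_scale (Q : R -> R -> Prop) :
  (forall t e e', Q t e -> 0 < e' <= e -> Q t e') ->
  (forall t, 0 <= t <= 1 -> exists2 d, 0 < d & forall t', 0 <= t' <= 1 -> `|t' - t| < d -> Q t' d) ->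
  exists2 e, 0 < e & forall t, 0 <= t <= 1 -> Q t e.
Proof.
move=> Qm H; apply: contrapT => N.
have /choice [u hu] n : exists t, 0 <= t <= 1 /\ ~ Q t (n.+1%:R^-1).
  apply: contrapT => N'; apply: N; exists (n.+1%:R^-1); first by rewrite invr_gt0.
  by move=> t t01; apply: contrapT => nQ; apply: N'; exists t.
have u1 n : `|u n| <= 1 by have [/andP[a1 a2] _] := hu n; rewrite ger0_norm.
have [f fi [l hl]] := bw_real u1.
have l01 : 0 <= l <= 1.
  apply/andP; split; apply/ler_addgt0Pr => e e0; have [n hn] := hl e e0;
    by have := hn n (leqnn n); have [/andP[a1 a2] _] := hu (f n); rewrite ltr_norml => /andP[b1 b2]; lra.
have [d d0 hd] := H l l01; have [n1 hn1] := hl d d0.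
pose n2 := Num.truncn (d^-1); pose n := maxn n1 n2.
have fn : (n <= f n)%N.
  by elim: (n) => // k IH; apply: leq_ltn_trans IH _; exact: fi.
have [t01 nQ] := hu (f n); apply: nQ.
apply: Qm (hd _ t01 (hn1 n (leq_maxl _ _))) _.
rewrite invr_gt0 ltr0Sn /= invf_ple ?posrE //.
apply: le_trans (ltW (truncnS_gt _)) _; rewrite ler_nat ltnS.
by apply: leq_trans fn; exact: leq_maxr.
Qed.

End Homotopy.

(** * From lattice moves to homotopies *)

Section LatticeHomotopy.
Variables (R : realType) (U : set (Cplx R)) (b0 : R[i]) (eta : R).
Local Notation C := (R[i]).
Local Notation V := (int * int)%type.
Local Notation nd := (node b0 eta).
Implicit Types (p q a c x y b : V) (l s : seq V) (u : R).

Definition vtri a x y := triU U (nd a) (nd x) (nd y).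

Lemma gnull_lhom l l' n : lhom vtri l l' -> size l = n.+1 -> last 0 l = head 0 l ->
  chainU U (map nd l) -> gnull U (fun t => lpoly (map nd l') (n%:R * t)) ->
  gnull U (fun t => lpoly (map nd l) (n%:R * t)).
Proof.
elim=> {l l'} // A a x y c B l t1 t2 _ IH sz hl V G.
have lp0 (k : seq C) : lpoly k (n%:R * 0) = head 0 k by rewrite mulr0; case: k => //= z k; exact: polyline_le0.
have lp1 (k : seq C) : size k = n.+1 -> lpoly k (n%:R * 1) = last 0 k.
  by rewrite mulr1; case: k => //= z k [<-]; exact: polyline_last.
have pc (k : seq C) : pathc (fun t => lpoly k (n%:R * t)).
  by case: k => [|z k]; [move=> z; exact: ccont_cst|exact: polyline_cont].
have hd : head 0 (map nd (A ++ [:: a, y, c & B])) = head 0 (map nd (A ++ [:: a, x, c & B])) by case: (A).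
have ls : last 0 (map nd (A ++ [:: a, y, c & B])) = last 0 (map nd (A ++ [:: a, x, c & B])).
  by rewrite !map_cat !last_cat.
have ls2 : last 0 (map nd (A ++ [:: a, x, c & B])) = head 0 (map nd (A ++ [:: a, x, c & B])).
  rewrite map_cat last_cat /= last_map; move: hl; rewrite last_cat /= => ->.
  by case: (A).
have sz' : size (A ++ [:: a, y, c & B]) = n.+1 by rewrite -sz !size_cat.
apply: (@gnull_step R U _ (fun t => lpoly (map nd (A ++ [:: a, y, c & B])) (n%:R * t))) => //.
- by rewrite !lp0 hd.
- by rewrite lp0 lp1 // size_map.
- by rewrite lp0 lp1 ?size_map // ls.
- move=> t _; rewrite !map_cat; apply: lpoly_move => //.
  by move: V; rewrite map_cat.
- apply: IH => //.
    by move: hl; rewrite !last_cat /= => ->; case: (A).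
  by move: V; rewrite !map_cat; exact: chain_move.
Qed.

End LatticeHomotopy.

Lemma grid_index_shift k n j : (k.+1 <= j <= k.+1 + n)%N -> [/\ (k <= j <= k + n.+1)%N,
  (2 * (j - k) = 2 * (j - k.+1) + 2)%N & (2 * (j - k).+1 = 2 * (j - k.+1).+1 + 2)%N].
Proof. by move=> h; split; lia. Qed.

(** * Approximation of a loop by a lattice loop *)

Section Discretize.
Variables (R : realType) (U : set (Cplx R)) (c : R -> R[i]) (delta : R) (N : nat).
Local Notation C := (R[i]).
Local Notation V := (int * int)%type.
(** All nodes and curve points attached to one tick lie within [3 * eta] of the curve there, hence
    in a disc inside [U]. *)
Let eta := delta / 8.
Local Notation nd := (node (c 0) eta).
Hypothesis delta0 : 0 < delta.
Hypothesis N0 : (0 < N)%N.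
Let tick k : R := k%:R / N%:R.
Hypothesis ballU : forall t w, 0 <= t <= 1 -> cmod (w - c t) < delta -> U w.
Hypothesis close : forall t t', 0 <= t <= 1 -> 0 <= t' <= 1 -> `|t - t'| <= N%:R^-1 -> cmod (c t - c t') < eta.
Implicit Types (p q : V) (k n : nat) (t u : R) (z w x y : C).

Let eta0 : 0 < eta. Proof. by rewrite divr_gt0. Qed.
Let Ngt0 : 0 < N%:R :> R. Proof. by rewrite ltr0n. Qed.

Let tick01 k : (k <= N)%N -> 0 <= tick k <= 1.
Proof. by move=> kN; rewrite divr_ge0 ?ler0n //= ler_pdivrMr // mul1r ler_nat. Qed.

Let tick0 : tick 0 = 0. Proof. by rewrite /tick mul0r. Qed.

Let tickS k : tick k.+1 = tick k + N%:R^-1.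
Proof. by rewrite /tick -natr1 mulrDl mul1r. Qed.

Let q k : V := (Num.floor (cx (c 0) eta (c (tick k))), Num.floor (cy (c 0) eta (c (tick k)))).

(** Consecutive rounded points may differ by one in both coordinates; this intermediate node splits
    the diagonal step into two lattice steps. *)
Let m k : V := ((q k.+1).1, (q k).2).

Lemma ball_convex z x y (r t : R) : cmod (x - z) <= r -> cmod (y - z) <= r -> 0 <= t <= 1 ->
  cmod ((1 - t)%:C%C * x + t%:C%C * y - z) <= r.
Proof.
move=> hx hy /andP[t0 t1].
have -> : (1 - t)%:C%C * x + t%:C%C * y - z = (1 - t)%:C%C * (x - z) + t%:C%C * (y - z).
  by rewrite rmorphB rmorph1; ring.
apply: le_trans (cmodD _ _) _; rewrite cmodM [cmod (t%:C%C * _)]cmodM !cmod_real.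
rewrite (@ger0_norm _ (1 - t)) ?(ger0_norm t0) ?subr_ge0 //.
have -> : r = (1 - t) * r + t * r by ring.
by apply: lerD; rewrite ler_wpM2l // subr_ge0.
Qed.

Let closeS k : (k < N)%N -> cmod (c (tick k.+1) - c (tick k)) < eta.
Proof.
move=> kN; apply: close; [exact: tick01|by apply: tick01; exact: ltnW|].
by rewrite tickS addrAC subrr add0r ger0_norm // invr_ge0 ltW.
Qed.

Let node_near (i j : int) z (A B : R) : `|i%:~R - cx (c 0) eta z| <= A -> `|j%:~R - cy (c 0) eta z| <= B ->
  cmod (nd (i, j) - z) <= eta * (A + B).
Proof.
move=> h1 h2; rewrite {1}(coordE (c 0) eta0 z) /node /=.
apply: le_trans (cmod_le _) _; rewrite !(cReB, cImB, cReD, cImD) /= mulrDr.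
have -> : complex.Re (c 0) + eta * i%:~R - (complex.Re (c 0) + eta * cx (c 0) eta z) =
  eta * (i%:~R - cx (c 0) eta z) by ring.
have -> : complex.Im (c 0) + eta * j%:~R - (complex.Im (c 0) + eta * cy (c 0) eta z) =
  eta * (j%:~R - cy (c 0) eta z) by ring.
by rewrite !(normrM eta) (gtr0_norm eta0); apply: lerD; rewrite ler_pM2l.
Qed.

Let floor_near (x : R) : `|(Num.floor x)%:~R - x| <= 1.
Proof.
have h1 : (Num.floor x)%:~R <= x by exact: floor_le.
have h2 : x < (Num.floor x + 1)%:~R by exact: floorD1_gt.
by rewrite rmorphD rmorph1 in h2; rewrite ler_norml; apply/andP; split; lra.
Qed.

Let near0 k : cmod (nd (q k) - c (tick k)) <= 3 * eta.
Proof.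
apply: le_trans (_ : eta * (1 + 1) <= _); last by have := eta0; lra.
by apply: node_near; exact: floor_near.
Qed.

Let near1 k : (k < N)%N -> cmod (nd (q k.+1) - c (tick k)) <= 3 * eta.
Proof.
move=> kN; apply: le_trans (cmod_tri _ _ (c (tick k.+1))) _.
have := closeS kN; suff : cmod (nd (q k.+1) - c (tick k.+1)) <= eta * (1 + 1) by lra.
by apply: node_near; exact: floor_near.
Qed.

Let close_coord k : (k < N)%N ->
  `|cx (c 0) eta (c (tick k.+1)) - cx (c 0) eta (c (tick k))| < 1 /\
  `|cy (c 0) eta (c (tick k.+1)) - cy (c 0) eta (c (tick k))| < 1.
Proof. by move=> kN; apply: (cx_close _ eta0); rewrite mulr1; exact: closeS. Qed.

Let nearm k : (k < N)%N -> cmod (nd (m k) - c (tick k)) <= 3 * eta.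
Proof.
move=> kN; apply: le_trans (_ : eta * (2 + 1) <= _); last by have := eta0; lra.
apply: node_near; last exact: floor_near.
have [h _] := close_coord kN; have := floor_near (cx (c 0) eta (c (tick k.+1))).
set u := _%:~R; set v := cx _ _ _ in h *; set v' := cx _ _ _ in h * => h'.
have -> : u - v' = (u - v) + (v - v') by ring.
by apply: le_trans (ler_normD _ _) _; lra.
Qed.

Let floor_adj (x y : R) : `|x - y| < 1 -> (`|Num.floor x - Num.floor y| <= 1)%N.
Proof.
have h1 : (Num.floor x)%:~R <= x by exact: floor_le.
have h2 : x < (Num.floor x + 1)%:~R by exact: floorD1_gt.
have h3 : (Num.floor y)%:~R <= y by exact: floor_le.
have h4 : y < (Num.floor y + 1)%:~R by exact: floorD1_gt.
rewrite ltr_norml => /andP[h5 h6].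
have a1 : Num.floor x < Num.floor y + 1 + 1 by rewrite -(ltr_int R) [in ltRHS]rmorphD rmorph1; lra.
have a2 : Num.floor y < Num.floor x + 1 + 1 by rewrite -(ltr_int R) [in ltRHS]rmorphD rmorph1; lra.
by move: a1 a2; clear; lia.
Qed.

Let edge_near k p p' : (k <= N)%N -> adjacent p p' -> cmod (nd p - c (tick k)) <= 3 * eta ->
  cmod (nd p' - c (tick k)) <= 3 * eta -> edgeU U (c 0) eta p p'.
Proof.
move=> kN pp h h'; apply/asboolP; split=> // t t01.
apply: (ballU (tick01 kN)); apply: le_lt_trans (ball_convex h h' t01) _.
by rewrite /eta; have := delta0; lra.
Qed.

Let edge1 k : (k < N)%N -> edgeU U (c 0) eta (q k) (m k).
Proof.
move=> kN; apply: (@edge_near k); [exact: ltnW| |exact: near0|exact: nearm].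
have [h _] := close_coord kN; have := floor_adj h; rewrite /adjacent /m /q /=.
by clear; lia.
Qed.

Let edge2 k : (k < N)%N -> edgeU U (c 0) eta (m k) (q k.+1).
Proof.
move=> kN; apply: (@edge_near k); [exact: ltnW| |exact: nearm|exact: near1].
have [_ h] := close_coord kN; have := floor_adj h; rewrite /adjacent /m /q /=.
by clear; lia.
Qed.

Fixpoint grid_path k n : seq V :=
  if n is n'.+1 then m k :: q k.+1 :: grid_path k.+1 n' else [::].

Let grid_size k n : size (grid_path k n) = (2 * n)%N.
Proof. by elim: n k => //= n IH k; rewrite IH; lia. Qed.

Let grid_last k n : last (q k) (grid_path k n) = q (k + n).
Proof. by elim: n k => [|n IH] k /=; rewrite ?addn0 // IH addSnnS. Qed.

Let grid_edges k n : (k + n <= N)%N -> path (edgeU U (c 0) eta) (q k) (grid_path k n).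
Proof.
elim: n k => //= n IH k kn; have kN : (k < N)%N by lia.
by rewrite edge1 // edge2 // IH //; lia.
Qed.

Let grid_near k n u : (k + n.+1 <= N)%N -> 0 <= u <= 2 * n.+1%:R ->
  exists j, [/\ (k <= j <= k + n)%N, (2 * (j - k))%N%:R <= u <= (2 * (j - k).+1)%N%:R &
    cmod (polyline (nd (q k)) (map nd (grid_path k n.+1)) u - c (tick j)) <= 3 * eta].
Proof.
elim: n k u => [|n IH] k u kn /andP[u0 u1].
  have kN : (k < N)%N by lia.
  exists k; rewrite leqnn leq_addr subnn muln0 muln1; split=> //; first by rewrite u0 /=; lra.
  rewrite [grid_path _ _]/= [map _ _]/=; have [h|h] := leP u 1.
    by rewrite polyline_cons1 ?u0 //; apply: ball_convex; first [exact: near0|exact: nearm|by rewrite u0].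
  rewrite polyline_cons_ge1 ?(ltW h) // polyline_cons1; last by rewrite subr_ge0 (ltW h) /=; lra.
  apply: ball_convex; [exact: nearm|exact: near1|].
  by rewrite subr_ge0 (ltW h) /=; lra.
have kN : (k < N)%N by lia.
have [h2|h2] := leP u 2.
  exists k; rewrite leqnn leq_addr subnn muln0 muln1; split=> //; first by rewrite u0.
  change (grid_path k n.+2) with (m k :: q k.+1 :: grid_path k.+1 n.+1).
  rewrite [map _ (_ :: _)]/=; have [h|h] := leP u 1.
    by rewrite polyline_cons1 ?u0 //; apply: ball_convex; first [exact: near0|exact: nearm|by rewrite u0].
  rewrite polyline_cons_ge1 ?(ltW h) // polyline_cons1; last by rewrite subr_ge0 (ltW h) /=; lra.
  apply: ball_convex; [exact: nearm|exact: near1|].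
  by rewrite subr_ge0 (ltW h) /=; lra.
have u2 : 0 <= u - 2 <= 2 * n.+1%:R by move: u1; rewrite -(natr1 n.+1) mulrDr => u1; apply/andP; split; lra.
have kn' : (k.+1 + n.+1 <= N)%N by rewrite addSnnS.
have [j [j1 /andP[j3 j4] hj]] := IH k.+1 (u - 2) kn' u2.
have [j2 e1 e2] := grid_index_shift j1.
exists j; split=> //.
  by rewrite e1 e2 !natrD; apply/andP; split; lra.
change (grid_path k n.+2) with (m k :: q k.+1 :: grid_path k.+1 n.+1).
change (map nd (m k :: q k.+1 :: grid_path k.+1 n.+1)) with
  (nd (m k) :: nd (q k.+1) :: map nd (grid_path k.+1 n.+1)).
have g1 : 1 <= u by apply: le_trans (ltW h2); rewrite ler1n.
have g2 : 1 <= u - 1 by rewrite lerBrDr; exact: (ltW h2).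
rewrite (@polyline_cons_ge1 R _ _ _ u g1) (@polyline_cons_ge1 R _ _ _ (u - 1) g2).
by have -> : u - 1 - 1 = u - 2 by ring.
Qed.

Hypothesis c01 : c 1 = c 0.

(** The lattice is anchored at [c 0], so the polygonal loop keeps the base point. There are two
    steps per tick, which keeps both parametrisations in pace. *)
Lemma grid_loop : exists b s, [/\ path (edgeU U (c 0) eta) b s, last b s = b, nd b = c 0,
  size s = (2 * N)%N &
  forall t, 0 <= t <= 1 -> segU U (polyline (nd b) (map nd s) ((size s)%:R * t)) (c t)].
Proof.
exists (q 0), (grid_path 0 N).
have cx0 : cx (c 0) eta (c 0) = 0 by rewrite /cx subrr mul0r.
have cy0 : cy (c 0) eta (c 0) = 0 by rewrite /cy subrr mul0r.
have tN : tick N = 1 by rewrite /tick divff // gt_eqF.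
have qN : q N = q 0 by rewrite /q tN c01 tick0.
split; [exact: grid_edges|by rewrite grid_last| |exact: grid_size|].
  rewrite /q tick0 cx0 cy0 floor0 /node /= mulr0.
  by apply: complex_ext; rewrite ?(cReD, cImD) /= addr0.
move=> t /andP[t0 t1]; rewrite grid_size; have [n E] : exists n, N = n.+1 by exists N.-1; rewrite prednK.
have Ng : 0 < n.+1%:R :> R by rewrite ltr0n.
rewrite E.
have [j [/andP[_ j2] /andP[j3 j4] hj]] := @grid_near 0 n ((2 * n.+1)%N%:R * t) ltac:(by rewrite E add0n)
  ltac:(by rewrite natrM mulr_ge0 ?mulr_ge0 ?ler0n //= ler_piMr // mulr_ge0).
rewrite subn0 in j3 j4; have jN : (j <= N)%N by rewrite E; exact: leq_trans j2 (leqnSn _).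
have ht : cmod (c t - c (tick j)) < eta.
  apply: close; [by rewrite t0|exact: tick01|].
  move: j3 j4; rewrite !natrM -!mulrA !ler_pM2l // => j3 j4.
  rewrite /tick -[t](mulfK (lt0r_neq0 Ng)) -E -mulrBl normrM (@ger0_norm _ (_^-1)) ?invr_ge0 ?ler0n //.
  rewrite ler_piMl ?invr_ge0 ?ler0n // E ler_norml.
  by rewrite -natr1 in j4; rewrite (mulrC t); apply/andP; split; lra.
move=> s s01; apply: (ballU (tick01 jN)).
apply: le_lt_trans (_ : 3 * eta < _); last by rewrite /eta; have := delta0; lra.
by apply: ball_convex => //; apply: le_trans (ltW ht) _; have := eta0; lra.
Qed.

End Discretize.

(** * A hole in a multiply connected domain *)

Section Hole.
Variables (R : realType) (U : set (Cplx R)).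
Local Notation C := (R[i]).

Lemma within_contP (c : R -> Cplx R) : {within `[0, 1], continuous c} ->
  forall t, 0 <= t <= 1 -> forall e, 0 < e ->
  exists2 d, 0 < d & forall t', 0 <= t' <= 1 -> `|t' - t| < d -> cmod (c t' - c t) < e.
Proof.
move=> /subspace_continuousP cc t t01 e e0.
have t01' : `[0, 1]%classic t by rewrite /= in_itv.
have B : nbhs (c t) [set w : Cplx R | cmod (w - c t) < e] by apply/nbhsC; exists e.
have := cc t t01' _ B; rewrite /= /within /= => /nbhs_ballP[d /= d0 hd].
exists d => // t' t'01 tt'; apply: hd; last by rewrite /= in_itv.
by rewrite /ball /= distrC.
Qed.

(** The loop is joined to a lattice loop by segments inside [U], and the lattice loop to a constant
    by moves; every stage is a [gnull_step]. *)
Lemma loop_null (c : R -> Cplx R) : open U ->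
  (forall S : set (Cplx R), closed S -> (exists r, bounded_by S r) ->
    (forall z, S z -> ~ U z -> exists2 e, 0 < e & forall w, cmod (w - z) < e -> S w) ->
    S `<=` U) ->
  loop_in U c -> null_homotopic_in U c.
Proof.
move=> Uo nh [cc cU c01].
have cont := within_contP cc.
have Uc t : 0 <= t <= 1 -> U (c t) by move=> t01; apply: cU; exists t; rewrite //= in_itv.
have [delta d0 hd] : exists2 e, 0 < e & forall t, 0 <= t <= 1 -> forall w, cmod (w - c t) < e -> U w.
  apply: (@uniform_scale R (fun t e => forall w, cmod (w - c t) < e -> U w)).
    by move=> t e e' H /andP[e0 ee] w hw; apply: H; exact: lt_le_trans ee.
  move=> t t01; have [e e0 he] := (openC U).1 Uo _ (Uc t t01).
  have [d d0 hd] := cont t t01 (e / 2) ltac:(by rewrite divr_gt0).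
  exists (Num.min d (e / 2)); first by rewrite lt_min d0 divr_gt0.
  move=> t' t'01; rewrite lt_min => /andP[h1 _] w; rewrite lt_min => /andP[_ h2].
  apply: he; apply: le_lt_trans (cmod_tri _ _ (c t')) _.
  by have := hd t' t'01 h1; lra.
have eta0 : 0 < delta / 8 by rewrite divr_gt0.
have [e e0 he] : exists2 e, 0 < e & forall t, 0 <= t <= 1 ->
    forall t', 0 <= t' <= 1 -> `|t - t'| < e -> cmod (c t - c t') < delta / 8.
  apply: (@uniform_scale R (fun t e => forall t', 0 <= t' <= 1 -> `|t - t'| < e -> cmod (c t - c t') < delta / 8)).
    by move=> t e e' H /andP[e0 ee] t' t'01 h; apply: H => //; exact: lt_le_trans ee.
  move=> t t01; have [d dd0 hd'] := cont t t01 (delta / 8 / 2) ltac:(by rewrite divr_gt0).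
  exists (d / 2); first by rewrite divr_gt0.
  move=> t' t'01 h1 t'' t''01 h2.
  apply: le_lt_trans (cmod_tri _ _ (c t)) _; rewrite [cmod (c t - _)]cmodB.
  have a1 := hd' t' t'01 ltac:(lra).
  have a2 : cmod (c t'' - c t) < delta / 8 / 2.
    apply: hd' => //; apply: le_lt_trans (ler_distD t' _ _) _; rewrite (distrC t''); lra.
  by lra.
pose N := (Num.truncn e^-1).+1.
have N0 : (0 < N)%N by [].
have Ne : N%:R^-1 < e.
  by rewrite invf_plt ?posrE ?ltr0n // truncnS_gt.
have [b [s [ps ls nb sz hs]]] := @grid_loop R U c delta N d0 N0 (fun t w t01 => hd t t01 w)
  (fun t t' h1 h2 h3 => he t h1 t' h2 (le_lt_trans h3 Ne)) (esym c01).
(* Extended by constants, as [pathc] asks for continuity on the whole line. *)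
pose g (t : R) := c (clip 0 1 t).
have gE t : 0 <= t <= 1 -> g t = c t.
  move=> /andP[t0 t1]; rewrite /g; case: (clipP t ler01) => -[h ->] //; congr c; lra.
have i0 : 0 <= (0 : R) <= 1 by rewrite lexx ler01.
have i1 : 0 <= (1 : R) <= 1 by rewrite lexx ler01.
have clip01 (t : R) : 0 <= clip 0 1 t <= 1.
  by case: (clipP t ler01) => -[h ->].
have gc : pathc g.
  move=> z e1 e10; have [d dd0 hd'] := cont _ (clip01 (complex.Im z)) e1 e10.
  exists d => // w hw; apply: hd' => //; apply: le_lt_trans (clip_lip _ _ ler01) _.
  by rewrite -cImB; apply: le_lt_trans (cmod_im _) hw.
have L : lhom (vtri U (c 0) (delta / 8)) (b :: s) (nseq (size s).+1 b).
  apply: (@lhom_const (edgeU U (c 0) (delta / 8)) _ _ _ _ _ _ (size s)) => //.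
  - by move=> p q; exact: edgeU_adj.
  - by move=> p q; exact: edgeU_sym.
  - by move=> p q; exact: edgeU_refl.
  - by move=> p q x y z; exact: tri_edgeU.
  - by move=> b' s' i j ps' ls' w; exact: (cell_in_U eta0 nh ps' ls' w).
have chain : chainU U (map (node (c 0) (delta / 8)) (b :: s)).
  move=> A x y B.
  elim: s b ps {hs sz ls nb L} A => [|q s IH] b /=; first by move=> _ [|? [|? A]].
  move=> /andP[bq pq] [|a A] /=; last by case=> _; exact: IH.
  by case=> <- <- _; case/asboolP: bq.
have G : gnull U (fun t => lpoly (map (node (c 0) (delta / 8)) (b :: s)) ((size s)%:R * t)).
  apply: gnull_lhom L _ _ _ _ => //.
  rewrite [nseq _ _]/=; have E u : lpoly (node (c 0) (delta / 8) b :: map (node (c 0) (delta / 8)) (nseq (size s) b)) u = c 0.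
    rewrite /lpoly map_nseq nb; elim: (size s) u => //= k IH u.
    by rewrite IH subrr mulr0 addr0.
  by apply: gnull_cst => [|t _]; rewrite ?E //; exact: Uc.
have lp0 : polyline (node (c 0) (delta / 8) b) (map (node (c 0) (delta / 8)) s) ((size s)%:R * 0) = c 0.
  by rewrite mulr0 polyline_le0.
have lp1 : polyline (node (c 0) (delta / 8) b) (map (node (c 0) (delta / 8)) s) ((size s)%:R * 1) = c 0.
  by rewrite mulr1 -(size_map (node (c 0) (delta / 8))) polyline_last last_map ls.
have [h [hc hU h0 h1 hs']] : gnull U g.
  apply: gnull_step G; first exact: gc.
  - exact: polyline_cont.
  - by rewrite /= lp0 gE.
  - by rewrite !gE.
  - by rewrite /= lp1 gE.
  - by move=> t t01; rewrite gE //; exact: hs.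
exists (fun p => h (Complex p.1 p.2)); split.
- apply: continuous_subspaceT => p.
  move=> A /nbhsC[e1 e10 he1]; have [d d1 hd1] := hc (Complex p.1 p.2) e1 e10.
  exists (ball p.1 (d / 2), ball p.2 (d / 2)); first by split; apply: nbhsx_ballx; rewrite divr_gt0.
  move=> [x y] /= [hx hy]; apply/he1/hd1; apply: le_lt_trans (cmod_le _) _.
  by rewrite !(cReB, cImB) /=; move: hx hy; rewrite /ball /= => hx hy; rewrite distrC (distrC y); lra.
- by move=> _ [[x y] /= [hx hy] <-]; apply: hU; [move: hx|move: hy]; rewrite /= in_itv.
- by move=> t t01; rewrite /= h0 // gE.
- by move=> t t01; rewrite /= h1 // gE.
- by move=> t t01; have [a1 a2] := hs' t t01; rewrite /= a1 a2 gE.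
Qed.

Lemma hole : multiply_connected U -> exists S : set (Cplx R),
  [/\ closed S, exists r, bounded_by S r,
    forall z, S z -> ~ U z -> exists2 e, 0 < e & forall w, cmod (w - z) < e -> S w &
    exists p, S p /\ ~ U p].
Proof.
move=> [dU nsc]; apply: contrapT => N; apply: nsc; split=> // c lc.
have [_ Uo _] := dU; apply: loop_null => // S Sc Sb SS p Sp.
by apply: contrapT => nUp; apply: N; exists S; split=> //; exists p.
Qed.

End Hole.

(** * Dynamics on the wandering domain *)

Section Normality.
Variable R : realType.
Local Notation C := (R[i]).
Implicit Types (z w x y a b p : C) (r s e M rho : R) (n k l j : nat).

Lemma entourageC (E : set (Cplx R * Cplx R)) : entourage E <->
  exists2 e, 0 < e & forall x y : C, cmod (x - y) < e -> E (x, y).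
Proof.
rewrite -entourage_ballE; split=> [[e /= e0 he]|[e e0 he]].
  have [er ei] : e = (complex.Re e)%:C%C /\ 0 < complex.Re e.
    move: e0; rewrite ltcE /= => /andP[/eqP h1 h2]; split=> //.
    by apply: complex_ext => //=; rewrite h1.
  by exists (complex.Re e) => // x y h; apply: he; rewrite /= /ball /= er cmodE ltcR.
exists (e%:C%C); first by rewrite /= ltcR.
by move=> [x y] /=; rewrite /ball /= cmodE ltcR; exact: he.
Qed.

Lemma uniform_cvgC (A : set (Cplx R)) (g : nat -> Cplx R -> Cplx R) (h : Cplx R -> Cplx R) :
  {uniform A, g @ \oo --> h} <->
  forall e, 0 < e -> exists N, forall n, (N <= n)%N -> forall x, A x -> cmod (h x - g n x) < e.
Proof.
split=> [H e e0|H P /uniform_nbhs [E [/entourageC[e e0 he] EP]]].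
  have := H [set g' | forall x, A x -> cmod (h x - g' x) < e].
  case=> [|N _ hN]; last by exists N => n Nn; exact: hN.
  apply/uniform_nbhs; exists [set p | cmod (p.1 - p.2) < e]; split=> //.
  by apply/entourageC; exists e.
by have [N hN] := H e e0; exists N => // n Nn; apply: EP => x Ax; apply: he; exact: hN.
Qed.

Lemma homo_ge (phi : nat -> nat) : {homo phi : m n / (m < n)%N} -> forall n, (n <= phi n)%N.
Proof. by move=> hp; elim=> // n IH; apply: leq_ltn_trans IH _; exact: hp. Qed.

(** Counterexamples with growing indices would accumulate at a point of [K], against the hypothesis
    there. *)
Lemma compact_uniform (K : set (Cplx R)) r (Q : nat -> C -> Prop) : closed K -> bounded_by K r ->
  (forall z, K z -> exists2 rho, 0 < rho &
    exists N, forall k, (N <= k)%N -> forall x, K x -> cmod (x - z) < rho -> Q k x) ->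
  exists N, forall k, (N <= k)%N -> forall x, K x -> Q k x.
Proof.
move=> Kc Kb H; apply: contrapT => N.
have /choice [u hu] n : exists kx : nat * C, [/\ (n <= kx.1)%N, K kx.2 & ~ Q kx.1 kx.2].
  apply: contrapT => N'; apply: N; exists n => k nk x Kx; apply: contrapT => nQ.
  by apply: N'; exists (k, x).
have ub n : cmod (u n).2 <= r by have [_ h _] := hu n; exact: Kb.
have [phi hphi [l hl]] := bwC ub.
have Kl : K l.
  apply: ((closedC _).1 Kc l) => e e0; have [n hn] := hl e e0.
  by exists (u (phi n)).2; [have [] := hu (phi n)|exact: hn].
have [rho rho0 [m hm]] := H l Kl; have [n hn] := hl rho rho0.
have [h1 h2 h3] := hu (phi (maxn m n)); apply: h3; apply: hm => //; last exact: hn (leq_maxr _ _).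
by apply: leq_trans h1; apply: leq_trans (homo_ge hphi _); exact: leq_maxl.
Qed.

Variable f : C -> C.

(** A Cauchy condition avoids naming the limit. It is uniform on full discs, not only on their part
    in [G], so it is meaningful for [G = [set z]], as used on frontiers. *)
Definition loc_cauchy (G : set (Cplx R)) (n : nat -> nat) := forall z, G z -> exists2 rho, 0 < rho &
  forall e, 0 < e -> exists K, forall k l, (K <= k)%N -> (K <= l)%N -> forall x, cmod (x - z) < rho ->
    cmod (iter (n k) f x - iter (n l) f x) < e.

Definition loc_infty (G : set (Cplx R)) (n : nat -> nat) := forall z, G z -> exists2 rho, 0 < rho &
  forall M, exists K, forall k, (K <= k)%N -> forall x, cmod (x - z) < rho -> M < cmod (iter (n k) f x).

Definition loc_normal (G : set (Cplx R)) := forall n : nat -> nat, (forall k, (0 < n k)%N) ->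
  exists2 phi : nat -> nat, {homo phi : k l / (k < l)%N} &
    loc_cauchy G (n \o phi) \/ loc_infty G (n \o phi).

Lemma cauchyC (u : nat -> C) :
  (forall e, 0 < e -> exists K, forall k l, (K <= k)%N -> (K <= l)%N -> cmod (u k - u l) < e) ->
  exists h, forall e, 0 < e -> exists K, forall k, (K <= k)%N -> cmod (h - u k) < e.
Proof.
move=> H; have [K hK] := H 1 ltr01.
have ub n : cmod (u (n + K)%N) <= cmod (u K) + 1.
  have := cmod_subl (u (n + K)%N) (u K); have := hK (n + K)%N K (leq_addl _ _) (leqnn _); lra.
have [phi hphi [l hl]] := bwC ub; exists l => e e0.
have [K1 hK1] := H (e / 2) ltac:(by rewrite divr_gt0); have [K2 hK2] := hl (e / 2) ltac:(by rewrite divr_gt0).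
exists K1 => k kK; set m := maxn K1 K2.
apply: le_lt_trans (cmod_tri _ _ (u (phi m + K)%N)) _.
have := hK2 m (leq_maxr _ _); rewrite cmodB.
have a : (K1 <= phi m + K)%N.
  by apply: leq_trans (leq_addr _ _); apply: leq_trans (homo_ge hphi _); exact: leq_maxl.
by have := hK1 _ k a kK; lra.
Qed.

Lemma FatouP z : Fatou_set f z <-> exists2 r, 0 < r & loc_normal (cdisc z r).
Proof.
split=> [[G [Go Gz] GN]|[r r0 H]].
  have [r r0 hr] := (openC G).1 Go z Gz; exists r => // n n0.
  have [phi [hphi C]] := GN (fun k => iter (n k) f) (fun k => ex_intro2 _ _ (n k) (n0 k) erefl).
  exists phi => //; case: C => [[h lc]|lc]; [left|right] => w wr; have Gw : G w by exact: hr.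
    have [V /nbhsC[rho rho0 hV] /uniform_cvgC hU] := lc w Gw.
    have [s s0 hs] := (openC G).1 Go w Gw.
    exists (Num.min rho s); first by rewrite lt_min rho0.
    move=> e e0; have [K hK] := hU (e / 2) ltac:(by rewrite divr_gt0); exists K => k l Kk Kl x.
    rewrite lt_min => /andP[/hV Vx /hs Gx]; apply: le_lt_trans (cmod_tri _ _ (h x)) _.
    have a1 := hK k Kk x (conj Vx Gx); have a2 := hK l Kl x (conj Vx Gx).
    by rewrite /= in a1 a2; rewrite cmodB in a1; rewrite /=; lra.
  have [V /nbhsC[rho rho0 hV] hU] := lc w Gw.
  have [s s0 hs] := (openC G).1 Go w Gw.
  exists (Num.min rho s); first by rewrite lt_min rho0.
  move=> M; have [K _ hK] := hU M; exists K => k Kk x.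
  by rewrite lt_min => /andP[/hV Vx /hs Gx]; exact: hK.
exists (cdisc z r); first by split; [exact: cdisc_open|rewrite /cdisc /= subrr cmod0].
move=> g Fg; have /choice [n hn] k : exists n, (0 < n)%N /\ iter n f = g k.
  by have [n n0 E] := Fg k; exists n.
have [phi hphi C] := H n (fun k => (hn k).1); exists phi; split=> //.
have gE k : g (phi k) = iter (n (phi k)) f by have [_ ->] := hn (phi k).
case: C => lc; [left|right].
  have /choice [h hh] x : exists h, cdisc z r x -> forall e, 0 < e -> exists K, forall k, (K <= k)%N ->
      cmod (h - iter (n (phi k)) f x) < e.
    have [xr|nx] := pselect (cdisc z r x); last by exists 0.
    have [rho rho0 hrho] := lc x xr.
    have [|l hl] := @cauchyC (fun k => iter (n (phi k)) f x); last by exists l.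
    move=> e e0; have [K hK] := hrho e e0; exists K => k l Kk Kl; apply: hK => //.
    by rewrite subrr cmod0.
  exists h => w wr; have [rho rho0 hrho] := lc w wr.
  exists (cdisc w rho); first by apply/nbhsC; exists rho.
  apply/uniform_cvgC => e e0; have [K hK] := hrho (e / 2) ltac:(by rewrite divr_gt0).
  exists K => k Kk x [xw xr]; rewrite /= gE.
  have [K' hK'] := hh x xr (e / 2) ltac:(by rewrite divr_gt0).
  apply: le_lt_trans (cmod_tri _ _ (iter (n (phi (maxn K K'))) f x)) _.
  have := hK' _ (leq_maxr K K'); have := hK (maxn K K') k (leq_maxl _ _) Kk x xw; rewrite /=; lra.
move=> w wr; have [rho rho0 hrho] := lc w wr.
exists (cdisc w rho); first by apply/nbhsC; exists rho.
by move=> M; have [K hK] := hrho M; exists K => // k Kk x xw _; rewrite /= gE; exact: hK.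
Qed.

(** A sequence of iterates near [f z] is one with indices raised by 1 near [z]; open mapping carries
    the discs over. *)
Lemma Fatou_forward z : centire f -> nonconst f -> Fatou_set f z -> Fatou_set f (f z).
Proof.
move=> fe fn /FatouP[r r0 H]; apply/FatouP; have [d d0 hd] := open_mapping z fe fn r0.
exists d => // n n0; have [phi hphi C] := H (fun k => (n k).+1) (fun=> isT).
exists phi => //.
have L w : cmod (w - f z) < d -> exists x, [/\ cdisc z r x, f x = w &
    forall rho, 0 < rho -> exists2 d', 0 < d' & forall w', cmod (w' - w) < d' -> exists2 x', cmod (x' - x) < rho & f x' = w'].
  move=> /hd[x xz <-]; exists x; split=> // rho rho0; exact: open_mapping.
case: C => lc; [left|right] => w /L[x [xz xw hx]]; have [rho rho0 hrho] := lc x xz.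
  have [d' d'0 hd'] := hx rho rho0; exists d' => // e e0; have [K hK] := hrho e e0; exists K => k l Kk Kl w'.
  by move=> /hd'[x' xx' <-]; rewrite -!iterSr; exact: hK.
have [d' d'0 hd'] := hx rho rho0; exists d' => // M; have [K hK] := hrho M; exists K => k Kk w'.
by move=> /hd'[x' xx' <-]; rewrite -!iterSr; exact: hK.
Qed.

Lemma Fatou_forward_iter n z : centire f -> nonconst f -> Fatou_set f z -> Fatou_set f (iter n f z).
Proof. by move=> fe fn Fz; elim: n => //= n; exact: Fatou_forward. Qed.

Lemma loc_cauchy_sub G (n phi : nat -> nat) : {homo phi : k l / (k < l)%N} -> loc_cauchy G n -> loc_cauchy G (n \o phi).
Proof.
move=> hp H z Gz; have [rho rho0 h] := H z Gz; exists rho => // e e0; have [K hK] := h e e0.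
by exists K => k l Kk Kl; apply: hK; [apply: leq_trans Kk _|apply: leq_trans Kl _]; exact: homo_ge.
Qed.

Lemma loc_infty_sub G (n phi : nat -> nat) : {homo phi : k l / (k < l)%N} -> loc_infty G n -> loc_infty G (n \o phi).
Proof.
move=> hp H z Gz; have [rho rho0 h] := H z Gz; exists rho => // M; have [K hK] := h M.
by exists K => k Kk; apply: hK; apply: leq_trans Kk _; exact: homo_ge.
Qed.

Lemma bounded_eventually (u : nat -> R) K B : (forall k, (K <= k)%N -> u k <= B) ->
  exists B', forall k, u k <= B'.
Proof.
elim: K B => [|K IH] B H; first by exists B => k; exact: H.
apply: (IH (Num.max B (u K))) => k; rewrite leq_eqVlt => /orP[/eqP <-|h]; rewrite le_max ?lexx ?orbT //.
by rewrite H.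
Qed.

Lemma loc_cauchy_bounded G (n : nat -> nat) z : loc_cauchy G n -> G z -> exists B, forall k, cmod (iter (n k) f z) <= B.
Proof.
move=> H Gz; have [rho rho0 h] := H z Gz; have [K hK] := h 1 ltr01.
apply: (@bounded_eventually _ K (cmod (iter (n K) f z) + 1)) => k Kk.
have := cmod_subl (iter (n k) f z) (iter (n K) f z).
have := hK k K Kk (leqnn _) z; rewrite subrr cmod0 => /(_ rho0); lra.
Qed.

(* The finite/infinite dichotomy of normality concerns a whole neighbourhood, so boundedness of
   the orbit along [n] is both an open and a closed condition. *)
Lemma bounded_spread (U : set (Cplx R)) (n : nat -> nat) : connected U -> U `<=` Fatou_set f -> (forall k, (0 < n k)%N) ->
  forall x y, U x -> U y -> (exists B, forall k, cmod (iter (n k) f x) <= B) ->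
  exists B, forall k, cmod (iter (n k) f y) <= B.
Proof.
move=> Uc UF n0 x y Ux Uy bx.
pose bd z := exists B, forall k, cmod (iter (n k) f z) <= B.
have L z : U z -> exists2 r, 0 < r & forall w w', cmod (w - z) < r -> cmod (w' - z) < r -> bd w -> bd w'.
  move=> /UF/FatouP[r r0 H]; exists r => // w w' wz w'z [B hB]; apply: contrapT => nb.
  have /choice [j hj] m : exists j, m%:R < cmod (iter (n j) f w').
    apply: contrapT => N; apply: nb; exists m%:R => k; rewrite leNgt; apply/negP => h; apply: N; by exists k.
  have [phi hphi [lc|lc]] := H (n \o j) (fun k => n0 (j k)).
    have [B' hB'] := loc_cauchy_bounded lc w'z.
    have := hj (phi (Num.truncn B').+1); have := hB' (Num.truncn B').+1; rewrite /= => h1 h2.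
    have : B' < (phi (Num.truncn B').+1)%:R.
      by apply: lt_le_trans (truncnS_gt _) _; rewrite ler_nat; exact: homo_ge.
    by lra.
  have [rho rho0 h] := lc w wz; have [K hK] := h B.
  have := hK K (leqnn _) w; rewrite subrr cmod0 => /(_ rho0); rewrite /=.
  by have := hB (j (phi K)); lra.
apply: (@connected_ind R U bd Uc) Uy => [|z Uz bz|z Uz H]; first by exists x.
  have [r r0 h] := L z Uz; exists r => // w wz _; apply: h bz => //; by rewrite subrr cmod0.
have [r r0 h] := L z Uz; have [w wz [_ bw]] := H r r0; apply: h bw => //.
by rewrite subrr cmod0.
Qed.

End Normality.

(** * A bounded domain with frontier in the Fatou component *)

Section FilledDomain.
Variable R : realType.
Local Notation C := (R[i]).
Implicit Types (z w x y a p : C) (r s e M rho : R) (U W S : set (Cplx R)).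

Lemma segment_set_connected a x : connected ([set a + t%:C%C * (x - a) | t in (`[0, 1]%classic : set R)] : set (Cplx R)).
Proof.
apply: connected_continuous_connected; first exact: segment_connected.
apply: continuous_subspaceT => t A /nbhsC[e e0 he].
apply/nbhs_ballP; exists (e / (cmod (x - a) + 1)).
  by rewrite /= divr_gt0 // ltr_wpDl ?cmod_ge0.
move=> t'; rewrite /ball /= ltr_pdivlMr ?ltr_wpDl ?cmod_ge0 // => h; apply: he.
have -> : a + t'%:C%C * (x - a) - (a + t%:C%C * (x - a)) = (t' - t)%:C%C * (x - a) by rewrite rmorphB; ring.
by rewrite cmodM cmod_real; apply: le_lt_trans h; rewrite distrC ler_wpM2l // lerDl ler01.
Qed.

Lemma cdisc_connected a r : connected (cdisc a r).
Proof.
have [r0|r0] := ltP 0 r; last first.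
  have -> : cdisc a r = set0.
    apply/seteqP; split=> // z; rewrite /cdisc /=; have := cmod_ge0 (z - a); lra.
  exact: connected0.
have -> : cdisc a r = \bigcup_(x in cdisc a r) ([set a + t%:C%C * (x - a) | t in (`[0, 1]%classic : set R)] : set (Cplx R)).
  apply/seteqP; split=> [x xr|_ [x xr [t /= t01 <-]]].
    exists x => //; exists 1; first by rewrite /= in_itv /= ler01 lexx.
    by rewrite rmorph1 mul1r addrC subrK.
  move: t01 xr; rewrite in_itv /= /cdisc /= addrAC subrr add0r cmodM cmod_real => /andP[t0 t1] xr.
  by rewrite ger0_norm //; apply: le_lt_trans xr; rewrite ler_piMl ?cmod_ge0.
apply: bigcup_connected => [|x xr]; last exact: segment_set_connected.
exists a => x xr; exists 0; first by rewrite /= in_itv /= ler01 lexx.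
by rewrite rmorph0 mul0r addr0.
Qed.

Lemma cdisc_center a r : 0 < r -> cdisc a r a.
Proof. by rewrite /cdisc /= subrr cmod0. Qed.

Lemma bounded_open_boundary W r p : open W -> bounded_by W r -> W p ->
  exists2 x, closure W x & ~ W x.
Proof.
move=> Wo Wb Wp; apply: contrapT => N.
have Wc x : closure W x -> W x by move=> cx; apply: contrapT => nW; apply: N; exists x.
pose q : C := (`|r| + 1)%:C%C.
have qn : cmod q = `|r| + 1 by rewrite cmod_real ger0_norm // addr_ge0.
suff /Wb : W q by rewrite qn; have := ler_norm r; lra.
pose s := cmod p + cmod q + 1.
have s0 : 0 < s by rewrite /s; have := cmod_ge0 p; have := cmod_ge0 q; lra.
apply: (@connected_ind R (cdisc 0 s) W (@cdisc_connected 0 s)).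
- by exists p => //; rewrite /cdisc /= subr0 /s; have := cmod_ge0 q; lra.
- by move=> z _ Wz; have [e e0 he] := (openC W).1 Wo z Wz; exists e => // w /he.
- move=> z _ H; apply/Wc/closureC => e e0; have [w wz [_ Ww]] := H e e0; by exists w.
- by rewrite /cdisc /mkset subr0 /s -addrA ltr_wpDl ?cmod_ge0 // ltrDl.
Qed.

(** [W] is a component of the interior of [S]; a frontier point outside [U] would be interior to [S]
    and so belong to [W]. Were [W] inside [F], it would meet [U] near its frontier and be absorbed
    by maximality, although it contains [p] outside [U]. *)
Lemma filled_domain (F U : set (Cplx R)) : multiply_connected U -> U `<=` F ->
  (forall V, connected V -> V `<=` F -> (exists2 x, V x & U x) -> V `<=` U) ->
  exists W r, [/\ open W, bounded_by W r, connected W, forall z, closure W z -> ~ W z -> U z &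
    exists2 p, W p & ~ F p].
Proof.
move=> mc UF Umax; have [[_ Uo Uc] _] := mc.
have [S [Sc [r Sb] SU [p [Sp nUp]]]] := hole mc.
pose I := [set z : Cplx R | exists2 e, 0 < e & forall w, cmod (w - z) < e -> S w].
have IS z : I z -> S z by move=> [e e0 he]; apply: he; rewrite subrr cmod0.
have Io z : I z -> exists2 e, 0 < e & cdisc z e `<=` I.
  move=> [e e0 he]; exists (e / 2); first by rewrite divr_gt0.
  move=> w hw; exists (e / 2); first by rewrite divr_gt0.
  move=> v hv; apply: he; apply: le_lt_trans (cmod_tri _ _ w) _.
  by rewrite /cdisc /= in hw; lra.
have Ip : I p by exact: SU.
pose W := connected_component I p.
have WI : W `<=` I by exact: connected_component_sub.
have Wmax z e : cdisc z e `<=` I -> (exists2 w, W w & cmod (w - z) < e) -> cdisc z e `<=` W.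
  move=> dI [w Ww wz]; rewrite /W (same_connected_component Ww).
  by apply: connected_component_max => //; exact: cdisc_connected.
have Wo : open W.
  apply/openC => z Wz; have [e e0 he] := Io z (WI z Wz); exists e => // w hw.
  by apply: (Wmax z e he) => //; exists z; rewrite // subrr cmod0.
have Wp : W p by exact: connected_component_refl.
have Wb : bounded_by W r by move=> z /WI/IS/Sb.
have bd z : closure W z -> ~ W z -> U z.
  move=> cz nW; apply: contrapT => nU.
  have Sz : S z by apply: ((closedC S).1 Sc) => e e0; have [w /WI/IS Sw wz] := (closureC _ _).1 cz e e0; exists w.
  have [e e0 he] := Io z (SU z Sz nU); have [w Ww wz] := (closureC _ _).1 cz e e0.
  by apply/nW/(Wmax z e he); [exists w|exact: cdisc_center].
exists W, r; split=> //; first exact: component_connected.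
apply: contrapT => N.
have WF : W `<=` F by move=> z Wz; apply: contrapT => nF; apply: N; exists z.
have [x cx nWx] := bounded_open_boundary Wo Wb Wp.
have [e e0 he] := (openC U).1 Uo x (bd x cx nWx).
have [w Ww wx] := (closureC _ _).1 cx e e0.
have : W `<=` U.
  by apply: Umax => //; [exact: component_connected|exists w => //; exact: he].
by move/(_ p Wp).
Qed.

End FilledDomain.

(** * Large discs covered by iterates *)

Section Star.
Variables (R : realType) (f : R[i] -> R[i]) (U W : set (Cplx R)) (r : R) (p : R[i]).
Local Notation C := (R[i]).
Local Notation it n := (iter n f).
Hypothesis fe : centire f.
Hypothesis Uc : connected U.
Hypothesis UF : U `<=` Fatou_set f.
Hypothesis Wo : open W.
Hypothesis Wb : bounded_by W r.
Hypothesis bdU : forall z, closure W z -> ~ W z -> U z.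
Hypothesis Wp : W p.
Hypothesis nFp : ~ Fatou_set f p.
Implicit Types (z w x y a : C) (s e M rho : R) (k l j : nat) (n m : nat -> nat).

Definition frontier : set (Cplx R) := [set z | closure W z /\ ~ W z].

Lemma frontier_closed : closed frontier.
Proof.
apply/closedC => z H; split.
  apply: ((closedC _).1 (@closed_closure _ W)) => e e0.
  by have [w [cw _] wz] := H e e0; exists w.
move=> Wz; have [e e0 he] := (openC W).1 Wo z Wz; have [w [_ nw] wz] := H e e0.
by apply/nw/he.
Qed.

Lemma closure_bounded_by : bounded_by (closure W) r.
Proof.
move=> z cz; apply/ler_addgt0Pr => e e0; have [w Ww wz] := (closureC _ _).1 cz e e0.
by have := Wb Ww; have := cmod_subl z w; rewrite cmodB in wz; lra.
Qed.

Lemma frontier_bounded : bounded_by frontier r.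
Proof. by move=> z [cz _]; exact: closure_bounded_by. Qed.

(** Finitely many discs of normality cover the compact frontier, and subsequences are extracted one
    disc after another. *)
Lemma frontier_normal n : (forall k, (0 < n k)%N) -> exists2 phi : nat -> nat, {homo phi : k l / (k < l)%N} &
  forall z, frontier z -> loc_cauchy f [set z] (n \o phi) \/ loc_infty f [set z] (n \o phi).
Proof.
move=> n0.
have /choice [rad hrad] z : exists s, frontier z -> 0 < s /\ loc_normal f (cdisc z s).
  have [fz|nf] := pselect (frontier z); last by exists 0.
  have [cz nz] := fz; have [s s0 hs] := (FatouP f z).1 (UF (bdU cz nz)); by exists s.
have Kc : compact frontier by apply: compactC frontier_closed frontier_bounded.
move: Kc; rewrite compact_cover => /(_ _ frontier (fun z => cdisc z (rad z))).
case=> [z _|z fz|D' D'K cov].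
- exact: cdisc_open.
- by exists z => //; apply: cdisc_center; exact: (hrad z fz).1.
pose sq : seq (Cplx R) := finmap.enum_fset D'.
have [phi hphi H] : exists2 phi : nat -> nat, {homo phi : k l / (k < l)%N} &
    forall z, z \in sq -> loc_cauchy f (cdisc z (rad z)) (n \o phi) \/ loc_infty f (cdisc z (rad z)) (n \o phi).
  have: forall z, z \in sq -> frontier z by move=> z /D'K; rewrite inE.
  elim: sq => [|z s IH] sK; first by exists id.
  have [phi hphi H] := IH (fun x xs => sK x (@mem_behead _ (z :: s) x xs)).
  have zK := sK z (mem_head _ _).
  have [psi hpsi C] := (hrad z zK).2 (n \o phi) (fun k => n0 (phi k)).
  exists (phi \o psi); first by move=> k l kl; apply/hphi/hpsi.
  move=> x; rewrite inE => /orP[/eqP ->//|/H[lc|lc]]; [left|right].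
    exact: (loc_cauchy_sub hpsi lc).
  exact: (loc_infty_sub hpsi lc).
exists phi => // z fz; have [x xD zx] := cov z fz.
by case: (H x xD) => lc; [left|right] => _ ->; exact: lc.
Qed.

Lemma iter_cont k z : ccont (it k) z.
Proof. by apply/cdiff_cont/(centire_iter k fe). Qed.

(* Otherwise every sequence of iterates has a subsequence with a limit along the frontier, and the
   maximum principle for [it k - it l], or for [1 / (it k - w)] with [w] omitted, carries this limit
   inside, so that [p] would be a point of normality. *)
Lemma covering s : 0 <= s -> exists k, [/\ (0 < k)%N, forall z, frontier z -> s < cmod (it k z) &
  forall w, cmod w <= s -> exists2 z, W z & it k z = w].
Proof.
move=> s0; apply: contrapT => N; apply: nFp; apply/FatouP.
have [d d0 hd] := (openC W).1 Wo p Wp; exists d => // n n0.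
have [phi hphi H] := frontier_normal n0; exists phi => //.
have [allI|] := pselect (forall z, frontier z -> loc_infty f [set z] (n \o phi)).
  right.
  have big M : exists K, forall k, (K <= k)%N -> forall x, W x -> M < cmod (it (n (phi k)) x).
    (* On the frontier the distance to [w] is at least [M' - s]; inside, once carried over, it
       leaves a modulus of at least [M' - 2 * s > M]. *)
    pose M' := `|M| + 2 * s + 1.
    have [K hK] : exists K, forall k, (K <= k)%N -> forall x, frontier x -> M' < cmod (it (n (phi k)) x).
      apply: (compact_uniform frontier_closed frontier_bounded) => z fz.
      have [rho rho0 h] := allI z fz z erefl; exists rho => //; have [K hK] := h M'.
      by exists K => k Kk x _; exact: hK.
    exists K => k Kk x Wx.
    have [w [ws wo]] : exists w, cmod w <= s /\ forall z, W z -> it (n (phi k)) z != w.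
      apply: contrapT => N'; apply: N; exists (n (phi k)); split=> [//|z fz|w ws].
        by apply: le_lt_trans (hK k Kk z fz); rewrite /M'; have := normr_ge0 M; lra.
      apply: contrapT => N''; apply: N'; exists w; split=> // z Wz; apply/eqP => E.
      by apply: N''; exists z.
    have nz z : closure W z -> it (n (phi k)) z - w != 0.
      move=> cz; rewrite subr_eq0; have [Wz|nWz] := pselect (W z); first exact: wo.
      apply/eqP => E; have := hK k Kk z (conj cz nWz); rewrite E /M'; have := normr_ge0 M; lra.
    have M's : 0 < M' - s by rewrite /M'; have := normr_ge0 M; lra.
    have mp : cmod ((it (n (phi k)) x - w)^-1) <= (M' - s)^-1.
      apply: (@max_principle R W (fun z => (it (n (phi k)) z - w)^-1) (M' - s)^-1 r Wo Wb) => [z cz|z Wz|z cz nWz|].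
      - by apply: ccontV; [exact: nz|apply: ccontB; [exact: iter_cont|exact: ccont_cst]].
      - apply: cdiffV; first by apply: nz; exact: subset_closure.
        by apply: cdiffB; [exact: centire_iter|exact: cdiff_cst].
      - rewrite cmodV lef_pV2 ?posrE // ?cmod_gt0 ?nz //.
        have := hK k Kk z (conj cz nWz); have := cmod_subl (it (n (phi k)) z) w; lra.
      - exact: subset_closure.
    have xw : 0 < cmod (it (n (phi k)) x - w) by rewrite cmod_gt0 nz //; exact: subset_closure.
    rewrite cmodV lef_pV2 ?posrE // in mp.
    have := cmodD (it (n (phi k)) x) (- w); rewrite cmodN; rewrite /M' in mp; have := ler_norm M; lra.
  move=> z zp; exists (d - cmod (z - p)); first by rewrite subr_gt0.
  move=> M; have [K hK] := big M; exists K => k Kk x xz; apply: hK => //; apply: hd.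
  by have := cmod_tri x p z; lra.
move=> /existsNP[x0 /not_implyP[fx0 nI]]; left.
have bx0 : exists B, forall k, cmod (it ((n \o phi) k) x0) <= B.
  by case: (H x0 fx0) => // lc; apply: (loc_cauchy_bounded lc).
(* One bounded orbit on the frontier excludes the infinite alternative at all its points, since they
   all lie in the connected [U]. *)
have allC z : frontier z -> loc_cauchy f [set z] (n \o phi).
  move=> fz; case: (H z fz) => // lc.
  have [B hB] := bounded_spread Uc UF (fun k => n0 (phi k)) (bdU fx0.1 fx0.2) (bdU fz.1 fz.2) bx0.
  have [rho rho0 h] := lc z erefl; have [K hK] := h B.
  by have := hK K (leqnn _) z; rewrite subrr cmod0 => /(_ rho0); have := hB K; lra.
have uni e : 0 < e -> exists K, forall k l, (K <= k)%N -> (K <= l)%N -> forall x, W x ->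
    cmod (it (n (phi k)) x - it (n (phi l)) x) < e.
  move=> e0; have e2 : 0 < e / 2 by rewrite divr_gt0.
  have [K hK] : exists K, forall k, (K <= k)%N -> forall x, frontier x ->
      forall l, (k <= l)%N -> cmod (it (n (phi k)) x - it (n (phi l)) x) < e / 2.
    apply: (compact_uniform frontier_closed frontier_bounded) => z fz.
    have [rho rho0 h] := allC z fz z erefl; exists rho => //; have [K hK] := h (e / 2) e2.
    by exists K => k Kk x _ xz l kl; apply: hK => //; exact: leq_trans kl.
  have mp k l x : (K <= k)%N -> (k <= l)%N -> W x -> cmod (it (n (phi k)) x - it (n (phi l)) x) <= e / 2.
    move=> Kk kl Wx.
    apply: (@max_principle R W (fun x => it (n (phi k)) x - it (n (phi l)) x) (e / 2) r Wo Wb) => [z cz|z Wz|z cz nWz|].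
    - by apply: ccontB; exact: iter_cont.
    - by apply: cdiffB; exact: centire_iter.
    - by apply: ltW; exact: hK.
    - exact: subset_closure.
  exists K => k l Kk Kl x Wx; have [kl|lk] := leqP k l.
    by have := mp k l x Kk kl Wx; lra.
  by rewrite cmodB; have := mp l k x Kl (ltnW lk) Wx; lra.
move=> z zp; exists (d - cmod (z - p)); first by rewrite subr_gt0.
move=> e e0; have [K hK] := uni e e0; exists K => k l Kk Kl x xz; apply: hK => //; apply: hd.
by have := cmod_tri x p z; lra.
Qed.

End Star.

(** * Disjoint images of a wandering domain *)

Section Wandering.
Variables (R : realType) (f : R[i] -> R[i]) (U : set (Cplx R)).
Local Notation C := (R[i]).
Local Notation it n := (iter n f).
Hypothesis fe : centire f.
Hypothesis fn : nonconst f.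

Lemma Fatou_component_max : Fatou_component f U -> [/\ U `<=` Fatou_set f, connected U &
  forall V, connected V -> V `<=` Fatou_set f -> (exists2 x, V x & U x) -> V `<=` U].
Proof.
move=> [x Fx <-]; split; [exact: connected_component_sub|exact: component_connected|].
move=> V Vc VF [y Vy xy]; rewrite (same_connected_component xy).
exact: connected_component_max.
Qed.

Lemma component_orbitE n a : Fatou_component f U -> U a ->
  component_orbit f U n = connected_component (Fatou_set f) (it n a).
Proof.
move=> FU Ua; have [UF Uc _] := Fatou_component_max FU.
pose P := [set V | Fatou_component f V /\ it n @` U `<=` V].
have PV V : P V -> V = connected_component (Fatou_set f) (it n a).
  move=> [[x Fx <-] H]; apply: same_connected_component.
  by apply: H; exists a.
apply: PV; apply: (@getPex _ P); exists (connected_component (Fatou_set f) (it n a)); split.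
  by exists (it n a) => //; apply: Fatou_forward_iter => //; exact: UF.
apply: (@connected_component_max (Cplx R) (Fatou_set f) (it n @` U) (it n a)); first by exists a.
  by move=> _ [x Ux <-]; apply: Fatou_forward_iter => //; exact: UF.
apply: connected_continuous_connected => //; apply: continuous_subspaceT => x.
by apply/ccontP/cdiff_cont; exact: centire_iter.
Qed.

(** A common value would make the components of the [i]-th and [j]-th images, and all later ones,
    coincide, giving the period [j - i]. *)
Lemma wandering_disjoint i j a b : wandering_domain f U -> (i < j)%N -> U a -> U b ->
  it i a <> it j b.
Proof.
move=> [FU np] ij Ua Ub E; apply: np; exists i, (j - i)%N; split; first by rewrite subn_gt0.
move=> n ni; rewrite (component_orbitE _ FU Ub) (component_orbitE _ FU Ua); congr connected_component.
have -> : (n + (j - i) = (n - i) + j)%N by move: ij ni; clear; lia.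
by rewrite iterD -E -iterD subnK.
Qed.

End Wandering.

(** * Escape to infinity and a disc of slow growth *)

Section Escape.
Variables (R : realType) (f : R[i] -> R[i]) (U W : set (Cplx R)) (r : R) (p b1 : R[i]).
Local Notation C := (R[i]).
Local Notation it n := (iter n f).
Hypothesis ft : transc f.
Hypothesis Uc : connected U.
Hypothesis UF : U `<=` Fatou_set f.
Hypothesis Wo : open W.
Hypothesis Wb : bounded_by W r.
Hypothesis bdU : forall z, closure W z -> ~ W z -> U z.
Hypothesis Wp : W p.
Hypothesis nFp : ~ Fatou_set f p.
Hypothesis disj : forall i j a b, (i < j)%N -> U a -> U b -> it i a <> it j b.
Hypothesis fb1 : frontier W b1.
Implicit Types (z w x y a v : C) (s e M rho : R) (k l j n m : nat).

Let fe : centire f. Proof. exact: ft.1. Qed.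
Let fn : nonconst f. Proof. exact: transc_nonconst. Qed.
Let itc k z : ccont (it k) z. Proof. exact: iter_cont. Qed.
Let cover_disc := covering fe Uc UF Wo Wb bdU Wp nFp.

Lemma max_on_closure k M : (forall x, frontier W x -> cmod (it k x) <= M) ->
  forall x, closure W x -> cmod (it k x) <= M.
Proof.
move=> H x cx; apply: (@max_principle R W (it k) M r Wo Wb) => // z.
  by move=> _; exact: centire_iter.
by move=> cz nz; exact: H.
Qed.

Lemma image_limit (g : C -> C) v : (forall z, ccont g z) ->
  (forall e, 0 < e -> exists2 y, W y & cmod (g y - v) < e) -> exists2 y, closure W y & g y = v.
Proof.
move=> gc H.
have /choice [u hu] n : exists y, W y /\ cmod (g y - v) < n.+1%:R^-1.
  by have [|y Wy hy] := H (n.+1%:R^-1); [rewrite invr_gt0|exists y].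
have [phi hphi [l hl]] := bwC (fun n => Wb (hu n).1); exists l.
  by apply/closureC => e e0; have [n hn] := hl e e0; exists (u (phi n)); [exact: (hu _).1|exact: hn].
apply/eqP; rewrite -subr_eq0 -cmod_eq0 eq_le cmod_ge0 andbT; apply/ler_addgt0Pr => e e0; rewrite add0r.
have e2 : 0 < e / 2 by rewrite divr_gt0.
have [d d0 hd] := gc l (e / 2) e2; have [n hn] := hl d d0.
pose n2 := maxn n (Num.truncn (e / 2)^-1).
apply: le_trans (cmod_tri _ _ (g (u (phi n2)))) _; rewrite cmodB.
have h1 := hd _ (hn n2 (leq_maxl _ _)).
have h2 : cmod (g (u (phi n2)) - v) < e / 2.
  apply: lt_le_trans (hu _).2 _; rewrite invf_ple ?posrE ?ltr0n //.
  apply: le_trans (ltW (truncnS_gt _)) _; rewrite ler_nat ltnS.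
  by apply: leq_trans (homo_ge hphi _); exact: leq_maxr.
lra.
Qed.

Lemma iter_bound N : exists B, forall m, (m <= N)%N -> forall z, closure W z -> cmod (it m z) <= B.
Proof.
have one m : exists B, forall z, closure W z -> cmod (it m z) <= B.
  have cW : closed (closure W) by exact: closed_closure.
  have [||z cz hz] := @compact_max R (closure W) r (fun z => cmod (it m z)) cW (closure_bounded_by Wb).
  - by exists p; exact: subset_closure.
  - by move=> z _ e e0; have [d d0 hd] := cmod_cont (itc m z) e0; exists d => // w _; exact: hd.
  - by exists (cmod (it m z)).
elim: N => [|N [B hB]]; first by have [B hB] := one 0%N; exists B => m; rewrite leqn0 => /eqP ->.
have [B' hB'] := one N.+1; exists (Num.max B B') => m; rewrite leq_eqVlt => /orP[/eqP ->|mN] z cz; rewrite le_max.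
  by rewrite hB' ?orbT.
by rewrite hB.
Qed.

(* An image [it (n + j) @` U] meeting [it n @` W] would lie inside it, by disjointness from
   [it n @` U], and the maximum principle would then bound all iterates on [W]. *)
Lemma later_disjoint n j a y : (0 < j)%N -> U a -> W y -> it n y <> it (n + j) a.
Proof.
move=> j0 Ua Wy E.
(* Openness comes from open mapping. For closedness, a limit value is attained on the closure of
   [W], and not on its frontier, which lies in [U], by [disj]. *)
have sub z : U z -> exists2 y, W y & it n y = it (n + j) z.
  apply: (@connected_ind R U [set z | exists2 y, W y & it n y = it (n + j) z] Uc).
  - by exists a => //; exists y.
  - move=> z' Uz [y' Wy' E']; have [e e0 he] := (openC W).1 Wo y' Wy'.
    have [d d0 hd] := open_mapping y' (centire_iter n fe) (nonconst_iter n fe fn) e0.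
    have [d' d'0 hd'] := itc (n + j) z' d0; exists d' => // w wz _.
    have [|x xy Ex] := hd (it (n + j) w); first by rewrite E'; exact: hd'.
    by exists x; [exact: he|rewrite Ex].
  - move=> z' Uz H; have [|x cx E'] := @image_limit (it n) (it (n + j) z') (itc n).
      move=> e e0; have [d d0 hd] := itc (n + j) z' e0; have [w wz [_ [x Wx E']]] := H d d0.
      by exists x => //; rewrite E'; exact: hd.
    have [Wx|nWx] := pselect (W x); first by exists x.
    by exfalso; apply: (@disj n (n + j)%N x z') => //; [rewrite -[ltnLHS]addn0 ltn_add2l|exact: bdU].
have [B hB] := iter_bound (n + j).
(* On the frontier, [sub] rewrites the [i]-th iterate as the iterate of index [i - j] at a point of
   [W], so the bound descends by strong induction. *)
have all i : forall x, closure W x -> cmod (it i x) <= B.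
  elim/ltn_ind: i => i IH; apply: max_on_closure => x [cx nx].
  have [iN|iN] := leqP i (n + j); first exact: hB.
  have [y' Wy' E'] := sub x (bdU cx nx).
  rewrite -(subnK (ltnW iN)) iterD -E' -iterD; apply: IH; last exact: subset_closure.
  by move: j0 iN; clear; lia.
have B0 : 0 <= B by apply: le_trans (cmod_ge0 _) (all 0%N p _); exact: subset_closure.
have [k [_ hk _]] := cover_disc B0.
by have := hk b1 fb1; have := all k b1 fb1.1; lra.
Qed.

Lemma escape s : exists N, forall m, (N <= m)%N -> forall a, U a -> s < cmod (it m a).
Proof.
have [k [k0 _ hk]] := cover_disc (normr_ge0 s); exists k.+1 => m km a Ua; rewrite ltNge; apply/negP => h.
have [y Wy E] := hk (it m a) (le_trans h (ler_norm s)).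
apply: (@later_disjoint k (m - k) a y) => //; first by rewrite subn_gt0.
by rewrite subnKC // ltnW.
Qed.

(** The image of [W] under [it k] contains the disc of radius [expR (8 * T)], so the frontier bound
    [M] controls [it n] on that disc. Near a zero [a] of [it k] only the disc of radius [expR T] is
    reached, and [iter_growth] compares the two. *)
Lemma slow_disc : exists m0 a s, [/\ 0 < s, forall z, cmod (z - a) < s -> W z &
  forall n z M, cmod (z - a) < s -> (forall x, frontier W x -> cmod (it (n + m0) x) <= M) ->
    cmod (it (n + m0) z) ^+ 4 <= M].
Proof.
have [T [T1 hT]] := iter_growth ft.
have [k [k0 _ hk]] := cover_disc (expR_ge0 (8 * T)).
have [a Wa a0] : exists2 z, W z & it k z = 0 by apply: hk; rewrite cmod0 expR_ge0.
have [s1 s10 hs1] := (openC W).1 Wo a Wa.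
have [s2 s20 hs2] := itc k a (expR_gt0 T).
exists k, a, (Num.min s1 s2); split; first by rewrite lt_min s10.
  by move=> z; rewrite lt_min => /andP[/hs1].
move=> n z M; rewrite lt_min => /andP[_ /hs2]; rewrite a0 subr0 => hz H.
have ge : centire (it n) by exact: centire_iter.
have gn : nonconst (it n) by exact: nonconst_iter.
rewrite iterD; have h1 := maxmod_le ge (ltW hz).
have [_ [v vE v']] := maxmod_attained ge (expR_ge0 (8 * T)).
have h2 : maxmod (it n) (expR (8 * T)) <= M.
  have [y Wy E] : exists2 z, W z & it k z = v by apply: hk; rewrite vE.
  by rewrite -v' -E -iterD; apply: max_on_closure => //; exact: subset_closure.
have m1 : 0 < maxmod (it n) (expR T) by apply: maxmod_gt0 => //; exact: expR_gt0.
have m2 : 0 < maxmod (it n) (expR (8 * T)) by apply: maxmod_gt0 => //; exact: expR_gt0.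
apply: le_trans h2; apply: le_trans (_ : maxmod (it n) (expR T) ^+ 4 <= _).
  by apply: lerXn2r; rewrite ?nnegrE ?cmod_ge0 // ltW.
rewrite -ler_ln ?posrE ?exprn_gt0 // lnXn //.
by have := hT T n (lexx _); rewrite /lmax (mulr_natl (ln (maxmod (it n) (expR T))) 4).
Qed.

End Escape.

(** * Oscillation of the logarithms and covered annuli *)

Section OneFunction.
Variable R : realType.
Local Notation C := (R[i]).
Implicit Types (g G : C -> C) (z w x a : C) (r s e A B c rho u : R) (p : nat).

Lemma geometric_small (q e : R) : 0 <= q -> q < 1 -> 0 < e -> exists p, q ^+ p < e.
Proof.
move=> q0 q1 e0; have : (fun n => q ^+ n) @ \oo --> (0 : R) by apply: cvg_expr; rewrite ger0_norm.
move=> /cvgrPdist_lt /(_ e e0)[N _ hN]; exists N.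
by have := hN N (leqnn _); rewrite /= sub0r normrN ger0_norm // exprn_ge0.
Qed.

Lemma expR_ln_pow (q : R) p : 0 < q -> q ^+ p = expR (p%:R * ln q).
Proof. by move=> q0; rewrite expRM_natl lnK. Qed.

(** The power [P], close to [tau * L], spends half of the gap [1 - c] on the growth [kap] of the
    inner term and gains [lam] per unit on the outer one. Rounding costs one [lam], absorbed since
    [L > 4 / tau]. *)
Lemma exponent_balance (c kap lam L P tau : R) : 0 < kap -> 0 < lam -> c < 1 -> 0 < L ->
  tau = (1 - c) / (2 * kap) -> 4 / tau < L -> P <= tau * L -> tau * L < P + 1 ->
  c * L + P * kap <= (1 + c) / 2 * L /\
  (1 + tau * lam / 4) * L - P * lam <= (1 - tau * lam / 2) * L.
Proof.
move=> kap0 lam0 c1 L0 tE L4 P1 P2.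
have tau0 : 0 < tau by rewrite tE divr_gt0 ?mulr_gt0 // subr_gt0.
have tk : tau * L * kap = (1 - c) / 2 * L by rewrite tE; field; rewrite gt_eqF.
split.
  have : P * kap <= tau * L * kap by rewrite ler_wpM2r // ltW.
  by rewrite tk; clear -c1; lra.
have a1 : (tau * L - 1) * lam <= P * lam by rewrite ler_wpM2r ?(ltW lam0) // lerBlDr ltW.
have a2 : 4 / tau * (tau * lam) <= L * (tau * lam) by rewrite ler_wpM2r ?(ltW L4) // mulr_ge0 // ltW.
have a3 : 4 / tau * (tau * lam) = 4 * lam by field; rewrite gt_eqF.
by rewrite a3 in a2; clear -a1 a2; lra.
Qed.

(** Three circles with radii [rho / 2] and [3 / 2 * s], evaluated up to [5 / 4 * s]; the bases of
    the powers are the ratios of these radii. *)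
Lemma hadamard_spread g w s rho A B p : 0 < rho <= s -> (forall x, cmod (x - w) < 2 * s -> cdiff g x) ->
  (forall x, cmod (x - w) < rho -> cmod (g x) <= A) ->
  (forall x, cmod (x - w) <= 3 / 2 * s -> cmod (g x) <= B) ->
  forall x, cmod (x - w) <= 5 / 4 * s ->
  cmod (g x) <= Num.max (A * (5 * s / (2 * rho)) ^+ p) (B * (5 / 6) ^+ p).
Proof.
move=> /andP[rho0 rs] gd gA gB x xs; have s0 : 0 < s by apply: lt_le_trans rs.
have A0 : 0 <= A by apply: le_trans (cmod_ge0 _) (gA w _); rewrite subrr cmod0.
have B0 : 0 <= B by apply: le_trans (cmod_ge0 _) (gB w _); rewrite subrr cmod0; lra.
have K1 : 1 <= 5 * s / (2 * rho) by rewrite ler_pdivlMr; lra.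
have [xr|xr] := ltP (cmod (x - w)) (rho / 2).
  rewrite le_max; apply/orP; left; apply: le_trans (gA x _) _; first lra.
  by rewrite ler_peMr // exprn_ege1.
have h : cmod (g x) <= Num.max (A * (cmod (x - w) / (rho / 2)) ^+ p) (B * (cmod (x - w) / (3 / 2 * s)) ^+ p).
  apply: three_circles; [lra|exact: A0|exact: B0| | | |].
  - by move=> z /andP[_ zs]; apply: gd; lra.
  - by move=> z zs; apply: gA; lra.
  - by move=> z zs; apply: gB; lra.
  - by apply/andP; split; lra.
apply: le_trans h _; rewrite ge_max !le_max; apply/andP; split; apply/orP; [left|right].
  rewrite ler_wpM2l //; apply: lerXn2r; rewrite ?nnegrE ?divr_ge0 ?cmod_ge0 //; try lra.
  rewrite ler_pdivrMr; last lra.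
  have -> : 5 * s / (2 * rho) * (rho / 2) = 5 / 4 * s by field; rewrite gt_eqF.
  exact: xs.
rewrite ler_wpM2l //; apply: lerXn2r; rewrite ?nnegrE ?divr_ge0 ?cmod_ge0 //; try lra.
by rewrite ler_pdivrMr; lra.
Qed.

(** A logarithm of [g] has positive real part because [|g| > 1], and Harnack's inequality bounds its
    variation by [2 * ln |g a|]; division by [ln |g a|] gives the bound 2. *)
Lemma log_normalized g a s : 0 < s -> (forall z, cmod (z - a) < 4 * s -> cdiff g z) ->
  (forall z, cmod (z - a) < 4 * s -> 1 < cmod (g z)) ->
  exists G, [/\ G a = 0,
    forall z, cmod (z - a) < 3 * s -> cdiff G z,
    forall z, cmod (z - a) < 3 * s -> g z = g a * cexp ((ln (cmod (g a)))%:C%C * G z),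
    forall z, cmod (z - a) < 3 * s -> ln (cmod (g z)) = ln (cmod (g a)) * (1 + complex.Re (G z)) &
    forall z, cmod (z - a) <= 3 / 2 * s -> cmod (G z) <= 2].
Proof.
move=> s0 gd g1.
have a0 t : 0 < t -> cmod (a - a) < t by rewrite subrr cmod0.
have [|z zs|F hF] := @log_branch R g a (3 * s) (4 * s) _ gd; first lra.
  by rewrite -cmod_gt0; apply: lt_trans (g1 z zs).
have lnE z : cmod (z - a) < 3 * s -> complex.Re (F z) = ln (cmod (g z)).
  by move=> zs; have [_ <-] := hF z zs; rewrite cmod_cexp expRK.
set u := ln (cmod (g a)).
have u0 : 0 < u by apply: ln_gt0; apply/g1/a0; lra.
have un : (u%:C%C : C) != 0 by rewrite -cmod_gt0 cmod_real gtr0_norm.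
exists (fun z => (F z - F a) * (u^-1)%:C%C); split.
- by rewrite subrr mul0r.
- move=> z zs; apply: cdiffM; last exact: cdiff_cst.
  by apply: cdiffB; [exact: (hF z zs).1|exact: cdiff_cst].
- move=> z zs; have [_ <-] := hF z zs; have [|_ <-] := hF a; first by apply: a0; lra.
  rewrite -cexpD; congr cexp; rewrite fmorphV.
  by rewrite mulrC divfK // addrC subrK.
- move=> z zs; rewrite cReM /= mulr0 subr0 cReB !lnE //; last by apply: a0; lra.
  by rewrite -/u; field; rewrite gt_eqF.
- move=> z zs; rewrite cmodM cmod_real gtr0_norm ?invr_gt0 // ler_pdivrMr //.
  have [|||h _] := @harnack R F a (3 * s) (fun z zs => (hF z zs).1) _ z _ _.
  + by move=> x xs; rewrite lnE //; apply/ln_gt0/g1; lra.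
  + lra.
  + lra.
  + by move: h; rewrite lnE //; apply: a0; lra.
Qed.

(** A one-sided bound on the real part of the normalised logarithm makes its modulus at most [4 * e]
    on the disc of radius [rho / 2]; three circles carry this outwards against the bound 2. *)
Lemma ratio_spread g w s rho e p : 0 < rho <= s -> 0 < e ->
  (forall z, cmod (z - w) < 4 * s -> cdiff g z) -> (forall z, cmod (z - w) < 4 * s -> 1 < cmod (g z)) ->
  (forall x, cmod (x - w) < rho -> ln (cmod (g x)) <= ln (cmod (g w)) * (1 + e)) ->
  forall x, cmod (x - w) <= 5 / 4 * s -> `|ln (cmod (g x)) - ln (cmod (g w))| <=
    ln (cmod (g w)) * Num.max (4 * e * (5 * s / rho) ^+ p) (2 * (5 / 6) ^+ p).
Proof.
move=> /andP[rho0 rs] e0 gd g1 ge x xs; have s0 : 0 < s by apply: lt_le_trans rs.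
have [G [Ga Gd GE lnE G2]] := log_normalized s0 gd g1.
have u0 : 0 < ln (cmod (g w)) by apply/ln_gt0/g1; rewrite subrr cmod0; lra.
rewrite lnE; last lra.
rewrite mulrDr mulr1 addrAC subrr add0r normrM gtr0_norm // ler_pM2l //.
apply: le_trans (cmod_re _) _.
have -> : 5 * s / rho = 5 * s / (2 * (rho / 2)) by congr (_ / _); lra.
apply: (@hadamard_spread G w s (rho / 2)) => //.
- by apply/andP; split; lra.
- by move=> y ys; apply: Gd; lra.
- move=> y yr; apply: (@borel_carath R G w rho e) => //.
  + by move=> z zr; apply: Gd; lra.
  + move=> z zr; have := ge z zr; rewrite lnE; last lra.
    by rewrite ler_pM2l // lerD2l.
  + lra.
  + lra.
Qed.

(** If [w] were omitted, [(G - w) / 3] would have modulus strictly between 0 and 1. At [x] it is at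
    least [c / 8], so at [a], where it is [|w| / 3], it would be at least [(c / 8) ^+ 3]. *)
Lemma image_disc G a s c w : 0 < s -> 0 < c -> G a = 0 -> (forall z, cmod (z - a) <= 3 / 2 * s -> cdiff G z) ->
  (forall z, cmod (z - a) <= 3 / 2 * s -> cmod (G z) <= 2) ->
  (exists2 x, cmod (x - a) < s / 2 & c <= cmod (G x)) ->
  cmod w < Num.min (1 / 2) (Num.min (c / 2) ((c / 8) ^+ 3)) ->
  exists2 z, cmod (z - a) < 3 / 2 * s & G z = w.
Proof.
move=> s0 c0 Ga Gd G2 [x xs cx]; rewrite !lt_min => /andP[w1 /andP[w2 w3]].
apply: contrapT => N.
have nz z : cmod (z - a) < 3 / 2 * s -> G z - w != 0.
  by move=> zs; rewrite subr_eq0; apply/eqP => E; apply: N; exists z.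
pose g z := (G z - w) * ((3 : R)^-1)%:C%C.
have g3 z : cmod (g z) = cmod (G z - w) / 3 by rewrite /g cmodM cmod_real gtr0_norm ?invr_gt0.
have := @small_at_center R g a s (3 / 2 * s) ltac:(lra).
move=> /(_ _ _ x) H.
have {H} h : cmod (g x) ^+ 3 <= cmod (g a).
  apply: H; last 2 first; [lra|lra| |].
  - move=> z zs; apply: cdiffM; last exact: cdiff_cst.
    by apply: cdiffB; [apply: Gd; exact: ltW|exact: cdiff_cst].
  - move=> z zs; rewrite g3; apply/andP; split; first by rewrite divr_gt0 // cmod_gt0 nz.
    by have := cmodD (G z) (- w); rewrite cmodN; have := G2 z (ltW zs); lra.
rewrite !g3 Ga sub0r cmodN in h.
have h1 : c / 8 <= cmod (G x - w) / 3 by have := cmod_subl (G x) w; lra.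
have h2 : (c / 8) ^+ 3 <= (cmod (G x - w) / 3) ^+ 3 by apply: lerXn2r; rewrite ?nnegrE //; lra.
by have := cmod_ge0 w; lra.
Qed.

End OneFunction.

(** * Spreading the ratio estimates over the two domains *)

Section Final.
Variables (R : realType) (f : R[i] -> R[i]) (U W : set (Cplx R)) (r : R) (z0 b1 : R[i]).
Local Notation C := (R[i]).
Local Notation it n := (iter n f).
Hypothesis ft : transc f.
Hypothesis Uo : open U.
Hypothesis Uc : connected U.
Hypothesis Wo : open W.
Hypothesis Wb : bounded_by W r.
Hypothesis Wc : connected W.
Hypothesis bdU : forall z, closure W z -> ~ W z -> U z.
Hypothesis fb1 : frontier W b1.
Hypothesis Uz0 : U z0.
Implicit Types (z w x y a v : C) (s e M rho c t : R) (k m : nat) (n : nat -> nat).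

Let fe : centire f. Proof. exact: ft.1. Qed.
Let itd k z : cdiff (it k) z. Proof. exact: centire_iter. Qed.

Definition lnmod k z : R := ln (cmod (it k z)).

(** Uniform convergence near [z] of the ratio of logarithms to 1, with a radius chosen before
    [e]. *)
Definition ratio1 n z := exists2 rho, 0 < rho & forall e, 0 < e -> exists K, forall k, (K <= k)%N ->
  forall x, cmod (x - z) < rho -> `|lnmod (n k) x - lnmod (n k) z0| <= e * lnmod (n k) z0.

Lemma ratio1_spread n : (forall k a, U a -> 1 < cmod (it (n k) a)) -> ratio1 n z0 ->
  forall z, U z -> ratio1 n z.
Proof.
move=> n1 h0 z Uz.
have L0 k : 0 < lnmod (n k) z0 by apply/ln_gt0/n1.
apply: (@connected_ind R U (ratio1 n) Uc _ _ _ z Uz) => [|x Ux [rho rho0 h]|x Ux H].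
- by exists z0.
- exists (rho / 2) => [|y xy _]; first lra.
  exists (rho / 2) => [|e e0]; first lra.
  have [K hK] := h e e0; exists K => k Kk v vy; apply: hK => //.
  by have := cmod_tri v x y; lra.
have [s5 s50 hs5] := (openC U).1 Uo x Ux.
pose s := s5 / 5; have s0 : 0 < s by rewrite /s; lra.
have [w wx [Uw [rho0 rho00 h]]] := H s s0.
have wU y : cmod (y - w) < 4 * s -> U y.
  by move=> yw; apply: hs5; have := cmod_tri y x w; rewrite /s in wx yw *; lra.
pose rho := Num.min rho0 s.
have rho1 : 0 < rho by rewrite lt_min rho00.
have rho2 : rho <= s by rewrite ge_min lexx orbT.
have rho3 : rho <= rho0 by rewrite ge_min lexx.
exists (s / 4) => [|e e0]; first lra.
(* The exponent [p] first makes the outer term small; then [e1] offsets the resulting power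
   [(5 * s / rho) ^+ p]. *)
have [p hp] : exists p, (5 / 6 : R) ^+ p < e / 8 by apply: geometric_small; lra.
have K0 : 0 < (5 * s / rho) ^+ p by rewrite exprn_gt0 // divr_gt0 // mulr_gt0.
pose e1 := e / 16 / (5 * s / rho) ^+ p.
have e10 : 0 < e1 by rewrite /e1 divr_gt0 // divr_gt0.
pose e' := Num.min (1 / 2) (Num.min (e / 4) (e1 / 4)).
have e'0 : 0 < e' by rewrite /e' !lt_min; apply/andP; split; [lra|apply/andP; split; lra].
have [a1 a2 a3] : [/\ e' <= 1 / 2, e' <= e / 4 & e' <= e1 / 4].
  by rewrite /e' !ge_min !lexx ?orbT.
have [K hK] := h e' e'0; exists K => k Kk y yx.
have yw : cmod (y - w) <= 5 / 4 * s by have := cmod_tri y w x; rewrite (cmodB x); lra.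
have hw : `|lnmod (n k) w - lnmod (n k) z0| <= e' * lnmod (n k) z0.
  by apply: hK => //; rewrite subrr cmod0.
set L := lnmod (n k) z0; have LL : 0 < L := L0 k.
set u := lnmod (n k) w in hw.
have uL : (1 - e') * L <= u <= (1 + e') * L by move: hw; rewrite ler_norml -/L => /andP[? ?]; apply/andP; split; lra.
have up v : cmod (v - w) < rho -> ln (cmod (it (n k) v)) <= ln (cmod (it (n k) w)) * (1 + e1).
  move=> vw; have := hK k Kk v (lt_le_trans vw rho3); rewrite ler_norml => /andP[_ h2].
  apply: le_trans (_ : (1 + e') * L <= _); first by rewrite -/(lnmod (n k) v); move: h2; rewrite -/L; lra.
  apply: le_trans (_ : (1 - e') * L * (1 + e1) <= _); last first.
    by rewrite ler_wpM2r //; [lra|case/andP: uL].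
  rewrite mulrAC ler_wpM2r ?(ltW LL) //.
  have : e1 * e' <= e1 * (1 / 2) by rewrite ler_wpM2l // ltW.
  by lra.
have := @ratio_spread R (it (n k)) w s rho e1 p ltac:(by rewrite rho1) e10 (fun v _ => itd (n k) v)
  (fun v vw => n1 k v (wU v vw)) up y yw.
set mx := Num.max _ _.
have mxe : mx <= e / 4.
  rewrite /mx ge_max; apply/andP; split; last lra.
  by rewrite /e1 mulrCA mulrA divfK ?gt_eqF //; lra.
rewrite -/(lnmod _ _) -/(lnmod _ _) -/u => h3.
have h4 : `|lnmod (n k) y - u| <= (e / 2) * L.
  apply: le_trans h3 _; apply: le_trans (_ : (3 / 2 * L) * (e / 4) <= _).
    apply: ler_pM => //; last 1 first.
    - have : e' * L <= 1 / 2 * L by rewrite ler_wpM2r // ltW.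
      by case/andP: uL => _; lra.
    - have : 0 <= (1 - e') * L by rewrite mulr_ge0 //; lra.
      by case/andP: uL; lra.
    - by rewrite /mx le_max; apply/orP; right; rewrite mulr_ge0 // exprn_ge0.
  have : 0 <= e * L by rewrite mulr_ge0 // ltW.
  lra.
have h5 : e' * L <= e / 4 * L by rewrite ler_wpM2r // ltW.
have h6 := ler_distD u (lnmod (n k) y) L; rewrite -/L in hw.
have : 0 <= e * L by rewrite mulr_ge0 // ltW.
lra.
Qed.

Definition low n z := exists2 rho, 0 < rho & exists2 c, c < 1 & exists K, forall k, (K <= k)%N ->
  forall x, cmod (x - z) < rho -> cmod (it (n k) x) <= expR (c * lnmod (n k) z0).

(** The upper bound [1 + e] on the ratio holds on all of [W] for every [e], so three circles with a
    power proportional to [L] trade a little of the inner gain for an outer gain. The constant [c]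
    worsens from disc to disc but stays below 1. *)
Lemma low_spread n a : (forall M, exists K, forall k, (K <= k)%N -> M < lnmod (n k) z0) ->
  (forall e, 0 < e -> exists K, forall k, (K <= k)%N -> forall x, W x ->
    cmod (it (n k) x) <= expR ((1 + e) * lnmod (n k) z0)) ->
  W a -> low n a -> forall z, W z -> low n z.
Proof.
move=> Linf top Wa la z Wz.
apply: (@connected_ind R W (low n) Wc _ _ _ z Wz) => [|x Wx [rho rho0 h]|x Wx H].
- by exists a.
- exists (rho / 2) => [|y xy _]; first lra.
  exists (rho / 2); first lra.
  have [c c1 [K hK]] := h; exists c => //; exists K => k Kk v vy; apply: hK => //.
  by have := cmod_tri v x y; lra.
have [s5 s50 hs5] := (openC W).1 Wo x Wx.
pose s := s5 / 5; have s0 : 0 < s by rewrite /s; lra.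
have [w wx [Ww [rho0 rho00 [c c1 [K1 hK1]]]]] := H s s0.
have wW y : cmod (y - w) < 4 * s -> W y.
  by move=> yw; apply: hs5; have := cmod_tri y x w; rewrite /s in wx yw *; lra.
pose rho := Num.min rho0 s.
have rho1 : 0 < rho by rewrite lt_min rho00.
have rho2 : rho <= s by rewrite ge_min lexx orbT.
have rho3 : rho <= rho0 by rewrite ge_min lexx.
pose q := 5 * s / (2 * rho); pose kap := ln q; pose lam : R := - ln (5 / 6).
have q1 : 1 < q by rewrite /q ltr_pdivlMr; lra.
have kap0 : 0 < kap by exact: ln_gt0.
have lam0 : 0 < lam by rewrite oppr_gt0; apply: ln_lt0; apply/andP; split; lra.
pose tau := (1 - c) / (2 * kap).
have tau0 : 0 < tau by rewrite divr_gt0; lra.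
pose e := tau * lam / 4; have e0 : 0 < e by rewrite /e divr_gt0 // mulr_gt0.
have [K2 hK2] := top e e0; have [K3 hK3] := Linf (4 / tau).
exists (s / 4); first lra.
exists (Num.max ((1 + c) / 2) (1 - tau * lam / 2)).
  by rewrite gt_max; have := mulr_gt0 tau0 lam0; move=> ?; apply/andP; split; lra.
exists (maxn K1 (maxn K2 K3)) => k; rewrite !geq_max => /and3P[k1 k2 k3] y yx.
have yw : cmod (y - w) <= 5 / 4 * s by have := cmod_tri y w x; rewrite (cmodB x); lra.
set L := lnmod (n k) z0; have L4 : 4 / tau < L := hK3 k k3.
have L0 : 0 < L by apply: lt_trans L4; rewrite divr_gt0.
pose P := Num.truncn (tau * L).
have P1 : P%:R <= tau * L by rewrite truncn_le // mulr_ge0 // ltW.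
have P2 : tau * L < P%:R + 1 by rewrite natr1 truncnS_gt.
have [A B] := (hK1 k k1, hK2 k k2).
apply: le_trans (@hadamard_spread R (it (n k)) w s rho (expR (c * L)) (expR ((1 + e) * L)) P _ _ _ _ y yw) _.
- by rewrite rho1.
- by move=> v _; exact: itd.
- by move=> v vw; apply: A; exact: lt_le_trans rho3.
- by move=> v vw; apply: B; apply: wW; lra.
have q0 : 0 < q by apply: lt_trans q1.
have qE : q ^+ P = expR (P%:R * kap) by exact: expR_ln_pow.
have lE : (5 / 6 : R) ^+ P = expR (- (P%:R * lam)).
  by rewrite /lam mulrN opprK; apply: expR_ln_pow; rewrite divr_gt0.
rewrite -/q qE lE -!expRD ge_max !ler_expR.
set c' := Num.max _ _.
have [c'1 c'2] : (1 + c) / 2 <= c' /\ 1 - tau * lam / 2 <= c' by rewrite !le_max !lexx orbT.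
have [h1 h2] := @exponent_balance R c kap lam L P%:R tau kap0 lam0 c1 L0 erefl L4 P1 P2.
by apply/andP; split; [apply: (le_trans h1)|apply: (le_trans h2)]; rewrite ler_wpM2r // ltW.
Qed.

Lemma ratio_oscillates t : 0 < t -> (forall z, cmod (z - z0) < t -> U z) ->
  (forall M, exists N, forall m, (N <= m)%N -> forall a, U a -> M < cmod (it m a)) ->
  (exists m0 a s, [/\ 0 < s, forall z, cmod (z - a) < s -> W z &
    forall k z M, cmod (z - a) < s -> (forall x, frontier W x -> cmod (it (k + m0) x) <= M) ->
    cmod (it (k + m0) z) ^+ 4 <= M]) ->
  exists2 c, 0 < c & exists N, forall m, (N <= m)%N -> exists2 x, cmod (x - z0) < t &
    c * lnmod m z0 < `|lnmod m x - lnmod m z0|.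
Proof.
move=> t0 tU esc [m0 [a [s [s0 sW slow]]]]; apply: contrapT => N.
have [N0 hN0] := esc 1.
(* One failing index for each constant [k.+1%:R^-1], large enough for moduli above 1 on [U] and for
   [it (n k)] to factor through [it m0]. *)
have /choice [n hn] k : exists m, (maxn k (N0 + m0) <= m)%N /\ forall x, cmod (x - z0) < t ->
    `|lnmod m x - lnmod m z0| <= k.+1%:R^-1 * lnmod m z0.
  apply: contrapT => N'; apply: N; exists (k.+1%:R^-1); first by rewrite invr_gt0.
  exists (maxn k (N0 + m0)) => m hm; apply: contrapT => N''; apply: N'; exists m; split=> // x xt.
  by rewrite leNgt; apply/negP => h; apply: N''; exists x.
have nk k : (k <= n k)%N by have [] := hn k; rewrite geq_max => /andP[].
have nm k : (N0 + m0 <= n k)%N by have [] := hn k; rewrite geq_max => /andP[].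
have n1 k v : U v -> 1 < cmod (it (n k) v) by apply: hN0; apply: leq_trans (nm k); exact: leq_addr.
have r0 : ratio1 n z0.
  exists t => // e e0; exists (Num.truncn e^-1) => k Kk x xt.
  have [_ h] := hn k; apply: le_trans (h x xt) _; rewrite ler_wpM2r //.
    by apply/ltW/ln_gt0/n1.
  rewrite invf_ple ?posrE ?ltr0n //.
  by apply: le_trans (ltW (truncnS_gt _)) _; rewrite ler_nat ltnS.
have rU := ratio1_spread n1 r0.
have Linf M : exists K, forall k, (K <= k)%N -> M < lnmod (n k) z0.
  have [K hK] := esc (expR M); exists K => k Kk.
  have := hK (n k) (leq_trans Kk (nk k)) z0 Uz0 => h.
  by rewrite /lnmod -ltr_expR lnK // posrE; apply: lt_trans h; exact: expR_gt0.
have topF e : 0 < e -> exists K, forall k, (K <= k)%N -> forall x, frontier W x ->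
    cmod (it (n k) x) <= expR ((1 + e) * lnmod (n k) z0).
  move=> e0; apply: (compact_uniform (frontier_closed Wo) (frontier_bounded Wb)) => x [cx nx].
  have Ux := bdU cx nx; have [rho rho0 h] := rU x Ux.
  exists rho => //; have [K hK] := h e e0; exists K => k Kk y [cy ny] yx.
  have y1 := n1 k y (bdU cy ny).
  have := hK k Kk y yx; rewrite ler_norml => /andP[_ h2].
  have y0 : 0 < cmod (it (n k) y) by apply: lt_trans y1.
  by rewrite -[leLHS]lnK ?posrE // ler_expR; rewrite /lnmod in h2 *; lra.
have top e : 0 < e -> exists K, forall k, (K <= k)%N -> forall x, W x ->
    cmod (it (n k) x) <= expR ((1 + e) * lnmod (n k) z0).
  move=> e0; have [K hK] := topF e e0; exists K => k Kk x Wx.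
  apply: (@max_on_closure R f W r ft Wo Wb) => [y fy|]; first exact: hK.
  exact: subset_closure.
(* Convergence to 1 is used with error 1 only: the exponent 2 on the frontier becomes 1/2 by the
   fourth power. *)
have la : low n a.
  exists s => //; exists (1 / 2); first lra.
  have [K hK] := topF 1 ltr01; exists K => k Kk x xa.
  have nE : n k = (n k - m0 + m0)%N by rewrite subnK // (leq_trans _ (nm k)) // leq_addl.
  have h : cmod (it (n k) x) ^+ 4 <= expR ((1 + 1) * lnmod (n k) z0).
    by rewrite {1}nE; apply: slow => // y fy; rewrite -nE; exact: hK.
  rewrite -(@ler_pXn2r _ 4) ?nnegrE ?cmod_ge0 ?expR_ge0 //; apply: le_trans h _.
  by rewrite -expRM_natl ler_expR; lra.
have lowW := low_spread Linf top (sW a ltac:(by rewrite subrr cmod0)) la.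
have [rho rho0 h] := rU b1 (bdU fb1.1 fb1.2).
have [d d0 hd] := (openC U).1 Uo b1 (bdU fb1.1 fb1.2).
(* Near [b1] there is a point of both [W] and [U], where the ratio is at most [c] and at least
   [(1 + c) / 2]. *)
have [|w Ww] := (closureC _ _).1 fb1.1 (Num.min rho d); first by rewrite lt_min rho0.
rewrite lt_min => /andP[wb /hd Uw].
have [rho' rho'0 [c c1 [K hK]]] := lowW w Ww.
have [K' hK'] := h ((1 - c) / 2) ltac:(lra).
have [K2 hK2] := Linf 0.
pose k := maxn K (maxn K' K2).
have L0 : 0 < lnmod (n k) z0 by apply: hK2; rewrite /k !leq_max leqnn !orbT.
have := hK k (leq_maxl _ _) w; rewrite subrr cmod0 => /(_ rho'0) h1.
have := hK' k _ w wb; rewrite /k leq_max leq_max leqnn orbT => /(_ isT); rewrite -/k ler_norml => /andP[h2 _].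
have w0 : 0 < cmod (it (n k) w) by apply: lt_trans (n1 k w Uw).
rewrite -[leLHS]lnK ?posrE // ler_expR -/(lnmod _ _) in h1.
have : c * lnmod (n k) z0 < (1 - (1 - c) / 2) * lnmod (n k) z0 by rewrite ltr_pM2r //; lra.
lra.
Qed.

End Final.

(** * The covered annulus *)

Lemma transcendental_transc (R : realType) (f : Cplx R -> Cplx R) : transcendental_entire f -> transc f.
Proof. by move=> [fd fp]; split=> // z; exact: cder_derivable. Qed.

Theorem theorem1p2 (R : realType) (f : Cplx R -> Cplx R) (U : set (Cplx R))
    (hf : transcendental_entire f)
    (hU : wandering_domain f U) (hUm : multiply_connected U)
    (z0 : Cplx R) (hz0 : U z0)
    (D : set (Cplx R)) (hD : open D) (hDU : D `<=` U) (hDz0 : D z0) :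
  exists alpha : R, 0 < alpha /\
    \forall n \near \oo,
      iter n f @` D `<=` iter n f @` U /\
      annulus (cmod (iter n f z0) `^ (1 - alpha))
              (cmod (iter n f z0) `^ (1 + alpha)) `<=` iter n f @` D.
Proof.
have ft := transcendental_transc hf; have fe := ft.1; have fn := transc_nonconst ft.
have [FU _] := hU; have [UF Uc Umax] := Fatou_component_max FU.
have [[_ Uo _] _] := hUm.
have [W [r [Wo Wb Wc bdU [p Wp nFp]]]] := filled_domain hUm UF Umax.
have [b1 cb1 nb1] := bounded_open_boundary Wo Wb Wp.
have fb1 : frontier W b1 by [].
have disj i j a b : (i < j)%N -> U a -> U b -> iter i f a <> iter j f b.
  by move=> ij Ua Ub; exact: (wandering_disjoint fe fn hU ij Ua Ub).
have esc := escape ft Uc UF Wo Wb bdU Wp nFp disj fb1.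
have slow := slow_disc ft Uc UF Wo Wb bdU Wp nFp.
have [s5 s50 hs5] := (openC D).1 hD z0 hDz0.
pose s := s5 / 5; have s0 : 0 < s by rewrite /s; lra.
have sD z : cmod (z - z0) < 4 * s -> D z by move=> h; apply: hs5; rewrite /s in h; lra.
have sU z : cmod (z - z0) < s / 2 -> U z by move=> h; apply/hDU/sD; lra.
have [c c0 [N1 hN1]] : exists2 c, 0 < c & exists N, forall m, (N <= m)%N -> exists2 x, cmod (x - z0) < s / 2 &
    c * lnmod f m z0 < `|lnmod f m x - lnmod f m z0|.
  by apply: (ratio_oscillates ft Uo Uc Wo Wb Wc bdU fb1 hz0 _ sU esc slow); lra.
pose del := Num.min (1 / 2) (Num.min (c / 2) ((c / 8) ^+ 3)).
have del0 : 0 < del.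
  by rewrite /del !lt_min; apply/andP; split; [lra|apply/andP; split; [lra|rewrite exprn_gt0 //; lra]].
(* Beyond [N3] one has [pi < del / 2 * L], so half of the radius [del] accommodates every argument
   and the other half, [alpha], the change of modulus. *)
have [N2 hN2] := esc 1; have [N3 hN3] := esc (expR (2 * pi / del)).
exists (del / 2); split; first lra.
exists (maxn N1 (maxn N2 N3)) => // n; rewrite /= !geq_max => /and3P[n1 n2 n3].
split; first exact: image_subset.
set g := iter n f; pose L := ln (cmod (g z0)).
have g1 z : cmod (z - z0) < 4 * s -> 1 < cmod (g z) by move=> /sD/hDU; exact: hN2.
have gz1 : 1 < cmod (g z0) by exact: hN2.
have L0 : 0 < L by exact: ln_gt0.
have Lpi : 2 * pi / del < L.
  by rewrite -ltr_expR /L lnK ?posrE; [exact: hN3|lra].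
have [G [Ga Gd GE lnE G2]] := log_normalized s0 (fun z _ => centire_iter n fe z) g1.
have [x xs hx] := hN1 n n1.
have cG : c <= cmod (G x).
  have h : lnmod f n x = L * (1 + complex.Re (G x)) by apply: lnE; lra.
  move: hx; rewrite h -/(lnmod f n z0) -[lnmod f n z0]/L mulrDr mulr1 addrAC subrr add0r normrM gtr0_norm //.
  rewrite mulrC ltr_pM2l // => hx; apply/ltW/(lt_le_trans hx); exact: cmod_re.
have powE a : cmod (g z0) `^ a = expR (a * L) by rewrite /powR gt_eqF //; lra.
move=> zeta; rewrite /annulus /= !powE => /andP[z1 z2].
have zp : 0 < cmod zeta by apply: lt_trans z1; exact: expR_gt0.
have l1 : (1 - del / 2) * L < ln (cmod zeta) by rewrite -ltr_expR lnK.
have l2 : ln (cmod zeta) < (1 + del / 2) * L by rewrite -ltr_expR lnK.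
have gn0 : g z0 != 0 by rewrite -cmod_gt0; lra.
have zn0 : zeta / g z0 != 0 by rewrite mulf_neq0 ?invr_eq0 // -cmod_gt0.
have [t /andP[t1 t2] ht] := cexp_surj zn0.
(* A logarithm of [zeta / g z0]; dividing it by [L] gives the value that [G] has to take. *)
pose tau := Complex (ln (cmod (zeta / g z0))) t.
have lE : ln (cmod (zeta / g z0)) = ln (cmod zeta) - L.
  have gp : 0 < cmod (g z0) by apply: lt_trans gz1.
  by rewrite cmodM cmodV lnM ?posrE ?invr_gt0 // lnV ?posrE.
have tauL : cmod tau < del * L.
  apply: le_lt_trans (cmod_le _) _; rewrite /tau /= lE.
  have h1 : `|ln (cmod zeta) - L| < del / 2 * L by rewrite ltr_norml; apply/andP; split; lra.
  have h2 : `|t| <= pi by rewrite ler_norml t1.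
  have h3 : pi < del / 2 * L by move: Lpi; rewrite ltr_pdivrMr //; lra.
  by lra.
pose w := tau * (L^-1)%:C%C.
have wd : cmod w < del by rewrite /w cmodM cmod_real gtr0_norm ?invr_gt0 // ltr_pdivrMr.
have [|||z zs Gz] := @image_disc R G z0 s c w s0 c0 Ga _ _ _ wd.
- by move=> z zs; apply: Gd; lra.
- exact: G2.
- by exists x.
exists z; first by apply: sD; lra.
have L1 : (L%:C%C : R[i]) != 0 by rewrite -cmod_gt0 cmod_real gtr0_norm.
have -> : g z = g z0 * cexp (L%:C%C * G z) by apply: GE; lra.
have -> : L%:C%C * G z = tau by rewrite Gz /w fmorphV mulrC divfK.
by rewrite ht mulrC divfK.
Qed.
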